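(* Fix positive sequences $\delta_n \searrow 0$ and $\Delta_n \searrow 0$, sequences $K_n$, $s=s_n\ge1$, $p=p_n$, and constants $C>0$, $c>0$, $0<c'<1/2$, none of which depend on $\Pr$. Let $\mathbf{P}_n$ be the set of data-generating processes $\Pr$ for which the model and Condition HTE($\Pr$) described in the context hold. Then: (1) For any sequence $\Pr=\Pr_n\in\mathbf{P}_n$, $$\sigma_n^{-1}\sqrt{n}(\check\gamma-\gamma_0)\rightsquigarrow N(0,1),\qquad \sigma_n^2=\mathrm{E}\big[\tilde\varphi^2(\gamma_0,y_i,d_i,g(0,z_i),g(1,z_i),m(z_i),\mu)\big].$$ (2) The conclusion of (1) continues to hold with $\sigma_n^2$ replaced by $\hat\sigma_n^2:=\mathbb{E}_n\big[\tilde\varphi^2(\gamma_0,y_i,d_i,\hat g(0,z_i),\hat g(1,z_i),\hat m(z_i),\mu)\big]$. (3) For every $\xi\in(0,1)$, $$\lim_{n\to\infty}\sup_{\Pr\in\mathbf{P}_n}\Big|\Pr\big(\gamma_0\in[\check\gamma\pm\Phi^{-1}(1-\xi/2)\hat\sigma_n/\sqrt{n}]\big)-(1-\xi)\Big|=0,$$ where $\Phi$ is the standard normal cdf.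
   Context: Data: an i.i.d. sample $(y_i,d_i,z_i)_{i=1}^n$ on a probability space $(\Omega,\mathfrak F,\Pr)$ ($\Pr$ is called the data-generating process), with binary treatment $d_i\in\{0,1\}$, satisfying $$y_i = g(d_i,z_i)+\zeta_i,\ \mathrm{E}[\zeta_i\mid z_i,d_i]=0, \qquad d_i = m(z_i)+v_i,\ \mathrm{E}[v_i\mid z_i]=0.$$ Let $x_i = P(z_i)\in\mathbb{R}^p$ be a vector of technical controls, $\tilde x_i := (d_i x_i', (1-d_i)x_i')'$, and suppose $$y_i = \tilde x_i'\beta_{g0} + r_{gi} + \zeta_i,\qquad d_i = \Lambda(x_i'\beta_{m0}) + r_{mi} + v_i,$$ i.e. $g(d_i,z_i)=\tilde x_i'\beta_{g0}+r_{gi}$ and $m(z_i)=\Lambda(x_i'\beta_{m0})+r_{mi}$, where $\beta_{g0}=(\beta_{g0,1}',\beta_{g0,0}')'$, $r_{gi},r_{mi}$ are approximation errors, and $\Lambda(u)=u$ or $\Lambda(u)=e^u/(1+e^u)$. The target is the average treatment effect on the treated $\gamma_0=\mathrm{E}[g(1,z_i)-g(0,z_i)\mid d_i=1]$; let $\mu=\mathrm{E}[m(z_i)]=\Pr(d_i=1)$. Given estimators $\hat\beta_g=(\hat\beta_{g,1}',\hat\beta_{g,0}')'$ and $\hat\beta_m$ (e.g. post-Lasso estimators), set $\hat g(d,z)=d\,P(z)'\hat\beta_{g,1}+(1-d)P(z)'\hat\beta_{g,0}$, $\hat m(z)=\Lambda(P(z)'\hat\beta_m)$, $\hat\mu=\mathbb{E}_n[d_i]$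 ($\mathbb{E}_n$ = sample average). Define $$\tilde\varphi(\gamma,y,d,g_0,g_1,m,\mu)=\frac{d(y-g_1)}{\mu}-\frac{m(1-d)(y-g_0)}{(1-m)\mu}+\frac{d(g_1-g_0)}{\mu}-\gamma\frac{d}{\mu},$$ and let $\check\gamma$ solve $\mathbb{E}_n[\tilde\varphi(\check\gamma,y_i,d_i,\hat g(0,z_i),\hat g(1,z_i),\hat m(z_i),\hat\mu)]=0$. Notation: $\|w_i\|_{\Pr,q}$ is the $L^q(\Pr)$ norm; $\|w_i\|_{\mathbb{P}_n,q}=(n^{-1}\sum_{i=1}^n|w_i|^q)^{1/q}$; $\|\cdot\|_0$ counts nonzero entries, $\|\cdot\|_1$ is the $\ell_1$ norm. Condition HTE($\Pr$): (i) $\|r_{gi}\|_{\Pr,2}\le\delta_n n^{-1/4}$, $\|r_{gi}\|_{\Pr,\infty}\le\delta_n$, $\|r_{mi}\|_{\Pr,2}\le\delta_n n^{-1/4}$, $\|r_{mi}\|_{\Pr,\infty}\le\delta_n$. (ii) With $\Pr$-probability at least $1-\Delta_n$: $\|\tilde x_i'(\hat\beta_g-\beta_{g0})\|_{\mathbb{P}_n,2}\le\delta_n n^{-1/4}$, $\|x_i'(\hat\beta_m-\beta_{m0})\|_{\mathbb{P}_n,2}\le\delta_n n^{-1/4}$, $K_n\|\hat\beta_g-\beta_{g0}\|_1\le\delta_n$, $K_n\|\hat\beta_m-\beta_{m0}\|_1\le\delta_n$, $\|\hat\beta_g\|_0\le Cs$, $\|\hat\beta_m\|_0\le Cs$; moreover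 $\|\beta_{g0}\|_0\le Cs$, $\|\beta_{m0}\|_0\le Cs$, and $\sup_{\|\delta\|_0\le 2Cs}\big|\|\tilde x_i'\delta\|_{\mathbb{P}_n,2}/\|\tilde x_i'\delta\|_{\Pr,2}-1\big|\le\delta_n$. (iii) $\|x_{ij}\|_{\Pr,\infty}\le K_n$ for each $j$, $\|g\|_{\Pr,\infty}\le C$, $\|y_i\|_{\Pr,\infty}\le C$, $\Pr(c'\le m(z_i)\le1-c')=1$, and $\|\zeta_i^2\|_{\Pr,2}\ge c$. (iv) $(s\log(p\vee n))^2/n\le\delta_n$. *)

(* Defs.v *)
From HB Require Import structures.
From mathcomp Require Import all_boot all_order all_algebra.
From mathcomp Require Import all_classical all_reals all_analysis.
Set Implicit Arguments. Unset Strict Implicit. Unset Printing Implicit Defensive.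
Import Order.TTheory GRing.Theory Num.Theory.
Import numFieldNormedType.Exports.
Local Open Scope classical_set_scope.
Local Open Scope ring_scope.

Section defs.
Context {R : realType}.

Definition dotv {k} (u v : 'rV[R]_k) : R := \sum_(j < k) u 0 j * v 0 j.
Definition l1norm {k} (u : 'rV[R]_k) : R := \sum_(j < k) `|u 0 j|.
Definition l0norm {k} (u : 'rV[R]_k) : nat := #|[set j : 'I_k | u 0 j != 0]|.
Definition xtilde {k} (d : R) (x : 'rV[R]_k) : 'rV[R]_(k + k) :=
  row_mx (d *: x) ((1 - d) *: x).
Definition logistic (u : R) : R := expR u / (1 + expR u).

Definition phitilde (gam y d g0 g1 m mu : R) : R :=
  d * (y - g1) / mu - m * (1 - d) * (y - g0) / ((1 - m) * mu)
  + d * (g1 - g0) / mu - gam * d / mu.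

Definition Emp {n} (f : 'I_n -> R) : R := (\sum_(i < n) f i) / n%:R.
Definition empL2 {n} (f : 'I_n -> R) : R := Num.sqrt (Emp (fun i => f i ^+ 2)).

Definition Phi (t : R) : R := fine (normal_prob 0 1 `]-oo, t]).
Definition Phiinv (a : R) : R := xget 0 [set q : R | Phi q = a].

Definition iid_seq d (T : measurableType d) dV (V : measurableType dV)
    (P : probability T R) (X : nat -> T -> V) : Prop :=
  (forall i, measurable_fun setT (X i)) /\
  (forall i j (A : set V), measurable A -> P (X i @^-1` A) = P (X j @^-1` A)) /\
  (forall (k : nat) (A : nat -> set V), (forall i, measurable (A i)) ->
     P (\bigcap_(i in `I_k) (X i @^-1` A i)) = (\prod_(i < k) P (X i @^-1` A i))%E).

Definition cond_mean_zero d (T : measurableType d) dV (V : measurableType dV)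
    (P : probability T R) (W : T -> R) (F : T -> V) : Prop :=
  P.-integrable setT (EFin \o W) /\
  forall B : set V, measurable B ->
    ('E_P[fun w => (\1_(F @^-1` B) w * W w)%R] = 0)%E.

End defs.

(** * A data-generating process: a probability space carrying an i.i.d.
      sequence of observations (y_i, d_i, z_i), together with the regression
      function g(d,z) and propensity score m(z).  The sample of size n is the
      first n observations. *)
Record DGP (R : realType) (dZ : measure_display) (Zt : measurableType dZ) := {
  dgp_disp : measure_display;
  dgp_Om : measurableType dgp_disp;
  dgp_P : probability dgp_Om R;
  dgp_y : nat -> dgp_Om -> R;
  dgp_d : nat -> dgp_Om -> R;
  dgp_z : nat -> dgp_Om -> Zt;
  dgp_g : R -> Zt -> R;
  dgp_m : Zt -> R }.
Arguments dgp_disp {R dZ Zt} d.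
Arguments dgp_Om {R dZ Zt} d.
Arguments dgp_P {R dZ Zt} d.
Arguments dgp_y {R dZ Zt} d _ _.
Arguments dgp_d {R dZ Zt} d _ _.
Arguments dgp_z {R dZ Zt} d _ _.
Arguments dgp_g {R dZ Zt} d _ _.
Arguments dgp_m {R dZ Zt} d _.

Section dgp_defs.
Context {R : realType} {dZ : measure_display} {Zt : measurableType dZ}.
Variable D : DGP R Zt.
Local Notation Om := (dgp_Om D).
Local Notation P := (dgp_P D).
Local Notation y := (dgp_y D).
Local Notation d := (dgp_d D).
Local Notation z := (dgp_z D).
Local Notation g := (dgp_g D).
Local Notation m := (dgp_m D).

Definition obs (i : nat) (w : Om) : R * R * Zt := (y i w, d i w, z i w).
Definition sample (n : nat) (w : Om) : 'I_n -> R * R * Zt := fun i => obs i w.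
Definition zeta (i : nat) (w : Om) : R := y i w - g (d i w) (z i w).
Definition vres (i : nat) (w : Om) : R := d i w - m (z i w).
Definition mu0 : R := fine (P [set w | d 0 w = 1]).
Definition gamma0 : R :=
  fine ('E_P[fun w => (\1_[set w' | d 0 w' = 1] w * (g 1 (z 0 w) - g 0 (z 0 w)))%R])%E
  / fine (P [set w | d 0 w = 1]).
Definition sigma2 : R :=
  fine ('E_P[fun w => (phitilde gamma0 (y 0 w) (d 0 w) (g 0 (z 0 w))
                        (g 1 (z 0 w)) (m (z 0 w)) mu0 ^+ 2)%R])%E.
End dgp_defs.
Arguments obs {R dZ Zt} D i w.
Arguments sample {R dZ Zt} D n w.
Arguments zeta {R dZ Zt} D i w.
Arguments vres {R dZ Zt} D i w.
Arguments mu0 {R dZ Zt} D.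
Arguments gamma0 {R dZ Zt} D.
Arguments sigma2 {R dZ Zt} D.

Section plugin.
Context {R : realType} {Zt : Type} {k : nat}.
Definition ghat (Pd : Zt -> 'rV[R]_k) (b : 'rV[R]_(k + k)) (dd : R) (zz : Zt) : R :=
  dd * dotv (Pd zz) (lsubmx b) + (1 - dd) * dotv (Pd zz) (rsubmx b).
Definition mhat (Lam : R -> R) (Pd : Zt -> 'rV[R]_k) (b : 'rV[R]_k) (zz : Zt) : R :=
  Lam (dotv (Pd zz) b).
End plugin.

Definition est_eq {R : realType} {Zt : Type} {p n : nat} (Lam : R -> R)
  (Pd : Zt -> 'rV[R]_p) (bg : 'rV[R]_(p + p)) (bm : 'rV[R]_p)
  (w : 'I_n -> R * R * Zt) (gam : R) : R :=
  Emp (fun i => phitilde gam (w i).1.1 (w i).1.2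
     (ghat Pd bg 0 (w i).2) (ghat Pd bg 1 (w i).2) (mhat Lam Pd bm (w i).2)
     (Emp (fun j => (w j).1.2))).

Definition sigmahat2 {R : realType} {dZ} {Zt : measurableType dZ} {p : nat -> nat}
  (Lam : R -> R) (Pd : forall n, Zt -> 'rV[R]_(p n))
  (bg : forall n, ('I_n -> R * R * Zt) -> 'rV[R]_(p n + p n))
  (bm : forall n, ('I_n -> R * R * Zt) -> 'rV[R]_(p n))
  (D : DGP R Zt) (n : nat) (w : dgp_Om D) : R :=
  let S := sample D n w in
  Emp (fun i : 'I_n => phitilde (gamma0 D) (S i).1.1 (S i).1.2
     (ghat (Pd n) (bg n S) 0 (S i).2) (ghat (Pd n) (bg n S) 1 (S i).2)
     (mhat Lam (Pd n) (bm n S) (S i).2) (mu0 D) ^+ 2).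

Section classP.
Local Open Scope ring_scope.
Context {R : realType} {dZ : measure_display} {Zt : measurableType dZ}.
Variables (delta Delta K s : nat -> R) (p : nat -> nat) (C c c' : R).
Variables (Pd : forall n, Zt -> 'rV[R]_(p n)) (Lam : R -> R).
Variables (bg : forall n, ('I_n -> R * R * Zt) -> 'rV[R]_(p n + p n))
          (bm : forall n, ('I_n -> R * R * Zt) -> 'rV[R]_(p n))
          (gc : forall n, ('I_n -> R * R * Zt) -> R).

Definition inPn (n : nat) (D : DGP R Zt) : Prop :=
  let P := dgp_P D in
  let y := dgp_y D in let d := dgp_d D in let z := dgp_z D in
  let g := dgp_g D in let m := dgp_m D in
  let x := fun i w => Pd n (z i w) in
  let xt := fun i w => xtilde (d i w) (x i w) in
  let rate := delta n * (n%:R `^ (- 4^-1)) in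
  iid_seq P (obs D) /\
  (forall i w, d i w = 0 \/ d i w = 1) /\
  measurable_fun setT (g 0) /\ measurable_fun setT (g 1) /\ measurable_fun setT m /\
  cond_mean_zero P (zeta D 0) (fun w => (z 0 w, d 0 w)) /\
  cond_mean_zero P (vres D 0) (z 0) /\
  (forall j, measurable_fun setT (fun w => bg (sample D n w) 0 j)) /\
  (forall j, measurable_fun setT (fun w => bm (sample D n w) 0 j)) /\
  measurable_fun setT (fun w => gc (sample D n w)) /\
  exists (bg0 : 'rV[R]_(p n + p n)) (bm0 : 'rV[R]_(p n)),
    let rg := fun w => g (d 0 w) (z 0 w) - dotv (xt 0%N w) bg0 in
    let rm := fun w => m (z 0 w) - Lam (dotv (x 0%N w) bm0) in
    ('N[P]_2%:E[EFin \o rg] <= rate%:E)%E /\ (\forall w \ae P, `|rg w| <= delta n) /\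
    ('N[P]_2%:E[EFin \o rm] <= rate%:E)%E /\ (\forall w \ae P, `|rm w| <= delta n) /\
    (l0norm bg0)%:R <= C * s n /\ (l0norm bm0)%:R <= C * s n /\
    (exists E : set (dgp_Om D), measurable E /\ ((1 - Delta n)%:E <= P E)%E /\
      forall w, E w ->
        let bgh := bg (sample D n w) in let bmh := bm (sample D n w) in
        empL2 (fun i : 'I_n => dotv (xt i w) (bgh - bg0)) <= rate /\
        empL2 (fun i : 'I_n => dotv (x i w) (bmh - bm0)) <= rate /\
        K n * l1norm (bgh - bg0) <= delta n /\
        K n * l1norm (bmh - bm0) <= delta n /\
        (l0norm bgh)%:R <= C * s n /\ (l0norm bmh)%:R <= C * s n /\
        (forall v : 'rV[R]_(p n + p n), v != 0 -> (l0norm v)%:R <= 2 * C * s n ->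
          `| empL2 (fun i : 'I_n => dotv (xt i w) v)
             / fine ('N[P]_2%:E[EFin \o (fun w' => dotv (xt 0%N w') v)]) - 1 |
            <= delta n)) /\
    (forall j, \forall w \ae P, `|x 0%N w 0 j| <= K n) /\
    (\forall w \ae P, `|g 0 (z 0 w)| <= C /\ `|g 1 (z 0 w)| <= C) /\
    (\forall w \ae P, `|y 0 w| <= C) /\
    P [set w | c' <= m (z 0 w) <= 1 - c'] = 1%E /\
    (c%:E <= 'N[P]_2%:E[EFin \o (fun w => (zeta D 0 w ^+ 2)%R)])%E /\
    (s n * ln (maxn (p n) n)%:R) ^+ 2 / n%:R <= delta n.

End classP.

Definition cvg_dist_N01 {R : realType} {dZ} {Zt : measurableType dZ}
  (D : nat -> DGP R Zt) (T : forall n, dgp_Om (D n) -> R) : Prop :=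
  forall t : R, (fun n => fine (dgp_P (D n) [set w | T n w <= t])) @ \oo --> Phi t.
Arguments cvg_dist_N01 {R dZ Zt} D T.
Arguments sigmahat2 {R dZ Zt p} Lam Pd bg bm D n w.

(* Main.v *)
(** In the estimating function [phitilde] the regression [g 1] cancels, so that up to the factor
    [1 / mu] it is [psi - gamma d] with [psi = (y - g 0) (d - (1 - d) m / (1 - m))].  Replacing [g 0]
    and [m] by the plug-in estimators changes [psi] by terms linear in [x'(bg - bg0)] and
    [x'(bm - bm0)], whose weights are conditionally centred given the covariates because the score is
    orthogonal, and by second-order terms that the L2 rates make negligible.  The linear terms are
    [o(sqrt n)] uniformly over sparse directions, by Bernstein's inequality on a lattice net of sparse
    vectors; this replaces sample splitting.  The leading term is a normalized sum of bounded i.i.d.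
    variables, and Lindeberg's swapping argument against a Gaussian, with a logistic function
    smoothing the indicator of a half-line, bounds its distance to [Phi] by a quantity that depends
    only on [n] and on the constants of the class, which gives uniformity.  The variance estimator is
    handled by the sup-norm consistency of the plug-in score and a law of large numbers, and
    Slutsky's lemma in a quantitative form concludes. *)

Require Import Defs.
From HB Require Import structures.
From mathcomp Require Import all_boot all_order all_algebra.
From mathcomp Require Import all_classical all_reals all_analysis.
From mathcomp Require Import measurable_realfun lebesgue_Rintegral ring lra zify.
Import Order.TTheory GRing.Theory Num.Theory.
Import numFieldNormedType.Exports.
Local Open Scope classical_set_scope.
Local Open Scope ring_scope.
Set Implicit Arguments. Unset Strict Implicit. Unset Printing Implicit Defensive.

(** * Independent sums *)

(** Uniformity over the class shapes every statement: for [eps] there are a tolerance [eta] and a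
    rank [N], and only afterwards come the probability space, the dimension, the controls and the
    law of the sample. The estimators are arbitrary functions of the very sample that is summed, so
    they cannot be treated as fixed. All that is known of an estimation error is that it has at most
    [2 C s] nonzero entries and small norms; bounds are therefore proved for all such vectors on one
    event. The net has log-cardinality of order [s ln (maxn p n)], small against [sqrt n] by
    assumption, and a second moment [o(n^(-1/2))] leaves a Bernstein exponent of order [sqrt n];
    this balance is why the rate [n^(-1/4)] suffices. Bernstein's inequality asks for population
    moments while the rates are empirical: norm equivalence on sparse vectors converts one into the
    other, and overlap carries bounds from untreated units to the whole population. Dividing by the
    standard deviation is uniform because the moment condition on the residual keeps the variance of
    the score away from zero. *)

Section indep.
Context {R : realType} d (T : measurableType d) dV (V : measurableType dV)
  (P : probability T R).
Local Open Scope ereal_scope.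

(** The event [tau] stands for observations not yet summed and [c] for its probability; carrying it
    along is what lets the induction on the number of summands run. Agreement on rectangles extends
    to all measurable sets by uniqueness of the product measure. *)
Lemma scaled_prod_law (S : {mfun T >-> R}) (X : {mfun T >-> V})
    (tau : set T) (c : {nonneg R}) : measurable tau ->
  (forall A B, measurable A -> measurable B ->
    P (S @^-1` A `&` X @^-1` B `&` tau) = P (S @^-1` A) * P (X @^-1` B) * c%:num%:E) ->
  forall A' : set (R * V), measurable A' ->
    P ((fun w => (S w, X w)) @^-1` A' `&` tau) =
      c%:num%:E * (distribution P S \x distribution P X) A'.
Proof.
move=> mtau H A' mA'.
have mphi : measurable_fun setT (fun w => (S w, X w)).
  by apply/measurable_fun_pairP; split => //; exact: measurable_funPT.
pose phi : {mfun T >-> (R * V)%type} := HB.pack (fun w => (S w, X w))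
  (isMeasurableFun.Build _ _ _ _ _ mphi).
pose m0 := [the measure _ _ of pushforward (mrestr P mtau) phi]; pose m' := m0 mphi.
pose m1 := [the sigma_finite_measure _ _ of mscale c (distribution P S)].
have -> : P ((fun w => (S w, X w)) @^-1` A' `&` tau) = m' A' by [].
rewrite -(@product_measure_unique _ _ _ _ _ m1 (distribution P X) m')//.
  rewrite /product_measure1 ge0_integral_mscale//.
  by apply: measurable_fun_xsection.
move=> A B mA mB.
rewrite /m' /= /pushforward /mrestr/=.
have -> : (fun w => (S w, X w)) @^-1` (A `*` B) = S @^-1` A `&` X @^-1` B by [].
by rewrite H// /mscale/= /distribution /pushforward muleC muleA.
Qed.

Definition psum (X : nat -> T -> V) (f : V -> R) (k : nat) (w : T) : R :=
  \sum_(i < k) f (X i w).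

Lemma measurable_psum (X : nat -> T -> V) (f : V -> R) k :
  (forall i, measurable_fun setT (X i)) -> measurable_fun setT f ->
  measurable_fun setT (psum X f k).
Proof.
move=> mX mf; apply: measurable_sum => i.
exact: (measurableT_comp mf (mX i)).
Qed.

Lemma psumS (X : nat -> T -> V) (f : V -> R) k w :
  psum X f k.+1 w = (psum X f k w + f (X k w))%R.
Proof. by rewrite /psum big_ord_recr. Qed.

(** [iid_seq] only factorizes probabilities of boxes in the observations. Independence of a partial
    sum from the later observations comes by induction on [k], for tails of every length at once:
    [X k] is taken from the front of the tail and absorbed into the sum. *)
Lemma psum_tail_indep (X : nat -> T -> V) (f : V -> R) : iid_seq P X ->
  measurable_fun setT f ->
  forall k l (B : nat -> set V) A, (forall i, measurable (B i)) -> measurable A ->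
    P (psum X f k @^-1` A `&` \bigcap_(i in `I_l) (X (k + i)%N @^-1` B i)) =
    P (psum X f k @^-1` A) * \prod_(i < l) P (X (k + i)%N @^-1` B i).
Proof.
move=> [mX [idX indX]] mf; elim=> [|k IH] l B A mB mA.
  have -> : psum X f 0 = cst 0%R.
    by apply/funext => w; rewrite /psum big_ord0.
  rewrite preimage_cst; case: ifPn => _; last by rewrite set0I measure0 mul0e.
  by rewrite setTI probability_setT mul1e indX.
have mSk := measurable_psum k mX mf.
pose S : {mfun T >-> R} := HB.pack (psum X f k) (isMeasurableFun.Build _ _ _ _ _ mSk).
pose Xk : {mfun T >-> V} := HB.pack (X k) (isMeasurableFun.Build _ _ _ _ _ (mX k)).
pose A' := [set sv : R * V | A (sv.1 + f sv.2)%R].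
have mA' : measurable A'.
  rewrite -[A']setTI; apply: (_ : measurable_fun setT (fun sv : R * V => sv.1 + f sv.2)%R) => //.
  by apply: measurable_funD => //; exact: measurableT_comp.
have SE : psum X f k.+1 @^-1` A = (fun w => (S w, Xk w)) @^-1` A'.
  by apply/seteqP; split=> w /=; rewrite /A'/= psumS.
have step l' (C : nat -> set V) : (forall i, measurable (C i)) ->
    P (psum X f k.+1 @^-1` A `&` \bigcap_(i in `I_l') (X (k.+1 + i)%N @^-1` C i)) =
    \prod_(i < l') P (X (k.+1 + i)%N @^-1` C i) *
     (distribution P S \x distribution P Xk) A'.
  move=> mC; rewrite SE.
  have mp i : measurable (X (k.+1 + i)%N @^-1` C i).
    by rewrite -[X in measurable X]setTI; apply: (mX (k.+1 + i)%N).
  have pfin : \prod_(i < l') P (X (k.+1 + i)%N @^-1` C i) \is a fin_num.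
    by apply: prode_fin_num => i _; exact: fin_num_measure.
  have p0 : (0 <= fine (\prod_(i < l') P (X (k.+1 + i)%N @^-1` C i)))%R.
    by rewrite fine_ge0// prode_ge0.
  rewrite -[X in X * _]fineK//.
  apply: (@scaled_prod_law S Xk _ (NngNum p0)) => //.
    by apply: bigcap_measurableType => i _; exact: mp.
  move=> A1 B1 mA1 mB1 /=; rewrite fineK//.
  (* The constraint on [X k] becomes the first one of the tail, so the induction hypothesis applies
     with a tail longer by one. *)
  pose B2 i := if i is j.+1 then C j else B1.
  have mB2 i : measurable (B2 i) by case: i => //=.
  have := IH l'.+1 B2 A1 mB2 mA1.
  rewrite big_ord_recl/= addn0 -muleA.
  under [in X in _ = X -> _]eq_bigr do rewrite /bump/= add1n addnS -addSn.
  move=> <-; congr (P _); rewrite -setIA; congr (_ `&` _).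
  apply/seteqP; split=> w /=.
    move=> [Hk Hi] [|i] /= li; first by rewrite addn0.
    by rewrite addnS; exact: Hi.
  move=> H; split; first by have := H 0%N; rewrite addn0; apply.
  by move=> i li; have := H i.+1 li; rewrite addnS.
rewrite step// muleC; congr (_ * _).
(* With an empty tail the same identity shows that the product measure of [A'] is the probability
   that the longer sum lies in [A]. *)
have := step 0%N B mB.
rewrite big_ord0 mul1e => <-; congr (P _).
by rewrite II0 bigcap_set0 setIT.
Qed.

(** The last summand is replaced by an independent copy of [X 0], integrated separately. Both the
    exponential bound and the swapping argument use independence in this form; nonnegativity of [F]
    lets Tonelli's theorem dispense with integrability. *)
Lemma ge0_integral_psumS (X : nat -> T -> V) (f : V -> R) : iid_seq P X ->
  measurable_fun setT f -> forall k (F : R -> \bar R),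
  measurable_fun setT F -> (forall x, 0 <= F x) ->
  \int[P]_w F (psum X f k.+1 w) =
  \int[P]_w \int[P]_w' F (psum X f k w + f (X 0%N w'))%R.
Proof.
move=> iidX mf k F mF F0; have [mX [idX indX]] := iidX.
have mSk := measurable_psum k mX mf.
pose S : {mfun T >-> R} := HB.pack (psum X f k) (isMeasurableFun.Build _ _ _ _ _ mSk).
pose Xk : {mfun T >-> V} := HB.pack (X k) (isMeasurableFun.Build _ _ _ _ _ (mX k)).
pose X0 : {mfun T >-> V} := HB.pack (X 0%N) (isMeasurableFun.Build _ _ _ _ _ (mX 0%N)).
have mphi : measurable_fun setT (fun w => (S w, Xk w)).
  by apply/measurable_fun_pairP; split => //; exact: measurable_funPT.
have mG : measurable_fun setT (fun sv : R * V => F (sv.1 + f sv.2)%R).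
  apply: (measurableT_comp mF).
  by apply: measurable_funD => //; exact: measurableT_comp.
pose phi : {mfun T >-> (R * V)%type} := HB.pack (fun w => (S w, Xk w))
  (isMeasurableFun.Build _ _ _ _ _ mphi).
pose m' := distribution P phi.
transitivity (\int[m']_sv F (sv.1 + f sv.2)%R).
  rewrite ge0_integral_distribution//=.
  by apply: eq_integral => w _; rewrite psumS.
rewrite (eq_measure_integral (distribution P S \x distribution P Xk)); last first.
  move=> A mA _.
  have indSX A1 B1 : measurable A1 -> measurable B1 ->
      P (S @^-1` A1 `&` Xk @^-1` B1 `&` setT) =
      P (S @^-1` A1) * P (Xk @^-1` B1) * (1%:nng)%R%:num%:E.
    move=> mA1 mB1; rewrite setIT mule1.
    have := psum_tail_indep iidX mf k 1 (fun=> mB1) mA1.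
    rewrite big_ord1 addn0 => <-; congr (P (_ `&` _)).
    by rewrite II1 bigcap_set1 addn0.
  by have := scaled_prod_law measurableT indSX mA; rewrite setIT mul1e.
rewrite fubini_tonelli1//= ge0_integral_distribution//=; last 2 first.
- exact: measurable_fun_fubini_tonelli_F.
- by move=> x; apply: integral_ge0.
apply: eq_integral => w _; rewrite /fubini_F/=.
rewrite (eq_measure_integral (distribution P X0)); last first.
  by move=> A mA _; exact: idX.
rewrite ge0_integral_distribution//=.
by apply: (measurableT_comp mF); apply: measurable_funD.
Qed.

End indep.

(** * Real-valued expectations and almost surely bounded variables *)

Section expectation.
Context {R : realType} d (T : measurableType d) (P : probability T R).
Implicit Types (f g : T -> R) (c M : R).

Definition Ex f : R := Rintegral P setT f.
Definition ig f := P.-integrable setT (EFin \o f).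

Lemma igm f : ig f -> measurable_fun setT f.
Proof. by move=> /measurable_int /measurable_EFinP. Qed.

Lemma ig_cst c : ig (cst c).
Proof. exact: finite_measure_integrable_cst. Qed.

Lemma igD f g : ig f -> ig g -> ig (fun w => f w + g w).
Proof. by move=> fi gi; have := integrableD measurableT fi gi; apply: eq_integrable. Qed.

Lemma igB f g : ig f -> ig g -> ig (fun w => f w - g w).
Proof. by move=> fi gi; have := integrableB measurableT fi gi; apply: eq_integrable. Qed.

Lemma igZ c f : ig f -> ig (fun w => c * f w).
Proof. by move=> fi; have := integrableZl measurableT c fi; apply: eq_integrable. Qed.

Lemma ig_le f g : measurable_fun setT f -> (forall w, `|f w| <= `|g w|) ->
  ig g -> ig f.
Proof.
move=> mf fg; apply: le_integrable => //; first exact/measurable_EFinP.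
by move=> w _; rewrite !abse_EFin lee_fin.
Qed.

Lemma ig_norm f : ig f -> ig (fun w => `|f w|).
Proof. exact: integrable_norm. Qed.

Lemma ExD f g : ig f -> ig g -> Ex (fun w => f w + g w) = Ex f + Ex g.
Proof. by move=> fi gi; rewrite /Ex RintegralD. Qed.

Lemma ExB f g : ig f -> ig g -> Ex (fun w => f w - g w) = Ex f - Ex g.
Proof. by move=> fi gi; rewrite /Ex RintegralB. Qed.

Lemma ExZ c f : ig f -> Ex (fun w => c * f w) = c * Ex f.
Proof. by move=> fi; rewrite /Ex RintegralZl. Qed.

Lemma Ex_cst c : Ex (fun=> c) = c.
Proof. by rewrite /Ex Rintegral_cst//= probability_setT mulr1. Qed.

Lemma le_Ex f g : ig f -> ig g -> (forall w, f w <= g w) -> Ex f <= Ex g.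
Proof. by move=> fi gi fg; exact: le_Rintegral. Qed.

Lemma Ex_ge0 f : (forall w, 0 <= f w) -> 0 <= Ex f.
Proof. by move=> f0; apply: Rintegral_ge0. Qed.

Lemma Ex_norm f : ig f -> `|Ex f| <= Ex (fun w => `|f w|).
Proof. by move=> fi; exact: le_normr_Rintegral. Qed.

Lemma eq_Ex f g : f =1 g -> Ex f = Ex g.
Proof. by move=> fg; congr Ex; exact/funext. Qed.

Lemma Ex_EFin f : ig f -> (\int[P]_w (f w)%:E = (Ex f)%:E)%E.
Proof. by move=> fi; rewrite fineK//; exact: integrable_fin_num. Qed.

Lemma Ex_ae_eq f g : measurable_fun setT f -> measurable_fun setT g ->
  (\forall w \ae P, f w = g w) -> Ex f = Ex g.
Proof.
move=> mf mg fg; congr fine; apply: ae_eq_integral => //; try exact/measurable_EFinP.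
by apply: filterS fg => w -> _.
Qed.

Lemma ig_ae_eq f g : measurable_fun setT f -> measurable_fun setT g ->
  (\forall w \ae P, f w = g w) -> ig f -> ig g.
Proof.
move=> mf mg fg /integrableP[_ fi]; apply/integrableP; split; first exact/measurable_EFinP.
rewrite (_ : (\int[P]_x _ = \int[P]_x `|(EFin \o f) x|)%E)//.
apply: ae_eq_integral => //.
- by apply: measurableT_comp => //; exact/measurable_EFinP.
- by apply: measurableT_comp => //; exact/measurable_EFinP.
- by apply: filterS fg => w /= -> _.
Qed.

Lemma ae_le_Ex f g : ig f -> ig g -> (\forall w \ae P, f w <= g w) -> Ex f <= Ex g.
Proof.
move=> fi gi fg; rewrite -subr_ge0 -ExB//.
rewrite (@Ex_ae_eq _ (fun w => Num.max (g w - f w) 0)).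
- by apply: Ex_ge0 => w; rewrite le_max lexx orbT.
- by apply: measurable_funB; exact: igm.
- by apply: measurable_maxr => //; apply: measurable_funB; exact: igm.
- by apply: filterS fg => w fg; rewrite max_l// subr_ge0.
Qed.

(** The model bounds its variables only almost surely. This class is closed under sums, products and
    powers and consists of integrable functions, so integrability of any polynomial in the data
    follows from its syntax. *)
Definition aebd f := measurable_fun setT f /\ exists M, \forall w \ae P, `|f w| <= M.

Lemma aebd_ig f : aebd f -> ig f.
Proof.
move=> [mf [M fM]].
have mg : measurable_fun setT (fun w => if `|f w| <= M then f w else 0).
  apply: measurable_fun_ifT => //.
  by apply: measurable_fun_ler => //; exact: measurableT_comp.
apply: (ig_ae_eq mg mf); first by apply: filterS fM => w ->.
apply: (@ig_le _ (cst `|M|)) => //; last exact: ig_cst.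
move=> w /=; rewrite normr_id; case: ifPn => [|_]; last by rewrite normr0.
by move=> fM'; exact: le_trans (ler_norm _).
Qed.

Lemma aebd_cst c : aebd (cst c).
Proof. by split => //; exists `|c|; apply: aeW. Qed.

Lemma aebdD f g : aebd f -> aebd g -> aebd (fun w => f w + g w).
Proof.
move=> [mf [M fM]] [mg [N gN]]; split; first exact: measurable_funD.
exists (M + N); apply: filterS2 fM gN => w fM gN.
by rewrite (le_trans (ler_normD _ _))// lerD.
Qed.

Lemma aebdN f : aebd f -> aebd (fun w => - f w).
Proof.
move=> [mf [M fM]]; split; first exact: measurable_funN.
by exists M; apply: filterS fM => w; rewrite normrN.
Qed.

Lemma aebdB f g : aebd f -> aebd g -> aebd (fun w => f w - g w).
Proof. by move=> fb /aebdN gb; exact: aebdD. Qed.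

Lemma aebdM f g : aebd f -> aebd g -> aebd (fun w => f w * g w).
Proof.
move=> [mf [M fM]] [mg [N gN]]; split; first exact: measurable_funM.
exists (M * N); apply: filterS2 fM gN => w fM gN.
by rewrite normrM ler_pM.
Qed.

Lemma aebdX f n : aebd f -> aebd (fun w => f w ^+ n).
Proof.
move=> fb; elim: n => [|n IH]; first exact: aebd_cst.
by under [X in aebd X]eq_fun do rewrite exprS; exact: aebdM.
Qed.

Lemma aebd_sum (I : Type) (r : seq I) (F : I -> T -> R) :
  (forall i, aebd (F i)) -> aebd (fun w => \sum_(i <- r) F i w).
Proof.
move=> Fb; elim: r => [|i r IH].
  by under [X in aebd X]eq_fun do rewrite big_nil; exact: aebd_cst.
by under [X in aebd X]eq_fun do rewrite big_cons; exact: aebdD.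
Qed.

Lemma Ex_sum (I : Type) (r : seq I) (F : I -> T -> R) :
  (forall i, aebd (F i)) ->
  Ex (fun w => \sum_(i <- r) F i w) = \sum_(i <- r) Ex (F i).
Proof.
move=> Fb; elim: r => [|i r IH].
  rewrite big_nil -[RHS](Ex_cst 0); apply: eq_Ex => w; exact: big_nil.
rewrite big_cons -IH -ExD; [|exact: aebd_ig|exact/aebd_ig/aebd_sum].
by apply: eq_Ex => w; rewrite big_cons.
Qed.

End expectation.

(** * Smooth test functions *)

Section taylor.
Context {R : realType}.
Implicit Types (f : R -> R) (x u : R).

Lemma mvt_bound f f' (K u : R) :
  (forall y : R, is_derive y 1 f (f' y)) -> (forall y, `|y| <= `|u| -> `|f' y| <= K) ->
  `|f u - f 0| <= K * `|u|.
Proof.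
move=> df bf.
have cf : continuous f.
  by move=> y; apply/differentiable_continuous/derivable1_diffP; apply: ex_derive.
have cw a b : {within `[a, b], continuous f} by exact: continuous_subspaceT.
have [u0|u0] := leP 0 u.
  have [c + ->] := MVT_segment u0 (fun x _ => df x) (cw 0 u).
  rewrite in_itv/= => /andP[c0 cu]; rewrite subr0 normrM ler_wpM2r// bf//.
  by rewrite !ger0_norm.
have [c + E] := MVT_segment (ltW u0) (fun x _ => df x) (cw u 0).
rewrite in_itv/= => /andP[cu c0]; rewrite distrC E sub0r normrM normrN ler_wpM2r// bf//.
by rewrite !ler0_norm ?(ltW u0)// lerN2.
Qed.

(** Three mean-value inequalities in succession, for [f2], [f1] and [f], each costing a factor
    [|u|]. This yields [M] instead of the sharp [M / 6], and asks for a bound on [f3] only within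
    distance [|u|] of [x], so that the exponential is covered too. *)
Lemma taylor3 f f1 f2 f3 (M x u : R) :
  (forall y : R, is_derive y 1 f (f1 y)) -> (forall y : R, is_derive y 1 f1 (f2 y)) ->
  (forall y : R, is_derive y 1 f2 (f3 y)) ->
  (forall y, `|y| <= `|u| -> `|f3 (x + y)| <= M) ->
  `|f (x + u) - f x - u * f1 x - u ^+ 2 / 2 * f2 x| <= M * `|u| ^+ 3.
Proof.
move=> df df1 df2 b3.
have dsh (g g' : R -> R) : (forall y : R, is_derive y 1 g (g' y)) ->
    forall y : R, is_derive y 1 (fun v => g (x + v)) (g' (x + y)).
  move=> dg y; have h := dg (x + y).
  have h2 : is_derive y 1 (fun v : R => x + v) 1.
    by apply: is_derive_eq; rewrite /GRing.scale/=; ring.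
  by rewrite -[g' _]mulr1; exact: (is_derive1_comp h h2).
have M0 : 0 <= M.
  by apply: le_trans (b3 0 _); [exact: normr_ge0|rewrite normr0].
have dlin (c y : R) : is_derive y 1 (fun v : R => v * c) c.
  by apply: is_derive_eq; rewrite /GRing.scale/=; ring.
have dsqr (c y : R) : is_derive y 1 (fun v : R => v ^+ 2 / 2 * c) (y * c).
  by apply: is_derive_eq; rewrite /GRing.scale/=; field.
have B2 y : `|y| <= `|u| -> `|f2 (x + y) - f2 x| <= M * `|u|.
  move=> yu; have := @mvt_bound (fun v => f2 (x + v)) _ M y (dsh _ _ df2).
  rewrite addr0 => /(_ _)/le_trans; apply.
    by move=> v vy; apply: b3; exact: le_trans vy yu.
  by rewrite ler_wpM2l.
have B1 y : `|y| <= `|u| -> `|f1 (x + y) - f1 x - y * f2 x| <= M * `|u| ^+ 2.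
  move=> yu.
  have A1 (v : R) : is_derive v 1 (fun v => f1 (x + v) - v * f2 x) (f2 (x + v) - f2 x).
    exact: (is_deriveB (dsh _ _ df1 v) (dlin (f2 x) v)).
  have A2 v : `|v| <= `|y| -> `|f2 (x + v) - f2 x| <= M * `|u|.
    by move=> vy; apply: B2; exact: le_trans vy yu.
  have := mvt_bound A1 A2; rewrite addr0 mul0r subr0 addrAC => /le_trans; apply.
  by rewrite expr2 mulrA ler_wpM2l// mulr_ge0.
have A1 (v : R) : is_derive v 1 (fun v => f (x + v) - v * f1 x - v ^+ 2 / 2 * f2 x)
    (f1 (x + v) - f1 x - v * f2 x).
  exact: (is_deriveB (is_deriveB (dsh _ _ df v) (dlin (f1 x) v)) (dsqr (f2 x) v)).
have := mvt_bound A1 B1.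
rewrite addr0 expr0n !mul0r !subr0 -[_ * _ * `|u|]mulrA -exprSr.
have -> // : f (x + u) - u * f1 x - u ^+ 2 / 2 * f2 x - f x =
  f (x + u) - f x - u * f1 x - u ^+ 2 / 2 * f2 x by ring.
Qed.

(** The decreasing logistic function, a smooth stand-in for the indicator of a left half-line. Its
    derivatives [lgs1], [lgs2], [lgs3] are polynomials in [lgs] itself and are bounded by algebra
    alone. *)
Definition lgs x : R := (1 + expR x)^-1.
Definition lgs1 x : R := - (lgs x * (1 - lgs x)).
Definition lgs2 x : R := (2 * lgs x - 1) * lgs1 x.
Definition lgs3 x : R := 2 * lgs1 x * lgs1 x + (2 * lgs x - 1) * lgs2 x.

Lemma lgs01 x : 0 < lgs x < 1.
Proof.
have e0 := expR_gt0 x; rewrite /lgs invr_gt0 invf_lt1; lra.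
Qed.

Lemma is_derive_lgs x : is_derive x 1 lgs (lgs1 x).
Proof.
have e0 : 1 + expR x != 0 by rewrite gt_eqF// addr_gt0// expR_gt0.
have h : is_derive x 1 (fun x : R => 1 + expR x) (expR x).
  by apply: is_derive_eq; ring. 
have -> : lgs1 x = - (1 + expR x) ^- 2 *: expR x by rewrite /lgs1 /lgs /GRing.scale/=; field.
exact: is_deriveV.
Qed.

Lemma is_derive_lgs1 x : is_derive x 1 lgs1 (lgs2 x).
Proof.
have h := is_derive_lgs x.
by apply: is_derive_eq; rewrite /lgs2 /lgs1 /GRing.scale/=; ring.
Qed.

Lemma is_derive_lgs2 x : is_derive x 1 lgs2 (lgs3 x).
Proof.
have h := is_derive_lgs x; have h1 := is_derive_lgs1 x.
by apply: is_derive_eq; rewrite /lgs3 /GRing.scale/=; ring.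
Qed.

Lemma lgs3_le x : `|lgs3 x| <= 3.
Proof.
have /andP[s0 s1] := lgs01 x.
have b1 : `|lgs1 x| <= 1.
  rewrite /lgs1 normrN; have : 0 <= lgs x * (1 - lgs x) <= 1 by nra.
  by move=> /andP[h0 h1]; rewrite ger0_norm.
have b : `|2 * lgs x - 1| <= 1 by rewrite ler_norml; lra.
have b2 : `|lgs2 x| <= 1 by rewrite /lgs2 normrM mulr_ile1.
rewrite /lgs3; move: (lgs1 x) (lgs2 x) (2 * lgs x - 1) b1 b b2 => p q r p1 r1 q1.
rewrite (le_trans (ler_normD _ _))// -mulrA !normrM.
have -> : `|2| = 2 :> R by rewrite ger0_norm.
have h1 : `|p| * `|p| <= 1 by rewrite mulr_ile1.
have h2 : `|r| * `|q| <= 1 by rewrite mulr_ile1.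
lra.
Qed.

Lemma lgs_taylor x u :
  `|lgs (x + u) - lgs x - u * lgs1 x - u ^+ 2 / 2 * lgs2 x| <= 3 * `|u| ^+ 3.
Proof.
apply: taylor3; [exact: is_derive_lgs|exact: is_derive_lgs1|exact: is_derive_lgs2|].
by move=> y _; exact: lgs3_le.
Qed.

Lemma measurable_lgs : measurable_fun setT lgs.
Proof.
apply: continuous_measurable_fun => x.
by apply/differentiable_continuous/derivable1_diffP; have [] := is_derive_lgs x.
Qed.

Lemma expR_taylor u :
  `|expR u - 1 - u - u ^+ 2 / 2| <= expR `|u| * `|u| ^+ 3.
Proof.
have := @taylor3 expR expR expR expR (expR `|u|) 0 u.
rewrite add0r expR0 !mulr1; apply; try exact: is_derive_expR.
move=> y yu; rewrite add0r ger0_norm ?expR_ge0// ler_expR.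
exact: le_trans (ler_norm _) _.
Qed.

(** This is [1 + y <= expR y] at [y = t / 3], cubed; hence 27. *)
Lemma cube_le_expR (t : R) : 0 <= t -> t ^+ 3 <= 27 * expR t.
Proof.
move=> t0; have h := expR_ge1Dx (t / 3).
have : (t / 3) ^+ 3 <= expR (t / 3) ^+ 3 by rewrite lerXn2r// ?nnegrE ?expR_ge0//; lra.
by rewrite -expRM_natl [3%:R * _]mulrC divfK// expr_div_n; lra.
Qed.

End taylor.

(** * Gaussian integrals *)

Section gauss.
Context {R : realType}.
Local Notation mu := (@lebesgue_measure R).
Implicit Types (m s a b c : R) (F : R -> \bar R).

(** The Radon-Nikodym derivative of the normal law is only known abstractly; it equals the density
    almost everywhere because both have the same integral over every measurable set. *)
Lemma ge0_integral_normal_prob m s F : measurable_fun setT F ->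
  (forall x, 0 <= F x)%E ->
  (\int[normal_prob m s]_x F x = \int[mu]_x (F x * (normal_pdf m s x)%:E))%E.
Proof.
move=> mF F0.
have dom := normal_prob_dominates m s.
rewrite -(Radon_Nikodym_SigmaFinite.change_of_variables dom)//=.
apply: ae_eq_integral => //=.
- apply: emeasurable_funM => //; apply: (measurable_int mu).
  exact: Radon_Nikodym_SigmaFinite.f_integrable.
- apply: emeasurable_funM => //=; apply/measurable_EFinP.
  exact: measurable_normal_pdf.
- apply: ae_eqe_mul2l => /=.
  apply: integral_ae_eq => //=.
  + exact: Radon_Nikodym_SigmaFinite.f_integrable.
  + by apply/measurable_EFinP; exact: measurable_normal_pdf.
  + by move=> E _ mE; rewrite -Radon_Nikodym_SigmaFinite.f_integral.
Qed.

Lemma lebesgue_measure_shift (t : R) (A : set R) : measurable A ->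
  pushforward mu (fun x : R => x + t : measurableTypeR R) A = mu A.
Proof.
move=> mA.
have mt : measurable_fun setT (fun x : R => x + t : measurableTypeR R).
  exact: measurable_funD.
apply/esym/lebesgue_measure_unique => //= _ [[a b]] _ <-.
rewrite /pushforward [X in _ = mu X](_ : _ = `]a - t, b - t]%classic); last first.
  by apply/seteqP; split=> x /=; rewrite !in_itv/= ltrBlDr lerBrDr.
rewrite !lebesgue_measure_itv/= !lte_fin ltrD2r.
by case: ifPn => // _; rewrite -!EFinB; congr (_%:E); lra.
Qed.

Lemma ge0_integral_shift (t : R) F : measurable_fun setT F ->
  (forall x, 0 <= F x)%E -> (\int[mu]_x F (x + t)%R = \int[mu]_x F x)%E.
Proof.
move=> mF F0.
have mt : measurable_fun setT 
    (fun x : R => (x + t)%R : measurableTypeR R).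
  exact: measurable_funD.
transitivity (\int[pushforward mu
  (fun x : R => (x + t)%R : measurableTypeR R)]_x F x)%E.
  by rewrite ge0_integral_pushforward.
by apply: eq_measure_integral => //= A mA _; rewrite lebesgue_measure_shift.
Qed.

Lemma ge0_integral_opp F : measurable_fun setT F ->
  (forall x, 0 <= F x)%E -> (\int[mu]_x F (- x)%R = \int[mu]_x F x)%E.
Proof.
move=> mF F0.
have mt : measurable_fun setT 
    (-%R : measurableTypeR R -> measurableTypeR R).
  exact: oppr_measurable.
transitivity (\int[pushforward mu
  (-%R : measurableTypeR R -> measurableTypeR R)]_x F x)%E.
  by rewrite ge0_integral_pushforward.
by apply: eq_measure_integral => //= A mA _; rewrite lebesgue_measureN.
Qed.

Lemma normal_pdfN s x : s != 0 -> normal_pdf 0 s (- x) = normal_pdf 0 s x.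
Proof. by move=> s0; rewrite normal_pdfE// /normal_fun !subr0 sqrrN. Qed.

Lemma ge0_integral_normal_probN s F : s != 0 -> measurable_fun setT F ->
  (forall x, 0 <= F x)%E ->
  (\int[normal_prob 0 s]_x F (- x)%R = \int[normal_prob 0 s]_x F x)%E.
Proof.
move=> s0 mF F0.
have mFN : measurable_fun setT (fun x : R => F (- x)%R).
  by apply: (measurableT_comp mF); exact: oppr_measurable.
rewrite (ge0_integral_normal_prob _ _ mFN)// (ge0_integral_normal_prob _ _ mF)//.
transitivity (\int[mu]_x (F (- x)%R * (normal_pdf 0 s (- x))%:E))%E.
  by apply: eq_integral => x _; rewrite normal_pdfN.
apply: (@ge0_integral_opp (fun x => F x * (normal_pdf 0 s x)%:E)%E).
- apply: emeasurable_funM => //=; apply/measurable_EFinP.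
  exact: measurable_normal_pdf.
- by move=> x; rewrite mule_ge0// lee_fin normal_pdf_ge0.
Qed.

Lemma normal_peakE s : 0 < s -> normal_peak s = s^-1 * (Num.sqrt (pi *+ 2))^-1.
Proof.
move=> s0; rewrite /normal_peak -mulrnAr sqrtrM ?sqr_ge0//.
by rewrite sqrtr_sqr gtr0_norm// invfM.
Qed.

(** Completing the square. For independent centred Gaussians with standard deviations [a] and [b],
    the joint density of the first one and the sum is the density of the sum times a conditional
    density, with mean [a^2 y / c^2] and standard deviation [a b / c]. *)
Lemma normal_pdfM a b c y w : 0 < a -> 0 < b -> 0 < c ->
  c ^+ 2 = a ^+ 2 + b ^+ 2 ->
  normal_pdf 0 b (y - w) * normal_pdf 0 a w =
  normal_pdf 0 c y * normal_pdf (a ^+ 2 / c ^+ 2 * y) (a * b / c) w.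
Proof.
move=> a0 b0 c0 cE.
have s0 : 0 < a * b / c by rewrite divr_gt0// mulr_gt0.
rewrite !normal_pdfE ?gt_eqF// /normal_fun !subr0.
rewrite mulrACA [RHS]mulrACA -!expRD.
congr (_ * expR _).
  rewrite !normal_peakE//; set k := (Num.sqrt _)^-1.
  by field; rewrite !gt_eqF.
have -> : a ^+ 2 / c ^+ 2 * y = a ^+ 2 * y / c ^+ 2 by rewrite mulrAC.
rewrite exprMn exprVn cE !mulr2n.
have c2 : a ^+ 2 + b ^+ 2 != 0 by rewrite -cE expf_neq0// gt_eqF.
field; rewrite -!mulr2n !mulrn_eq0 c2 !expf_neq0 ?gt_eqF// ?mulr_gt0//. 
Qed.

(** After a shift by [w] and an exchange of the integrals, [normal_pdfM] leaves a normal density in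
    [w], of total mass one. *)
Lemma ge0_integral_normal_conv a b c F : 0 < a -> 0 < b -> 0 < c ->
  c ^+ 2 = a ^+ 2 + b ^+ 2 -> measurable_fun setT F -> (forall x, 0 <= F x)%E ->
  (\int[normal_prob 0 a]_w \int[normal_prob 0 b]_u F (w + u)%R =
   \int[normal_prob 0 c]_x F x)%E.
Proof.
move=> a0 b0 c0 cE mF F0.
have pdf0 m s x : (0 <= (normal_pdf m s x)%:E)%E by rewrite lee_fin normal_pdf_ge0.
have mpdf m s : measurable_fun setT (fun x : R => (normal_pdf m s x)%:E).
  by apply/measurable_EFinP; exact: measurable_normal_pdf.
have mF2 : measurable_fun setT (fun p : R * R => F (p.1 + p.2)%R).
  by apply: (measurableT_comp mF); apply: measurable_funD.
rewrite ge0_integral_normal_prob//; last 2 first.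
- exact: (@measurable_fun_fubini_tonelli_F _ _ _ _ _ (normal_prob 0 b)
    (fun p : R * R => F (p.1 + p.2)%R)).
- by move=> x; apply: integral_ge0.
pose G := fun p : R * R =>
  (F p.2 * (normal_pdf 0 b (p.2 - p.1) * normal_pdf 0 a p.1)%:E)%E.
have mG : measurable_fun setT G.
  apply: emeasurable_funM; first exact: measurableT_comp.
  apply/measurable_EFinP; apply: measurable_funM.
    apply: (measurableT_comp (measurable_normal_pdf 0 b)).
    exact: measurable_funB.
  exact: (measurableT_comp (measurable_normal_pdf 0 a)).
have G0 p : (0 <= G p)%E.
  by rewrite mule_ge0// lee_fin mulr_ge0// normal_pdf_ge0.
transitivity (\int[mu]_w \int[mu]_u G (w, u))%E.
  apply: eq_integral => w _.
  rewrite ge0_integral_normal_prob//; last first.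
    by apply: (measurableT_comp mF); apply: measurable_funD.
  rewrite -(@ge0_integral_shift w (fun u => G (w, u)))//; last first.
    exact: measurableT_comp.
  rewrite -ge0_integralZr//=.
  - apply: eq_integral => u _; rewrite /G/= addrC addrK EFinM muleA.
    by rewrite addrC.
  - apply: emeasurable_funM; last exact: mpdf.
    by apply: (measurableT_comp mF); apply: measurable_funD.
  - by move=> x _; rewrite mule_ge0.
rewrite (@fubini_tonelli _ _ (measurableTypeR R) (measurableTypeR R) R mu mu G)//.
rewrite (ge0_integral_normal_prob _ _ mF)//.
apply: eq_integral => u _; rewrite /G/=.
rewrite ge0_integralZl//=; last 2 first.
- apply/measurable_EFinP; apply: measurable_funM.
    apply: (measurableT_comp (measurable_normal_pdf 0 b)).
    exact: measurable_funB.
  exact: (measurableT_comp (measurable_normal_pdf 0 a)).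
- by move=> x _; rewrite lee_fin mulr_ge0// normal_pdf_ge0.
congr (_ * _)%E.
under eq_integral do rewrite (normal_pdfM _ _ a0 b0 c0 cE) EFinM.
rewrite ge0_integralZl//=; last exact: mpdf.
by rewrite [X in (_ * X)%E](_ : _ = 1%E) ?mule1//; exact: integral_normal_pdf.
Qed.

(** Exponential tilting: [expR (l x)] times the centred density is a constant multiple of the
    density with mean [l s^2]. *)
Lemma normal_mgf s l : 0 < s ->
  (\int[normal_prob 0 s]_x (expR (l * x))%:E = (expR (l ^+ 2 * s ^+ 2 / 2))%:E)%E.
Proof.
move=> s0.
have mE : measurable_fun setT (fun x : R => (expR (l * x))%:E).
  apply/measurable_EFinP.
  exact: (measurableT_comp (@measurable_expR R) (mulrl_measurable l)).
rewrite (ge0_integral_normal_prob _ _ mE); last first.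
  by move=> x; rewrite lee_fin expR_ge0.
transitivity (\int[mu]_x ((expR (l ^+ 2 * s ^+ 2 / 2))%:E *
    (normal_pdf (l * s ^+ 2) s x)%:E))%E.
  apply: eq_integral => x _; rewrite -!EFinM; congr _%:E.
  rewrite !normal_pdfE ?gt_eqF// /normal_fun mulrCA [RHS]mulrCA -!expRD.
  congr (_ * expR _); rewrite mulr2n.
  by field; rewrite -mulr2n mulrn_eq0 expf_neq0// gt_eqF.
rewrite ge0_integralZl//=.
- by rewrite [X in (_ * X)%E](_ : _ = 1%E) ?mule1//; exact: integral_normal_pdf.
- by apply/measurable_EFinP; exact: measurable_normal_pdf.
- by move=> x _; rewrite lee_fin normal_pdf_ge0.
Qed.

End gauss.

Section gauss_moments.
Context {R : realType}.
Variable s : R.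
Hypothesis s0 : 0 < s.
Local Notation N := (normal_prob 0 s).
Implicit Types (f : R -> R) (l : R).

Let sN0 : s != 0. Proof. by rewrite gt_eqF. Qed.

Lemma ig_normal_expR l : ig N (fun x => expR (l * x)).
Proof.
apply/integrableP; split.
  apply/measurable_EFinP.
  exact: (measurableT_comp (@measurable_expR R) (mulrl_measurable l)).
under eq_integral do rewrite /= ger0_norm ?expR_ge0//.
by rewrite /= normal_mgf// ltry.
Qed.

Lemma Ex_normal_expR l : Ex N (fun x => expR (l * x)) = expR (l ^+ 2 * s ^+ 2 / 2).
Proof. by rewrite /Ex /Rintegral normal_mgf. Qed.

Lemma Ex_normalN f : measurable_fun setT f ->
  Ex N (fun x => f (- x)) = Ex N f.
Proof.
move=> mf; rewrite /Ex /Rintegral; congr fine.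
have mf' : measurable_fun setT (EFin \o f) by exact/measurable_EFinP.
rewrite integralE [RHS]integralE.
rewrite -(ge0_integral_normal_probN sN0 (measurable_funepos mf'))//.
rewrite -(ge0_integral_normal_probN sN0 (measurable_funeneg mf'))//.
by congr (_ - _)%E; apply: eq_integral => x _; rewrite ?funeposE ?funenegE.
Qed.

(** Twice the hyperbolic cosine of [l x]. It dominates [expR (l |x|)] and has an explicit Gaussian
    mean, so it serves as the majorant for the moments below. *)
Let cosh2 l x : R := expR (l * x) + expR (- l * x).

Let ig_cosh2 l : ig N (cosh2 l).
Proof. by apply: igD; exact: ig_normal_expR. Qed.

Let Ex_cosh2 l : Ex N (cosh2 l) = 2 * expR (l ^+ 2 * s ^+ 2 / 2).
Proof.
rewrite ExD; [|exact: ig_normal_expR|exact: ig_normal_expR].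
by rewrite !Ex_normal_expR sqrrN; ring.
Qed.

Let expR_abs_cosh2 l x : 0 <= l -> expR (l * `|x|) <= cosh2 l x.
Proof.
move=> l0; rewrite /cosh2; have [x0|x0] := leP 0 x.
  by rewrite ger0_norm// lerDl expR_ge0.
by rewrite ltr0_norm// mulrN mulNr lerDr expR_ge0.
Qed.

Lemma ig_normal_cube : ig N (fun x => `|x| ^+ 3).
Proof.
apply: (@ig_le _ _ (measurableTypeR R) N _ (fun x => 27 * s ^+ 3 * cosh2 s^-1 x)).
- by apply: measurable_funX; exact: normr_measurable.
- move=> x; rewrite ger0_norm ?exprn_ge0//.
  have c0 : 0 <= cosh2 s^-1 x by rewrite /cosh2 addr_ge0 ?expR_ge0.
  have r0 : 0 <= 27 * s ^+ 3 * cosh2 s^-1 x.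
    by rewrite mulr_ge0// mulr_ge0// exprn_ge0// ltW.
  rewrite (ger0_norm r0).
  have sx0 : 0 <= s^-1 * `|x| by rewrite mulr_ge0// invr_ge0 ltW.
  have := cube_le_expR sx0.
  rewrite exprMn exprVn mulrC ler_pdivrMr ?exprn_gt0// => /le_trans; apply.
  rewrite [leRHS]mulrAC ler_wpM2r ?exprn_ge0 ?(ltW s0)// ler_wpM2l//.
  by apply: expR_abs_cosh2; rewrite invr_ge0 ltW.
- exact/igZ/ig_cosh2.
Qed.

(** The factor 54 is 27 from [cube_le_expR] times 2 from [cosh2], whose mean at scale [s^-1] is
    [2 expR (1/2)]. *)
Definition gauss_cube : R := 54 * expR 2^-1.

Lemma Ex_normal_cube : Ex N (fun x => `|x| ^+ 3) <= gauss_cube * s ^+ 3.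
Proof.
apply: (@le_trans _ _ (Ex N (fun x => 27 * s ^+ 3 * cosh2 s^-1 x))).
  apply: le_Ex; [exact: ig_normal_cube|exact/igZ/ig_cosh2|].
  move=> x; have sx0 : 0 <= s^-1 * `|x| by rewrite mulr_ge0// invr_ge0 ltW.
  have := cube_le_expR sx0.
  rewrite exprMn exprVn mulrC ler_pdivrMr ?exprn_gt0// => /le_trans; apply.
  rewrite [leRHS]mulrAC ler_wpM2r ?exprn_ge0 ?(ltW s0)// ler_wpM2l//.
  by apply: expR_abs_cosh2; rewrite invr_ge0 ltW.
rewrite ExZ ?Ex_cosh2//.
have -> : s^-1 ^+ 2 * s ^+ 2 / 2 = 2^-1 by rewrite exprVn mulVf ?mul1r// expf_neq0.
by rewrite /gauss_cube; lra.
Qed.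

Lemma ig_normal_id : ig N (fun x : R => x).
Proof.
apply: (@ig_le _ _ (measurableTypeR R) N _ (fun x : R => 1 + `|x| ^+ 3)).
- exact: measurable_id.
- move=> x; rewrite [leRHS]ger0_norm ?addr_ge0 ?exprn_ge0//.
  have := normr_ge0 x; move: `|x| => y y0.
  have [y1|/ltW y1] := leP y 1; first by rewrite (le_trans y1)// lerDl exprn_ge0.
  by rewrite (@le_trans _ _ (y ^+ 3))// ?lerDr// ler_eXnr.
- by apply: igD; [exact: ig_cst|exact: ig_normal_cube].
Qed.

Lemma ig_normal_sqr : ig N (fun x : R => x ^+ 2).
Proof.
apply: (@ig_le _ _ (measurableTypeR R) N _ (fun x : R => 1 + `|x| ^+ 3)).
- exact: exprn_measurable.
- move=> x; rewrite [leRHS]ger0_norm ?addr_ge0 ?exprn_ge0// normrX.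
  have := normr_ge0 x; move: `|x| => y y0.
  have [y1|/ltW y1] := leP y 1; first by rewrite (@le_trans _ _ 1)// ?exprn_ile1 ?lerDl ?exprn_ge0.
  by rewrite (@le_trans _ _ (y ^+ 3))// ?lerDr// ler_weXn2l.
- by apply: igD; [exact: ig_cst|exact: ig_normal_cube].
Qed.

Lemma Ex_normal_id : Ex N (fun x : R => x) = 0.
Proof.
have := @Ex_normalN (fun x => x) (@measurable_id _ _ setT).
have -> : Ex N (fun x : R => - x) = - Ex N (fun x : R => x).
  rewrite -mulN1r -ExZ; last exact: ig_normal_id.
  by apply: eq_Ex => x; rewrite mulN1r.
lra.
Qed.

Lemma Ex_normal_sqr : Ex N (fun x : R => x ^+ 2) = s ^+ 2.
Proof.
set V := Ex N _.
(* Expanding [E cosh (e U / s) = expR (e^2 / 2)] to second order in [e]. *)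
have key e : 0 < e -> e <= 1 ->
    `|V / s ^+ 2 - 1| <= (108 * expR 2 + 2) * e.
  move=> e0 e1.
  pose l := e / s.
  have l0 : 0 < l by rewrite divr_gt0.
  pose D x := cosh2 l x - 2 - l ^+ 2 * x ^+ 2.
  have Dle x : `|D x| <= 54 * e ^+ 3 * cosh2 (2 / s) x.
    have h1 := expR_taylor (l * x); have h2 := expR_taylor (- l * x).
    have -> : D x = (expR (l * x) - 1 - l * x - (l * x) ^+ 2 / 2) +
        (expR (- l * x) - 1 - - l * x - (- l * x) ^+ 2 / 2).
      by rewrite /D /cosh2; field.
    rewrite (le_trans (ler_normD _ _))//.
    have E : `|- l * x| = `|l * x| by rewrite mulNr normrN.
    rewrite E in h2.
    (* In the variable [x' = |x| / s] the cubic factor and the exponential of the Taylor remainder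
       are both absorbed by [expR (2 x')], hence by [cosh2] at scale [2 / s]. *)
    have [x' [x0 xE]] : exists x', 0 <= x' /\ `|l * x| = e * x'.
      exists (`|x| / s); split; first by rewrite divr_ge0// ltW.
      by rewrite normrM gtr0_norm// /l mulrAC -mulrA.
    have xE' : `|x| = s * x'.
      have : `|l * x| = l * `|x| by rewrite normrM gtr0_norm.
      rewrite xE /l => h; apply: (mulfI (lt0r_neq0 l0)); rewrite -h /l.
      by rewrite mulrA divfK.
    have h3 : expR `|l * x| * `|l * x| ^+ 3 <= 27 * e ^+ 3 * cosh2 (2 / s) x.
      rewrite xE exprMn.
      have c1 := cube_le_expR x0.
      have c2 : expR (e * x') <= expR x'.
        by rewrite ler_expR ler_piMl.
      have c3 : expR x' * expR x' <= cosh2 (2 / s) x.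
        rewrite -expRD.
        have -> : x' + x' = 2 / s * `|x| by rewrite xE' mulrA divfK// mulr2n mulrDl mul1r.
        by apply: expR_abs_cosh2; rewrite divr_ge0// ltW.
      have c4 : expR (e * x') * x' ^+ 3 <= 27 * cosh2 (2 / s) x.
        apply: (@le_trans _ _ (expR x' * (27 * expR x'))).
          by rewrite ler_pM// ?expR_ge0 ?exprn_ge0.
        by rewrite mulrCA ler_wpM2l.
      rewrite [leLHS](_ : _ = e ^+ 3 * (expR (e * x') * x' ^+ 3)); last by ring.
      rewrite [leRHS](_ : _ = e ^+ 3 * (27 * cosh2 (2 / s) x)); last by ring.
      by rewrite ler_wpM2l// exprn_ge0// ltW.
    lra.
  have igD : ig N D.
    apply: igB; last exact/igZ/ig_normal_sqr.
    by apply: igB; [exact: ig_cosh2|exact: ig_cst].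
  have ED : Ex N D = 2 * expR (e ^+ 2 / 2) - 2 - e ^+ 2 * (V / s ^+ 2).
    rewrite ExB; [|by apply: igB; [exact: ig_cosh2|exact: ig_cst]|exact/igZ/ig_normal_sqr].
    rewrite ExB; [|exact: ig_cosh2|exact: ig_cst].
    rewrite ExZ; last exact: ig_normal_sqr.
    rewrite Ex_cosh2 Ex_cst -/V /l expr_div_n divfK ?expf_neq0//.
    by rewrite [in RHS]mulrCA mulrC [V * _]mulrC; congr (_ - _ - _); rewrite mulrC.
  have B1 : `|Ex N D| <= 54 * e ^+ 3 * (2 * expR 2).
    apply: le_trans (Ex_norm igD) _.
    have <- : Ex N (fun x => 54 * e ^+ 3 * cosh2 (2 / s) x) = 54 * e ^+ 3 * (2 * expR 2).
      rewrite ExZ; last exact: ig_cosh2.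
      rewrite Ex_cosh2 expr_div_n divfK ?expf_neq0//.
      by congr (_ * (_ * expR _)); field.
    by apply: le_Ex => //; [exact: ig_norm|exact/igZ/ig_cosh2].
  have B2 : `|expR (e ^+ 2 / 2) - 1 - e ^+ 2 / 2| <= e ^+ 3.
    have e2 : 0 <= e ^+ 2 / 2 <= 2^-1.
      by rewrite divr_ge0 ?exprn_ge0 ?(ltW e0)//= ler_pdivrMr// mulVf// exprn_ile1// ltW.
    have := expR_taylor (e ^+ 2 / 2); have /andP[p0 p1] := e2.
    rewrite [`|e ^+ 2 / 2|]ger0_norm//.
    have ex : expR (e ^+ 2 / 2) <= 2.
      have h := expR_ge1Dx (- (e ^+ 2 / 2)).
      rewrite expRN in h.
      have eg := expR_gt0 (e ^+ 2 / 2).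
      have : (1 - e ^+ 2 / 2) * expR (e ^+ 2 / 2) <= 1.
        by rewrite -ler_pdivlMr// mul1r; lra.
      nra.
    set E := expR _ in ex * => h.
    have q : (e ^+ 2 / 2) ^+ 2 / 2 = e ^+ 3 * (e / 8) by field.
    have q2 : (e ^+ 2 / 2) ^+ 3 = e ^+ 3 * (e ^+ 3 / 8) by field.
    have e3 : 0 <= e ^+ 3 <= 1 by rewrite exprn_ge0 ?exprn_ile1// ltW.
    rewrite q q2 in h.
    move: h; rewrite !ler_norml => /andP[h1 h2].
    have E0 : 0 <= E by exact: expR_ge0.
    have /andP[e30 e31] := e3.
    have r1 : E * (e ^+ 3 * (e ^+ 3 / 8)) <= e ^+ 3 / 4.
      have : E * (e ^+ 3 / 8) <= 4^-1 by nra.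
      nra.
    have r2 : 0 <= e ^+ 3 * (e / 8) <= e ^+ 3 / 8 by nra.
    have /andP[r3 r4] := r2.
    by apply/andP; split; lra.
  have e20 : 0 < e ^+ 2 by rewrite exprn_gt0.
  have -> : V / s ^+ 2 - 1 =
      (2 * (expR (e ^+ 2 / 2) - 1 - e ^+ 2 / 2) - Ex N D) / e ^+ 2.
    by rewrite ED; field; rewrite gt_eqF.
  rewrite normrM [`|(_ ^+ 2)^-1|]gtr0_norm ?invr_gt0// ler_pdivrMr//.
  rewrite [leRHS](_ : _ = (108 * expR 2 + 2) * e ^+ 3); last by ring.
  rewrite (le_trans (ler_normB _ _))// normrM.
  have : 2 * `|expR (e ^+ 2 / 2) - 1 - e ^+ 2 / 2| <= 2 * e ^+ 3 by rewrite ler_wpM2l.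
  move=> h; rewrite ger0_norm//; lra.
have V1 : V / s ^+ 2 - 1 = 0.
  apply/eqP; rewrite -normr_eq0; apply/eqP/le_anti; rewrite normr_ge0 andbT.
  set K := 108 * expR 2 + 2 in key.
  have K0 : 0 < K by rewrite /K addr_gt0// mulr_gt0// expR_gt0.
  rewrite leNgt; apply/negP => h.
  set v := `|_| in h key.
  pose e := Num.min 1 (v / K / 2).
  have e0 : 0 < e by rewrite lt_min ltr01/= !divr_gt0.
  have := key e e0; rewrite ge_min lexx => /(_ isT).
  have : K * e <= v / 2.
    rewrite -ler_pdivlMl// (le_trans (y := v / K / 2))// ?ge_min ?lexx ?orbT//.
    by rewrite [leRHS](_ : _ = v / K / 2)//; ring.
  lra.
have s20 : s ^+ 2 != 0 by rewrite expf_neq0.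
have : V / s ^+ 2 = 1 by lra.
by move=> h; rewrite -[V](divfK s20) h mul1r.
Qed.

End gauss_moments.

(** * A Berry-Esseen type bound *)

Section lindeberg.
Context {R : realType}.

(** The comparison value sees the law of [xi] only through its variance. Two centred variables with
    the same variance therefore give expectations that differ by third-moment terms only. *)
Lemma Ex_lgs_taylor d (T : measurableType d) (P : probability T R) (xi : T -> R)
    (v k y a : R) :
  ig P xi -> ig P (fun w => xi w ^+ 2) -> ig P (fun w => `|xi w| ^+ 3) ->
  Ex P xi = 0 -> Ex P (fun w => xi w ^+ 2) = v -> Ex P (fun w => `|xi w| ^+ 3) <= k ->
  0 < a ->
  `|Ex P (fun w => lgs (y + a * xi w)) - (lgs y + a ^+ 2 * v / 2 * lgs2 y)| <= 3 * a ^+ 3 * k.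
Proof.
move=> i1 i2 i3 E1 E2 E3 a0.
have mlg : measurable_fun setT (fun w => lgs (y + a * xi w)).
  apply: (measurableT_comp measurable_lgs); apply: measurable_funD => //.
  exact: igm (igZ a i1).
have ilg : ig P (fun w => lgs (y + a * xi w)).
  apply: aebd_ig; split => //; exists 1; apply: aeW => w.
  by have /andP[h0 h1] := lgs01 (y + a * xi w); rewrite gtr0_norm// ltW.
have ipoly : ig P (fun w => lgs y + a * lgs1 y * xi w + a ^+ 2 / 2 * lgs2 y * xi w ^+ 2).
  by apply: igD; [apply: igD; [exact: ig_cst|exact: igZ]|exact: igZ].
have Epoly : Ex P (fun w => lgs y + a * lgs1 y * xi w + a ^+ 2 / 2 * lgs2 y * xi w ^+ 2) =
    lgs y + a ^+ 2 * v / 2 * lgs2 y.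
  rewrite ExD; [|by apply: igD; [exact: ig_cst|exact: igZ]|exact: igZ].
  rewrite ExD; [|exact: ig_cst|exact: igZ].
  by rewrite Ex_cst !ExZ// E1 E2; field.
rewrite -Epoly -ExB//.
apply: le_trans (Ex_norm (igB ilg ipoly)) _.
apply: (@le_trans _ _ (Ex P (fun w => 3 * a ^+ 3 * `|xi w| ^+ 3))).
  apply: le_Ex; [exact: ig_norm (igB ilg ipoly)|exact: igZ|].
  move=> w; have := lgs_taylor y (a * xi w).
  rewrite normrM gtr0_norm//.
  congr (`|_| <= _); first by field.
  by rewrite exprMn mulrA.
by rewrite ExZ// ler_wpM2l// mulr_ge0// exprn_ge0// ltW.
Qed.

(** For [s = 1 / sqrt (n + 1)] the accumulated Gaussian is standard, whatever [n] is. *)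
Lemma ge0_integral_normal_iter (s : R) (F : R -> \bar R) n x : 0 < s ->
  measurable_fun setT F -> (forall x, 0 <= F x)%E ->
  iter n.+1 (fun H y => \int[normal_prob 0 s]_u H (y + u)%R)%E F x =
  (\int[normal_prob 0 (Num.sqrt n.+1%:R * s)]_u F (x + u)%R)%E.
Proof.
move=> s0 mF F0; elim: n x => [|n IH] x; first by rewrite /= sqrtr1 mul1r.
rewrite iterS.
transitivity (\int[normal_prob 0 s]_w
   \int[normal_prob 0 (Num.sqrt n.+1%:R * s)]_u (fun y => F (x + y)%R) (w + u)%R)%E.
  by apply: eq_integral => w _; rewrite IH; apply: eq_integral => u _ /=; rewrite addrA.
apply: (@ge0_integral_normal_conv _ _ _ (Num.sqrt n.+2%:R * s) (fun y => F (x + y)%R)).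
- by [].
- by rewrite mulr_gt0// sqrtr_gt0.
- by rewrite mulr_gt0// sqrtr_gt0.
- by rewrite !exprMn !sqr_sqrtr// -(natr1 n.+1); ring.
- by apply: (measurableT_comp mF); apply: measurable_funD.
- by [].
Qed.

End lindeberg.

Lemma ge0_le_integralDe {R : realType} d (T : measurableType d)
    (P : probability T R) (F G : T -> \bar R) (e : R) : (0 <= e)%R ->
  measurable_fun setT F -> measurable_fun setT G -> (forall x, (0 <= F x)%E) ->
  (forall x, (0 <= G x)%E) -> (forall x, (F x <= G x + e%:E)%E) ->
  (\int[P]_x F x <= \int[P]_x G x + e%:E)%E.
Proof.
move=> e0 mF mG F0 G0 FG.
apply: (@le_trans _ _ (\int[P]_x (G x + e%:E))%E).
  by apply: ge0_le_integral => //; apply: emeasurable_funD.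
rewrite ge0_integralD//.
by rewrite integral_cst//= probability_setT mule1.
Qed.

Section clt.
Context {R : realType} d (T : measurableType d) dV (V : measurableType dV)
  (P : probability T R) (X : nat -> T -> V) (f : V -> R).
Hypothesis iidX : iid_seq P X.
Hypothesis mf : measurable_fun setT f.
Local Open Scope ereal_scope.
Variables (e s : R) (h : R -> R).
Hypotheses (e0 : (0 <= e)%R) (s0 : (0 < s)%R).
Hypotheses (mh : measurable_fun setT h) (h0 : forall x, (0 <= h x)%R).
Local Notation N := (normal_prob 0 s).
Hypothesis close0 : forall x,
  \int[P]_w (h (x + f (X 0%N w)))%:E <= \int[N]_u (h (x + u))%:E + e%:E /\
  \int[N]_u (h (x + u))%:E <= \int[P]_w (h (x + f (X 0%N w)))%:E + e%:E.

(** [H n x] is the mean of [h] at [x] plus [n] independent Gaussian steps, which stand for the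
    summands already replaced. *)
Let H n := iter n (fun H y => \int[N]_u H (y + u)%R) (EFin \o h).

Let mX0 : measurable_fun setT (X 0%N). Proof. by have [] := iidX. Qed.

Let H0 n x : 0 <= H n x.
Proof.
elim: n x => [|n IH] x; first by rewrite lee_fin.
by apply: integral_ge0.
Qed.

Let mHadd (F : R -> \bar R) : measurable_fun setT F ->
  measurable_fun setT (fun p : R * measurableTypeR R => F (p.1 + p.2)%R).
Proof. by move=> mF; apply: (measurableT_comp mF); apply: measurable_funD. Qed.

Let mH n : measurable_fun setT (H n).
Proof.
elim: n => [|n IH]; first exact/measurable_EFinP.
apply: (@measurable_fun_fubini_tonelli_F _ _ _ _ _ N
  (fun p : R * measurableTypeR R => H n (p.1 + p.2)%R)) => //.
exact: mHadd.
Qed.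

Let mHx n (x : R) : measurable_fun setT (fun u : measurableTypeR R => H n (x + (u : R))%R).
Proof. by apply: (measurableT_comp (mH n)); apply: measurable_funD. Qed.

Let mHP n (x : R) : measurable_fun setT (fun w => H n (x + f (X 0%N w))%R).
Proof.
apply: (measurableT_comp (mH n)); apply: measurable_funD => //.
exact: measurableT_comp.
Qed.

Let swap n x : \int[P]_w \int[N]_u H n (x + f (X 0%N w) + u)%R =
  \int[N]_u \int[P]_w H n (x + u + f (X 0%N w))%R.
Proof.
rewrite (@fubini_tonelli _ _ T (measurableTypeR R) R P N
  (fun p => H n (x + f (X 0%N p.1) + p.2)%R))//.
  by apply: eq_integral => u _; apply: eq_integral => w _ /=; rewrite addrAC.
apply: (measurableT_comp (mH n)); apply: measurable_funD => //.
apply: measurable_funD => //; apply: (measurableT_comp mf).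
exact: measurableT_comp.
Qed.

Let mHPF n x : measurable_fun setT
  (fun u : measurableTypeR R => \int[P]_w H n (x + u + f (X 0%N w))%R).
Proof.
apply: (@measurable_fun_fubini_tonelli_F _ _ (measurableTypeR R) T R P
  (fun p => H n (x + p.1 + f (X 0%N p.2))%R)) => //.
apply: (measurableT_comp (mH n)); apply: measurable_funD => //.
  exact: measurable_funD.
by apply: (measurableT_comp mf); exact: measurableT_comp.
Qed.

(** Averaging over further Gaussian steps does not raise the cost of one swap, because the bound [e]
    is uniform in the starting point. *)
Let close n x :
  \int[P]_w H n (x + f (X 0%N w))%R <= H n.+1 x + e%:E /\
  H n.+1 x <= \int[P]_w H n (x + f (X 0%N w))%R + e%:E.
Proof.
elim: n x => [|n IH] x; first exact: close0.
have -> : \int[P]_w H n.+1 (x + f (X 0%N w))%R =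
   \int[N]_u \int[P]_w H n (x + u + f (X 0%N w))%R by rewrite -swap.
pose F (u : measurableTypeR R) := \int[P]_w H n (x + u + f (X 0%N w))%R.
pose G (u : measurableTypeR R) := H n.+1 (x + u)%R.
have F0 u : 0 <= F u by apply: integral_ge0.
have FG u : F u <= G u + e%:E /\ G u <= F u + e%:E by exact: IH.
have G0 u : 0 <= G u by exact: H0.
have mF : measurable_fun setT F by exact: mHPF.
have mG : measurable_fun setT G by exact: mHx.
split.
  by apply: (@ge0_le_integralDe _ _ _ N F G e) => // u; have [] := FG u.
by apply: (@ge0_le_integralDe _ _ _ N G F e) => // u; have [] := FG u.
Qed.

Lemma lindeberg_swap n :
  \int[P]_w (h (psum X f n w))%:E <= H n 0%R + (n%:R * e)%:E /\
  H n 0%R <= \int[P]_w (h (psum X f n w))%:E + (n%:R * e)%:E.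
Proof.
(* Hybrid sums: [k] true summands followed by [n - k] Gaussian steps. Neighbours differ by at most
   [e], and the two ends are the quantities to compare. *)
pose a k := \int[P]_w H (n - k) (psum X f k w).
have mS k : measurable_fun setT (psum X f k).
  by apply: measurable_psum => //; have [] := iidX.
have mHS m k : measurable_fun setT (fun w => H m (psum X f k w)).
  exact: measurableT_comp.
have mC k m : measurable_fun setT
    (fun w => \int[P]_w' H m (psum X f k w + f (X 0%N w'))%R).
  apply: (@measurable_fun_fubini_tonelli_F _ _ T T R P
    (fun p => H m (psum X f k p.1 + f (X 0%N p.2))%R)) => //.
  apply: (measurableT_comp (mH m)); apply: measurable_funD => //.
    exact: measurableT_comp.
  by apply: (measurableT_comp mf); exact: measurableT_comp.
have step k : (k < n)%N -> a k.+1 <= a k + e%:E /\ a k <= a k.+1 + e%:E.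
  move=> kn; rewrite /a (ge0_integral_psumS iidX mf k (mH _))//.
  rewrite (_ : (n - k)%N = (n - k.+1).+1); last by rewrite subnSK.
  by split; apply: ge0_le_integralDe => //;
    first [exact: mC | exact: mHS | (by move=> w; apply: integral_ge0) |
      (by move=> w; have [] := close (n - k.+1) (psum X f k w))].
have tot k : (k <= n)%N -> a k <= a 0%N + (k%:R * e)%:E /\ a 0%N <= a k + (k%:R * e)%:E.
  elim: k => [|k IH] kn; first by rewrite mul0r adde0.
  have [h1 h2] := IH (ltnW kn); have [h3 h4] := step k kn.
  rewrite -natr1 mulrDl mul1r EFinD !addeA; split.
    by apply: (le_trans h3); rewrite leeD2r.
  apply: (le_trans h2); rewrite addeAC leeD2r//.
have := tot n (leqnn n).
rewrite {1 4}/a subnn.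
have -> // : a 0%N = H n 0%R.
rewrite /a subn0.
under eq_integral do rewrite /psum big_ord0.
by rewrite integral_cst//= probability_setT mule1.
Qed.

End clt.

(** * The normal distribution function and logistic smoothing *)

Section Phi_facts.
Context {R : realType}.
Implicit Types (t k : R).

Lemma Ex_indic d (T : measurableType d) (P : probability T R) (A : set T) :
  measurable A -> Ex P (\1_A) = fine (P A).
Proof. by move=> mA; rewrite /Ex /Rintegral integral_indic// setIT. Qed.

Lemma ig_indic d (T : measurableType d) (P : probability T R) (A : set T) :
  measurable A -> ig P (\1_A).
Proof. by move=> mA; apply: integrable_indic => //; rewrite ltey_eq fin_num_measure. Qed.

Lemma Phi_le t t' : t <= t' -> Phi t <= Phi t'.
Proof.
move=> tt; rewrite /Phi fine_le ?fin_num_measure//.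
rewrite le_measure ?inE//; [exact: measurable_itv..|].
by apply: subset_itvl; rewrite bnd_simp.
Qed.

(** The normal density is at most [1 / sqrt (2 pi)], hence at most 1. *)
Lemma Phi_lip t t' : t <= t' -> Phi t' <= Phi t + (t' - t).
Proof.
move=> tt; rewrite /Phi.
have -> : `]-oo, t']%classic = `]-oo, t] `|` `]t, t'] :> set R.
  by rewrite -itv_bndbnd_setU// bnd_simp.
rewrite measureU//=; last first.
  apply/seteqP; split => x //=; rewrite !in_itv/= => -[h1 /andP[h2 _]].
  by move: h1; rewrite leNgt h2.
rewrite fineD ?fin_num_measure// lerD2l.
rewrite -lee_fin fineK ?fin_num_measure// /normal_prob.
apply: (@le_trans _ _ (\int[lebesgue_measure]_(x in `]t, t']) cst 1%:E x)%E).
  apply: ge0_le_integral => //=.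
  - by move=> x _; rewrite lee_fin normal_pdf_ge0.
  - by apply/measurable_EFinP/measurable_funTS; exact: measurable_normal_pdf.
  - move=> x _; rewrite lee_fin; apply: le_trans (normal_pdf_ub _ _ _) _ => //.
    rewrite normal_peakE// invr1 mul1r.
    have p2 : 1 <= pi *+ 2 :> R by rewrite mulr2n; have := pi_ge2 R; lra.
    rewrite invf_le1 ?sqrtr_gt0 ?(lt_le_trans _ p2)//.
    by rewrite -[leLHS]sqrtr1 ler_wsqrtr.
rewrite [leLHS](_ : _ = 1%:E * lebesgue_measure `]t, t'])%E; last exact: integral_cst.
rewrite mul1e lebesgue_measure_itv/= lte_fin.
by case: ifPn => h; rewrite -?EFinB// lee_fin subr_ge0.
Qed.

Lemma expRN_small k v : 0 < k -> k^-1 <= v -> expR (- v) <= k.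
Proof.
move=> k0 kv; rewrite expRN -[leRHS]invrK lef_pV2 ?posrE ?expR_gt0 ?invr_gt0//.
by apply: (le_trans kv); have := expR_ge1Dx v; lra.
Qed.

(** At distance [k] from [t] the argument of [lgs] has modulus [1 / k], and [expR (- 1 / k) <= k].
    The scale [k^2] is chosen so that the width of the window and the error in height are the same
    number. *)
Lemma lgs_sandwich k t x : 0 < k -> let v := lgs ((x - t) / k ^+ 2) in
  (x <= t - k)%R%:R - k <= v <= (x <= t + k)%R%:R + k.
Proof.
move=> k0 /=; set v := (x - t) / k ^+ 2.
have /andP[l0 l1] := lgs01 v; have ev := expR_gt0 v.
have k20 : 0 < k ^+ 2 by rewrite exprn_gt0.
apply/andP; split.
  case: (leP x (t - k)) => /= h; rewrite ?mulr0n ?mulr1n; last by lra.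
  have : expR (- - v) <= k.
    apply: expRN_small => //.
    rewrite -mulNr ler_pdivlMr// expr2 mulrA mulVf ?gt_eqF// mul1r; lra.
  rewrite opprK => vk.
  rewrite /lgs -[_^-1]mul1r ler_pdivlMr; last lra.
  by nra.
case: (leP x (t + k)) => /= h; rewrite ?mulr0n ?mulr1n ?add0r; first by lra.
have : expR (- v) <= k.
  apply: expRN_small => //.
  rewrite ler_pdivlMr// expr2 mulrA mulVf ?gt_eqF// mul1r; lra.
apply: le_trans; rewrite expRN /lgs.
by rewrite lef_pV2 ?posrE//; lra.
Qed.

Lemma Ex_lgs_sandwich d (T : measurableType d) (P : probability T R) (Y : T -> R) k t :
  0 < k -> measurable_fun setT Y ->
  fine (P [set w | Y w <= t - k]) - k <= Ex P (fun w => lgs ((Y w - t) / k ^+ 2))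
    <= fine (P [set w | Y w <= t + k]) + k.
Proof.
move=> k0 mY.
have mset c : measurable [set w | Y w <= c].
  by rewrite -[X in measurable X]setTI; exact: measurable_fun_le.
have ilg : ig P (fun w => lgs ((Y w - t) / k ^+ 2)).
  apply: aebd_ig; split.
    apply: (measurableT_comp measurable_lgs); apply: measurable_funM => //.
    exact: measurable_funB.
  by exists 1; apply: aeW => w; have /andP[h0 h1] := lgs01 ((Y w - t) / k ^+ 2); rewrite gtr0_norm// ltW.
have indE c w : \1_[set w | Y w <= c] w = (Y w <= c)%R%:R :> R.
  by rewrite indicE; congr (nat_of_bool _)%:R; apply/idP/idP; rewrite inE.
have sw w := @lgs_sandwich k t (Y w) k0.
have ii c : ig P (\1_[set w | Y w <= c]) by exact: ig_indic.
have ik : ig P (cst k) by exact: ig_cst.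
have L : Ex P (fun w => \1_[set w | Y w <= t - k] w - k) =
    fine (P [set w | Y w <= t - k]) - k.
  by rewrite ExB// Ex_indic// Ex_cst.
have U : Ex P (fun w => \1_[set w | Y w <= t + k] w + k) =
    fine (P [set w | Y w <= t + k]) + k.
  by rewrite ExD// Ex_indic// Ex_cst.
rewrite -L -U; apply/andP; split; apply: le_Ex => //.
- exact: igB.
- by move=> w; rewrite indE; have /andP[] := sw w.
- exact: igD.
- by move=> w; rewrite indE; have /andP[] := sw w.
Qed.

Lemma Ex_lgs_sandwich_normal k t : 0 < k ->
  Phi (t - k) - k <= Ex (normal_prob 0 1) (fun x => lgs ((x - t) / k ^+ 2))
    <= Phi (t + k) + k.
Proof.
move=> k0.
have mid : measurable_fun setT (fun x : measurableTypeR R => (x : R)) by exact: measurable_id.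
have PhiE u : fine (normal_prob 0 1 [set x : measurableTypeR R | (x : R) <= u]) = Phi u.
  by rewrite /Phi; congr (fine (normal_prob 0 1 _)); apply/seteqP; split=> x /=; rewrite in_itv.
by have := Ex_lgs_sandwich (normal_prob 0 1) t k0 mid; rewrite !PhiE.
Qed.

End Phi_facts.

Lemma ler_dist_both (R : realType) (a b e : R) :
  `|a - b| <= e -> a <= b + e /\ b <= a + e.
Proof. by rewrite ler_norml => /andP[h1 h2]; split; lra. Qed.

Lemma ler_distP (R : realType) (a b e : R) :
  a <= b + e -> b <= a + e -> `|a - b| <= e.
Proof. by move=> h1 h2; rewrite ler_norml; apply/andP; split; lra. Qed.

Section clt_bound.
Context {R : realType} d (T : measurableType d) dV (V : measurableType dV)
  (P : probability T R) (X : nat -> T -> V) (f : V -> R).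
Hypothesis iidX : iid_seq P X.
Hypothesis mf : measurable_fun setT f.
Variables (B : R).
Hypothesis fB : forall v, `|f v| <= B.
Hypothesis Ef0 : Ex P (fun w => f (X 0%N w)) = 0.
Hypothesis Ef1 : Ex P (fun w => f (X 0%N w) ^+ 2) = 1.

Let mX0 : measurable_fun setT (X 0%N). Proof. by have [] := iidX. Qed.

Let mfX : measurable_fun setT (fun w => f (X 0%N w)).
Proof. exact: measurableT_comp. Qed.

Let bf : aebd P (fun w => f (X 0%N w)).
Proof. by split => //; exists B; apply: aeW. Qed.

Let B0 : 0 <= B.
Proof. by apply: le_trans (fB point); exact: normr_ge0. Qed.

(** Third moments of a summand and of its Gaussian counterpart scale like [n^(-3/2)], and so does
    the cost of a swap; [n] swaps give the rate [n^(-1/2)]. *)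
Lemma Ex_lgs_psum (n : nat) (a y : R) : (0 < n)%N -> 0 < a ->
  `|Ex P (fun w => lgs (y + a * (psum X f n w / Num.sqrt n%:R)))
    - Ex (normal_prob 0 1) (fun u => lgs (y + a * u))| <=
  3 * a ^+ 3 * (B ^+ 3 + gauss_cube) / Num.sqrt n%:R.
Proof.
move=> n0 a0; set r := Num.sqrt n%:R.
have r0 : 0 < r by rewrite sqrtr_gt0 ltr0n.
have r2 : r ^+ 2 = n%:R by rewrite sqr_sqrtr.
pose f' v := r^-1 * f v.
have mf' : measurable_fun setT f' by exact: measurable_funM.
pose s := r^-1.
have s0 : 0 < s by rewrite invr_gt0.
pose h x := lgs (y + a * x).
have mh : measurable_fun setT h.
  exact: (measurableT_comp measurable_lgs
    (measurable_funD (measurable_cst y) (mulrl_measurable a))).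
have h0 x : 0 <= h x by have /andP[/ltW] := lgs01 (y + a * x).
have h1 x : `|h x| <= 1 by have /andP[/ltW h2 /ltW h3] := lgs01 (y + a * x); rewrite ger0_norm.
have igh d' (T' : measurableType d') (P' : probability T' R) Y :
    measurable_fun setT Y -> ig P' (fun w => h (Y w)).
  move=> mY; apply: aebd_ig; split; first exact: (measurableT_comp mh mY).
  by exists 1; apply: aeW.
pose e := 3 * a ^+ 3 * (B ^+ 3 + gauss_cube) * s ^+ 3.
have gc0 : 0 <= gauss_cube :> R by rewrite /gauss_cube mulr_ge0// expR_ge0.
have e0 : 0 <= e.
  by rewrite !mulr_ge0// ?exprn_ge0// ?(ltW a0) ?(ltW s0)// addr_ge0// exprn_ge0.
have b' : aebd P (fun w => f' (X 0%N w)) by apply: aebdM => //; exact: aebd_cst.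
have cl x : `|Ex P (fun w => h (x + f' (X 0%N w))) - Ex (normal_prob 0 s) (fun u => h (x + u))| <= e.
  (* Both expansions are taken at the same point and with the same variance [s^2], so their
     quadratic parts coincide. *)
  have E1 := @Ex_lgs_taylor R _ _ P (fun w => f' (X 0%N w)) (s ^+ 2) (B ^+ 3 * s ^+ 3) (y + a * x) a
    (aebd_ig b') (aebd_ig (aebdX 2 b')).
  have E2 := @Ex_lgs_taylor R _ _ (normal_prob 0 s) (fun u => u) (s ^+ 2) (gauss_cube * s ^+ 3) (y + a * x) a
    (ig_normal_id s0) (ig_normal_sqr s0) (ig_normal_cube s0) (Ex_normal_id s0)
    (Ex_normal_sqr s0) (Ex_normal_cube s0) a0.
  have bn : aebd P (fun w => `|f' (X 0%N w)|).
    have [m1 [M m2]] := b'; split; first exact: measurableT_comp.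
    by exists M; apply: filterS m2 => w; rewrite normr_id.
  have {}E1 := E1 (aebd_ig (aebdX 3 bn)).
  have F1 : Ex P (fun w => f' (X 0%N w)) = 0 by rewrite ExZ ?Ef0 ?mulr0//; exact: aebd_ig.
  have F2 : Ex P (fun w => f' (X 0%N w) ^+ 2) = s ^+ 2.
    have -> : (fun w => f' (X 0%N w) ^+ 2) = (fun w => s ^+ 2 * f (X 0%N w) ^+ 2).
      by apply/funext => w; rewrite exprMn.
    by rewrite ExZ ?Ef1 ?mulr1//; apply: aebd_ig; exact: aebdX.
  have F3 : Ex P (fun w => `|f' (X 0%N w)| ^+ 3) <= B ^+ 3 * s ^+ 3.
    rewrite -[leRHS](Ex_cst P); apply: le_Ex.
    - exact/aebd_ig/aebdX.
    - exact: ig_cst.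
    - move=> w; rewrite normrM (gtr0_norm s0) exprMn mulrC ler_wpM2r// ?exprn_ge0 ?(ltW s0)//.
      by rewrite lerXn2r// nnegrE.
  have {}E1 := E1 F1 F2 F3 a0.
  have EE1 : Ex P (fun w => h (x + f' (X 0%N w))) = Ex P (fun w => lgs (y + a * x + a * f' (X 0%N w))).
    by apply: eq_Ex => w; rewrite /h mulrDr addrA.
  have EE2 : Ex (normal_prob 0 s) (fun u => h (x + u)) = Ex (normal_prob 0 s) (fun u => lgs (y + a * x + a * u)).
    by apply: eq_Ex => w; rewrite /h mulrDr addrA.
  rewrite EE1 EE2.
  move: E1 E2; set A := Ex _ _; set A' := Ex _ _; set Q := (_ + _ * lgs2 _).
  rewrite !ler_norml /e => /andP[p1 p2] /andP[p3 p4].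
  by apply/andP; split; lra.
have mxf x : measurable_fun setT (fun w => x + f' (X 0%N w)) by apply: measurable_funD => //; case: b'.
have mxu (x : R) : measurable_fun setT (fun u : measurableTypeR R => x + (u : R)) by exact: measurable_funD.
have cl0 x : ((\int[P]_w (h (x + f' (X 0%N w)))%:E <= \int[normal_prob 0 s]_u (h (x + u))%:E + e%:E) /\
  (\int[normal_prob 0 s]_u (h (x + u))%:E <= \int[P]_w (h (x + f' (X 0%N w)))%:E + e%:E))%E.
  have i1 : ig P (fun w => h (x + f' (X 0%N w))) by exact: igh.
  have i2 : ig (normal_prob 0 s) (fun u => h (x + u)) by exact: (igh _ _ _ _ (mxu x)).
  rewrite (Ex_EFin i1) (Ex_EFin i2) -!EFinD !lee_fin.
  exact: ler_dist_both (cl x).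
have := lindeberg_swap iidX mf' e0 mh h0 cl0 n.
case: n n0 @r r0 r2 @f' mf' @s s0 @e e0 b' cl mxf cl0 => // n _ r r0 r2 f' mf' s s0 e e0 b' cl mxf cl0.
have mh' : measurable_fun setT (EFin \o h) by exact/measurable_EFinP.
have h0' x : (0 <= (EFin \o h) x)%E by rewrite lee_fin.
rewrite (ge0_integral_normal_iter _ _ s0 mh' h0').
have -> : Num.sqrt n.+1%:R * s = 1 by rewrite -/r /s divff// gt_eqF.
have -> : (\int[normal_prob 0 1]_u (EFin \o h) (0 + u)%R = (Ex (normal_prob 0 1) h)%:E)%E.
  rewrite -Ex_EFin; last exact: (igh _ (measurableTypeR R) _ id).
  by apply: eq_integral => u _ /=; rewrite add0r.
have mS : measurable_fun setT (psum X f' n.+1) by apply: measurable_psum => //; have [] := iidX.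
rewrite (Ex_EFin (igh _ _ P _ mS)) -!EFinD !lee_fin => -[p1 p2].
have EE : Ex P (fun w => h (psum X f' n.+1 w)) = Ex P (fun w => lgs (y + a * (psum X f n.+1 w / r))).
  by apply: eq_Ex => w; congr (lgs (_ + _ * _)); rewrite /psum -mulr_sumr mulrC.
have ne : n.+1%:R * e = 3 * a ^+ 3 * (B ^+ 3 + gauss_cube) / r.
  by rewrite /e -r2 /s; field; rewrite gt_eqF.
by rewrite -EE -ne; exact: ler_distP.
Qed.

(** Half of the error [4 k] comes from moving the threshold by [2 k], through the Lipschitz bound on
    [Phi], and half from the height errors of the two sandwiches. The slope [k^-2] of the smoothing
    enters to the third power. The rate is not sharp, but beyond the normalization of [f] the bound
    sees the law only through [B]. *)
Theorem clt_bound (n : nat) (k t : R) : (0 < n)%N -> 0 < k ->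
  `|fine (P [set w | psum X f n w / Num.sqrt n%:R <= t]) - Phi t| <=
  4 * k + 3 * (k ^- 2) ^+ 3 * (B ^+ 3 + gauss_cube) / Num.sqrt n%:R.
Proof.
move=> n0 k0; set E := _ / _.
pose Y w := psum X f n w / Num.sqrt n%:R.
have mY : measurable_fun setT Y.
  by apply: measurable_funM => //; apply: measurable_psum => //; have [] := iidX.
have k20 : 0 < k ^- 2 by rewrite invr_gt0 exprn_gt0.
have cmp u : `|Ex P (fun w => lgs ((Y w - u) / k ^+ 2)) -
    Ex (normal_prob 0 1) (fun x => lgs ((x - u) / k ^+ 2))| <= E.
  have h := Ex_lgs_psum (- (u / k ^+ 2)) n0 k20.
  have E1 : Ex P (fun w => lgs ((Y w - u) / k ^+ 2)) =
      Ex P (fun w => lgs (- (u / k ^+ 2) + k ^- 2 * (psum X f n w / Num.sqrt n%:R))).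
    by apply: eq_Ex => w; congr lgs; rewrite /Y; ring.
  have E2 : Ex (normal_prob 0 1) (fun x => lgs ((x - u) / k ^+ 2)) =
      Ex (normal_prob 0 1) (fun x => lgs (- (u / k ^+ 2) + k ^- 2 * x)).
    by apply: eq_Ex => w; congr lgs; ring.
  by rewrite E1 E2.
have U : fine (P [set w | Y w <= t]) <= Phi t + 4 * k + E.
  have /andP[p1 _] := @Ex_lgs_sandwich R _ _ P Y k (t + k) k0 mY.
  have /andP[_ p2] := Ex_lgs_sandwich_normal (t + k) k0.
  rewrite addrK in p1.
  have := cmp (t + k); rewrite ler_norml => /andP[p3 p4].
  have p5 : Phi (t + k + k) <= Phi t + (t + k + k - t) by apply: Phi_lip; lra.
  lra.
have L : Phi t - 4 * k - E <= fine (P [set w | Y w <= t]).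
  have /andP[_ p1] := @Ex_lgs_sandwich R _ _ P Y k (t - k) k0 mY.
  have /andP[p2 _] := Ex_lgs_sandwich_normal (t - k) k0.
  rewrite subrK in p1.
  have := cmp (t - k); rewrite ler_norml => /andP[p3 p4].
  have p5 : Phi t <= Phi (t - k - k) + (t - (t - k - k)) by apply: Phi_lip; lra.
  lra.
by rewrite ler_norml; apply/andP; split; rewrite /Y in U L; lra.
Qed.

End clt_bound.

(** * Exponential inequalities *)

Lemma measurable_le_set {R : realType} d (T : measurableType d) (f g : T -> R) :
  measurable_fun setT f -> measurable_fun setT g -> measurable [set w | f w <= g w].
Proof. by move=> mf mg; rewrite -[X in measurable X]setTI; exact: measurable_fun_le. Qed.

Lemma measurable_lt_set {R : realType} d (T : measurableType d) (f g : T -> R) :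
  measurable_fun setT f -> measurable_fun setT g -> measurable [set w | f w < g w].
Proof.
move=> mf mg; have -> : [set w | f w < g w] = ~` [set w | g w <= f w].
  by apply/seteqP; split=> w /=; rewrite ltNge => /negP.
exact/measurableC/measurable_le_set.
Qed.

Section whp.
Context {R : realType} d (T : measurableType d) (P : probability T R).
Implicit Types (e : R) (Q : T -> Prop).

(** The properties of interest quantify over all sparse vectors and need not be measurable, so a
    measurable subevent of probability at least [1 - e] is part of the definition. *)
Definition whp e Q := exists F, [/\ measurable F, (P (~` F) <= e%:E)%E & forall w, F w -> Q w].

Lemma whp_imp e Q Q' : (forall w, Q w -> Q' w) -> whp e Q -> whp e Q'.
Proof. by move=> QQ' [F [mF PF FQ]]; exists F; split => // w /FQ /QQ'. Qed.

Lemma whp_le e e' Q : e <= e' -> whp e Q -> whp e' Q.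
Proof. by move=> ee [F [mF PF FQ]]; exists F; split => //; apply: le_trans PF _. Qed.

Lemma whp_and e e' Q Q' : whp e Q -> whp e' Q' -> whp (e + e') (fun w => Q w /\ Q' w).
Proof.
move=> [F [mF PF FQ]] [G [mG PG GQ]]; exists (F `&` G); split.
- exact: measurableI.
- rewrite setCI EFinD (le_trans (measureU2 _ _ _))//; try exact: measurableC.
  exact: leeD.
- by move=> w [/FQ ? /GQ].
Qed.

Lemma whpT e Q : 0 <= e -> (forall w, Q w) -> whp e Q.
Proof.
move=> e0 h; exists setT; split => //.
by rewrite setCT measure0 lee_fin.
Qed.

Lemma whp_seq (I : eqType) (r : seq I) e (Q : I -> T -> Prop) : 0 <= e ->
  (forall i, whp e (Q i)) -> whp ((size r)%:R * e) (fun w => forall i, i \in r -> Q i w).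
Proof.
move=> e0 h; elim: r => [|i r IH]; first by apply: whpT => //; rewrite mul0r.
rewrite /= -natr1 mulrDl mul1r.
apply: whp_imp (whp_and IH (h i)) => w [h1 h2] j.
by rewrite inE => /predU1P[->//|]; exact: h1.
Qed.

Lemma whp_ae Q : (\forall w \ae P, Q w) -> whp 0 Q.
Proof.
move=> [N [mN PN QN]]; exists (~` N); split; first exact: measurableC.
- by rewrite setCK PN.
- by move=> w; apply: contra_notP => h; exact: QN.
Qed.

Lemma whp_event e A : measurable A -> ((1 - e)%:E <= P A)%E -> whp e A.
Proof.
move=> mA PA; exists A; split => //.
rewrite probability_setC// leeBlDr ?fin_num_measure// -leeBlDl//.
Qed.

End whp.

(** On this range the cubic remainder is at most [2 |x|^3 <= x^2 / 4], which fits into the gap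
    between [x^2 / 2] and [x^2]. *)
Lemma expR_le_quad {R : realType} (x : R) : `|x| <= 8^-1 -> expR x <= 1 + x + x ^+ 2.
Proof.
move=> x8; have := expR_taylor x; rewrite ler_norml => /andP[_ h].
have e2 : expR `|x| <= 2.
  have := expR_ge1Dx (- `|x|); rewrite expRN => g.
  have e0 := expR_gt0 `|x|.
  have : (1 - `|x|) * expR `|x| <= 1 by rewrite -ler_pdivlMr// mul1r.
  nra.
have c : `|x| ^+ 3 <= x ^+ 2 / 8.
  by rewrite exprSr -normrX (ger0_norm (sqr_ge0 x)) ler_wpM2l// sqr_ge0.
have : expR `|x| * `|x| ^+ 3 <= 2 * (x ^+ 2 / 8).
  by rewrite ler_pM// ?expR_ge0 ?exprn_ge0.
have := sqr_ge0 x; lra.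
Qed.

Section bernstein.
Context {R : realType} d (T : measurableType d) dV (V : measurableType dV)
  (P : probability T R) (X : nat -> T -> V) (f : V -> R).
Hypothesis iidX : iid_seq P X.
Hypothesis mf : measurable_fun setT f.
Hypothesis f8 : forall v, `|f v| <= 8^-1.
Hypothesis Ef0 : Ex P (fun w => f (X 0%N w)) = 0.
Variable v : R.
Hypothesis Ef2 : Ex P (fun w => f (X 0%N w) ^+ 2) <= v.

Let mX i : measurable_fun setT (X i). Proof. by have [] := iidX. Qed.

Let bf : aebd P (fun w => f (X 0%N w)).
Proof.
by split; [exact: measurableT_comp|exists 8^-1; apply: aeW].
Qed.

Let mexpS n : measurable_fun setT (fun w => (expR (psum X f n w))%:E).
Proof.
apply/measurable_EFinP; apply: (measurableT_comp (@measurable_expR R)).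
exact: measurable_psum.
Qed.

Lemma mgf_psum n : (\int[P]_w (expR (psum X f n w))%:E <= (expR (n%:R * v))%:E)%E.
Proof.
have E1 : (\int[P]_w (expR (f (X 0%N w)))%:E <= (expR v)%:E)%E.
  have mexp : measurable_fun setT (fun w => expR (f (X 0%N w))).
    by apply: (measurableT_comp (@measurable_expR R)); case: bf.
  have ie : ig P (fun w => expR (f (X 0%N w))).
    apply: aebd_ig; split => //; exists (expR 8^-1); apply: aeW => w.
    by rewrite ger0_norm ?expR_ge0// ler_expR (le_trans (ler_norm _)).
  have iq : ig P (fun w => 1 + f (X 0%N w) + f (X 0%N w) ^+ 2).
    by apply: aebd_ig; apply: aebdD; [apply: aebdD => //; exact: aebd_cst|exact: aebdX].
  rewrite Ex_EFin// lee_fin (le_trans (le_Ex ie iq _))//.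
    by move=> w; exact: expR_le_quad.
  rewrite ExD; [|by apply: aebd_ig; apply: aebdD => //; exact: aebd_cst|exact/aebd_ig/aebdX].
  rewrite ExD; [|exact: ig_cst|exact: aebd_ig].
  by rewrite Ex_cst Ef0 addr0 (le_trans _ (expR_ge1Dx v))// lerD2l.
elim: n => [|n IH].
  under eq_integral do rewrite /psum big_ord0 expR0.
  by rewrite integral_cst//= probability_setT mule1 mul0r expR0.
rewrite (@ge0_integral_psumS _ _ _ _ _ P _ _ iidX mf n (fun x => (expR x)%:E)); last 2 first.
- by apply/measurable_EFinP; exact: measurable_expR.
- by move=> x; rewrite lee_fin expR_ge0.
rewrite (_ : (\int[P]_w _)%E = (\int[P]_w ((expR (psum X f n w))%:E *
    \int[P]_w' (expR (f (X 0%N w')))%:E))%E); last first.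
  apply: eq_integral => w _.
  rewrite -ge0_integralZl//=.
  - by apply: eq_integral => w' _; rewrite expRD EFinM.
  - apply/measurable_EFinP; apply: (measurableT_comp (@measurable_expR R)).
    by case: bf.
rewrite ge0_integralZr//=; last by apply: integral_ge0 => x _; rewrite lee_fin expR_ge0.
rewrite -natr1 mulrDl mul1r expRD EFinM; apply: lee_pmul => //.
- by apply: integral_ge0 => x _; rewrite lee_fin expR_ge0.
- by apply: integral_ge0 => x _; rewrite lee_fin expR_ge0.
Qed.

(** Markov's inequality for the exponential at parameter 1. No parameter is optimized here: the
    choice is left to the scaling of [f]. *)
Lemma chernoff_psum n a :
  (P [set w | (a < psum X f n w)%R] <= (expR (n%:R * v - a))%:E)%E.
Proof.
have mS : measurable_fun setT (psum X f n) by exact: measurable_psum.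
have mA : measurable [set w | (a < psum X f n w)%R].
  exact: measurable_lt_set.
have -> : P [set w | (a < psum X f n w)%R] = (\int[P]_w (\1_[set w | (a < psum X f n w)%R] w)%:E)%E.
  by rewrite integral_indic// setIT.
apply: (@le_trans _ _ (\int[P]_w ((expR (- a))%:E * (expR (psum X f n w))%:E))%E).
  apply: ge0_le_integral => //=.
  - by apply/measurable_EFinP; exact: measurable_indic.
  - exact: emeasurable_funM.
  - move=> w _; rewrite -EFinM lee_fin -expRD indicE.
    case: (boolP (w \in _)) => [|_]; last by rewrite expR_ge0.
    rewrite inE/= => h; rewrite -[leLHS]expR0 ler_expR; lra.
rewrite ge0_integralZl//=.
rewrite [(_ - a)%R]addrC expRD EFinM lee_pmul2l//; last by rewrite lte_fin expR_gt0.
exact: mgf_psum.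
Qed.

End bernstein.

Lemma bernstein {R : realType} d (T : measurableType d) dV (V : measurableType dV)
  (P : probability T R) (X : nat -> T -> V) (f : V -> R) (v a : R) n :
  iid_seq P X -> measurable_fun setT f -> (forall v, `|f v| <= 8^-1) ->
  Ex P (fun w => f (X 0%N w)) = 0 -> Ex P (fun w => f (X 0%N w) ^+ 2) <= v ->
  whp P (2 * expR (n%:R * v - a)) (fun w => `|psum X f n w| <= a).
Proof.
move=> iidX mf f8 E0 E2; have [mX _] := iidX.
have b1 := chernoff_psum iidX mf f8 E0 E2 n a.
have mS : measurable_fun setT (psum X f n) by exact: measurable_psum.
pose g v := - f v.
have mg : measurable_fun setT g by exact: measurable_funN.
have g8 u : `|g u| <= 8^-1 by rewrite normrN.
have bf : aebd P (fun w => f (X 0%N w)).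
  by split; [exact: measurableT_comp|exists 8^-1; apply: aeW].
have Eg0 : Ex P (fun w => g (X 0%N w)) = 0.
  rewrite (@eq_Ex _ _ _ _ _ (fun w => -1 * f (X 0%N w))).
    by rewrite ExZ ?E0 ?mulr0//; exact: aebd_ig.
  by move=> w; rewrite mulN1r.
have Eg2 : Ex P (fun w => g (X 0%N w) ^+ 2) <= v.
  by rewrite (@eq_Ex _ _ _ _ _ (fun w => f (X 0%N w) ^+ 2))// => w; rewrite sqrrN.
have b2 := chernoff_psum iidX mg g8 Eg0 Eg2 n a.
have mltS (h : T -> R) : measurable_fun setT h -> measurable [set w | a < h w].
  by move=> mh; exact: measurable_lt_set.
have mSg : measurable_fun setT (psum X g n) by exact: measurable_psum.
exists (~` ([set w | a < psum X f n w] `|` [set w | a < psum X g n w])); split.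
- by apply: measurableC; apply: measurableU; exact: mltS.
- rewrite setCK (le_trans (measureU2 _ _ _))//; try exact: mltS.
  by rewrite mulrDl mul1r EFinD leeD.
- move=> w /not_orP[/negP + /negP]; rewrite -!leNgt => h1 h2.
  rewrite ler_norml h1 andbT lerNl; move: h2.
  by rewrite /psum sumrN.
Qed.

(** * Concentration uniformly over sparse vectors *)

Section rates.
Context {R : realType}.

Lemma nat_big (M : R) : exists N : nat, forall n, (N <= n)%N -> M <= n%:R.
Proof.
exists (Num.truncn M).+1 => n Nn; apply: ltW (lt_le_trans (truncnS_gt M) _).
by rewrite ler_nat.
Qed.

Lemma sqrtn_big (M : R) : exists N : nat, forall n, (N <= n)%N -> M <= Num.sqrt n%:R.
Proof.
have [N hN] := nat_big (M ^+ 2); exists N => n /hN h.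
by rewrite (le_trans (ler_norm M))// -sqrtr_sqr ler_wsqrtr.
Qed.

Lemma exp_small (c eps y : R) : 0 < eps -> 0 < c -> 2 / (c * eps) <= y ->
  2 * expR (- (c * y)) <= eps.
Proof.
move=> e0 c0 hy.
have y0 : 0 < y by apply: lt_le_trans hy; rewrite divr_gt0// mulr_gt0.
have cy : 0 < c * y by rewrite mulr_gt0.
rewrite expRN ler_pdivrMr ?expR_gt0//.
have h1 : 2 <= eps * (c * y).
  by move: hy; rewrite ler_pdivrMr ?mulr_gt0// => /le_trans; apply; lra.
have h2 := expR_ge1Dx (c * y).
by apply: (le_trans h1); rewrite ler_wpM2l ?(ltW e0)//; lra.
Qed.

End rates.

Section concentration.
Context {R : realType}.

(** [n] times the variance is at most half of the deviation [eps sqrt n], so the exponent stays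
    below [- eps sqrt n / 2]. It serves for the centred terms that carry an approximation error and
    have second moment [o(n^(-1/2))]. *)
Lemma concentration_small (eps : R) : 0 < eps -> exists2 eta, 0 < eta & exists N : nat,
  forall n, (N <= n)%N ->
  forall d (T : measurableType d) dV (V : measurableType dV) (P : probability T R)
    (X : nat -> T -> V) (f : V -> R), iid_seq P X -> measurable_fun setT f ->
  (forall v, `|f v| <= eta) -> Ex P (fun w => f (X 0%N w)) = 0 ->
  Ex P (fun w => f (X 0%N w) ^+ 2) <= eta / Num.sqrt n%:R ->
  whp P eps (fun w => `|psum X f n w| <= eps * Num.sqrt n%:R).
Proof.
move=> e0; exists (Num.min 8^-1 (eps / 2)); first by rewrite lt_min !divr_gt0// invr_gt0 ltr0n.
set eta := Num.min _ _.
have [N hN] := sqrtn_big (2 / (eps / 2 * eps)); exists N.+1 => n Nn d T dV V P X f iidX mf fb E0 E2.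
have e8 : eta <= 8^-1 by rewrite ge_min lexx.
have ee : eta <= eps / 2 by rewrite ge_min lexx orbT.
have f8 v : `|f v| <= 8^-1 by exact: le_trans (fb v) e8.
apply: whp_le _ (bernstein (eps * Num.sqrt n%:R) n iidX mf f8 E0 E2).
have n0 : 0 < n%:R :> R by rewrite ltr0n (leq_trans _ Nn).
set r := Num.sqrt n%:R.
have r0 : 0 < r by rewrite sqrtr_gt0.
have nr : n%:R = r * r by rewrite -expr2 sqr_sqrtr// ltW.
apply: le_trans (exp_small e0 _ (hN n (ltnW Nn))); last by rewrite divr_gt0.
rewrite ler_wpM2l// ler_expR -/r nr.
have -> : r * r * (eta / r) = r * eta by field; rewrite gt_eqF.
have : r * eta <= r * (eps / 2) by rewrite ler_wpM2l// ltW.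
lra.
Qed.

Lemma weak_lln (eps B : R) : 0 < eps -> 0 < B -> exists N : nat,
  forall n, (N <= n)%N ->
  forall d (T : measurableType d) dV (V : measurableType dV) (P : probability T R)
    (X : nat -> T -> V) (f : V -> R), iid_seq P X -> measurable_fun setT f ->
  (forall v, `|f v| <= B) -> Ex P (fun w => f (X 0%N w)) = 0 ->
  whp P eps (fun w => `|psum X f n w| <= eps * n%:R).
Proof.
(* Scaling by [l] brings the summand below [1/8] and makes the variance term at most half of the
   deviation term. *)
move=> e0 B0; pose l := Num.min (8^-1 / B) (eps / (2 * B ^+ 2)).
have l0 : 0 < l by rewrite lt_min !divr_gt0// ?invr_gt0 ?ltr0n// mulr_gt0// exprn_gt0.
have c0 : 0 < l * eps / 2 by rewrite divr_gt0// mulr_gt0.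
have [N hN] := nat_big (2 / (l * eps / 2 * eps)).
exists N => n Nn d T dV V P X f iidX mf fb E0; have [mX _] := iidX.
have l1 : l * B <= 8^-1 by rewrite -ler_pdivlMr// ge_min lexx.
have l2 : l * B ^+ 2 <= eps / 2.
  have : l <= eps / (2 * B ^+ 2) by rewrite ge_min lexx orbT.
  rewrite ler_pdivlMr ?mulr_gt0 ?exprn_gt0//; lra.
pose g v := l * f v.
have mg : measurable_fun setT g by exact: measurable_funM.
have bf : aebd P (fun w => f (X 0%N w)).
  by split; [exact: measurableT_comp|exists B; apply: aeW].
have gb v : `|g v| <= l * B by rewrite normrM gtr0_norm// ler_wpM2l// ltW.
have g8 v : `|g v| <= 8^-1 by exact: le_trans (gb v) l1.
have Eg0 : Ex P (fun w => g (X 0%N w)) = 0 by rewrite ExZ ?E0 ?mulr0//; exact: aebd_ig.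
have Eg2 : Ex P (fun w => g (X 0%N w) ^+ 2) <= (l * B) ^+ 2.
  rewrite -[leRHS](Ex_cst P); apply: le_Ex.
  - by apply: aebd_ig; apply: aebdX; apply: aebdM => //; exact: aebd_cst.
  - exact: ig_cst.
  - by move=> w; rewrite -(ger0_norm (sqr_ge0 _)) normrX lerXn2r ?nnegrE// mulr_ge0// ltW.
have W := bernstein (l * (eps * n%:R)) n iidX mg g8 Eg0 Eg2.
have Q w : `|psum X g n w| <= l * (eps * n%:R) -> `|psum X f n w| <= eps * n%:R.
  by rewrite /psum -mulr_sumr normrM (gtr0_norm l0) ler_pM2l.
apply: whp_imp Q _; apply: whp_le _ W.
apply: le_trans (exp_small e0 c0 (hN n Nn)).
rewrite ler_wpM2l// ler_expR.
have h : n%:R * (l * (l * B ^+ 2)) <= n%:R * (l * (eps / 2)).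
  by rewrite ler_wpM2l// ler_wpM2l// ltW.
by rewrite exprMn [l ^+ 2]expr2 -[l * l * _]mulrA; lra.
Qed.

End concentration.

Section sparse_net.
Context {R : realType} {p : nat}.
Implicit Types (u v : 'rV[R]_p).

(** One coordinate moves by a multiple of [eta] between [- n eta] and [n eta]; the natural number
    [jc.2] codes the multiple with offset [n]. *)
Definition net_step (eta : R) n v (jc : 'I_p * nat) : 'rV[R]_p :=
  v + (eta * (jc.2%:R - n%:R)) *: delta_mx 0 jc.1.

Definition grid n : seq ('I_p * nat) :=
  [seq (j, c) | j <- enum 'I_p, c <- iota 0 (n + n).+1].

(** Lattice vectors reached from 0 in at most [k] moves. Repeated entries and repeated moves of one
    coordinate do no harm: only the length of the list and its approximation property matter. *)
Fixpoint net (eta : R) (n k : nat) : seq 'rV[R]_p :=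
  if k is k'.+1 then
    net eta n k' ++ [seq net_step eta n v jc | v <- net eta n k',
                      jc <- grid n]
  else [:: 0].

Lemma size_net eta n k : size (net eta n k) = ((p * (n + n).+1).+1 ^ k)%N.
Proof.
elim: k => //= k IH; rewrite size_cat !size_allpairs IH size_enum_ord size_iota.
by rewrite expnS mulSn; congr addn; rewrite mulnC.
Qed.

Lemma l0normE u : l0norm u = #|[pred j : 'I_p | u 0 j != 0]|.
Proof.
by apply: eq_card => j; apply/idP/idP => [/set_mem//|h]; exact: mem_set.
Qed.

Lemma l0norm0 u : l0norm u = 0%N -> u = 0.
Proof.
rewrite l0normE => /card0_eq h; apply/rowP => j.
by rewrite mxE; apply/eqP; have := h j; rewrite !inE => /negbFE.
Qed.

(** Induction on the support: a nonzero coordinate is erased, the rest approximated, and the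
    coordinate restored by rounding. The clause on zeros ensures that this coordinate of [v] was
    still zero, and it later confines the error of an inner product to the [k] coordinates of the
    support instead of all [p]. *)
Lemma net_approx eta n k u : 0 < eta -> (l0norm u <= k)%N ->
  (forall j, `|u 0 j| <= n%:R * eta) ->
  exists2 v, v \in net eta n k &
    forall j, `|u 0 j - v 0 j| <= eta /\ (u 0 j = 0 -> v 0 j = 0).
Proof.
move=> e0; elim: k u => [|k IH] u uk ub.
  move: uk; rewrite leqn0 => /eqP/l0norm0 ->; exists 0; first by rewrite inE.
  by move=> j; rewrite subrr normr0; split => //; exact: ltW.
have [uk'|uk'] := leqP (l0norm u) k.
  by have [v vin hv] := IH u uk' ub; exists v => //=; rewrite mem_cat vin.
have /card_gt0P[j0] : (0 < #|[pred j : 'I_p | (u 0 j != 0)%R]|)%N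
  by rewrite -l0normE; exact: leq_ltn_trans uk'.
rewrite inE => uj0.
pose u' : 'rV[R]_p := \row_j (if j == j0 then 0 else u 0 j).
have u'k : (l0norm u' <= k)%N.
  rewrite -ltnS (leq_trans _ uk)// !l0normE; apply: proper_card; apply/properP; split.
    by apply/fintype.subsetP => j; rewrite !inE mxE; case: ifP => //; rewrite eqxx.
  by exists j0; rewrite !inE// mxE eqxx eqxx.
have u'b j : `|u' 0 j| <= n%:R * eta.
  by rewrite mxE; case: ifP => // _; rewrite normr0 mulr_ge0// ltW.
have [v vin hv] := IH u' u'k u'b.
(* In units of [eta] and shifted by [n] the coordinate lies between 0 and [2 n], so rounding is
   truncation to a natural number. *)
pose y := u 0 j0 / eta + n%:R.
have y0 : 0 <= y <= (n + n)%:R.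
  have := ub j0; rewrite ler_norml => /andP[b1 b2].
  rewrite /y natrD -lerBlDr sub0r ler_pdivlMr// mulNr b1/= lerD2r ler_pdivrMr//.
have /andP[y1 y2] := y0.
pose c := Num.truncn y.
have /andP[c1 c2] : c%:R <= y < c.+1%:R by exact: truncn_itv.
have cn : (c < (n + n).+1)%N by rewrite ltnS -(ler_nat R) (le_trans c1).
exists (net_step eta n v (j0, c)).
  rewrite /= mem_cat; apply/orP; right; apply/allpairsP; exists (v, (j0, c)); split => //=.
  by apply/allpairsP; exists (j0, c); split => //; rewrite ?mem_enum// mem_iota.
move=> j; rewrite /net_step !mxE/=; have [h1 h2] := hv j.
have [jj|jj] := eqVneq j j0; last first.
  rewrite mulr0 addr0; move: h1 h2; rewrite mxE (negbTE jj) => h1 h2.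
  by split.
have vj0 : v 0 j = 0 by apply: h2; rewrite mxE jj eqxx.
rewrite jj in vj0 *; rewrite vj0 add0r mulr1; split; last by move/eqP: uj0.
have -> : u 0 j0 - eta * (c%:R - n%:R) = eta * (y - c%:R).
  by rewrite /y; field; rewrite gt_eqF.
rewrite normrM (gtr0_norm e0) ler_piMr ?(ltW e0)//.
rewrite ler_norml; move: c2; rewrite -natr1 => c2.
by apply/andP; split; lra.
Qed.

Lemma l1norm_coord u j : `|u 0 j| <= l1norm u.
Proof. by rewrite /l1norm (bigD1 j)//= lerDl sumr_ge0. Qed.

Lemma dotvBr (x u v : 'rV[R]_p) : dotv x (u - v) = dotv x u - dotv x v.
Proof. by rewrite /dotv -sumrB; apply: eq_bigr => j _; rewrite !mxE mulrBr. Qed.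

Lemma dotv_sparse_le (w K eta : R) (x u v : 'rV[R]_p) k : 0 <= K -> 0 <= eta ->
  (forall j, `|w * x 0 j| <= K) -> (l0norm u <= k)%N ->
  (forall j, `|u 0 j - v 0 j| <= eta /\ (u 0 j = 0 -> v 0 j = 0)) ->
  `|w * dotv x u - w * dotv x v| <= k%:R * (K * eta).
Proof.
move=> K0 e0 wx uk uv.
rewrite -mulrBr -dotvBr /dotv mulr_sumr.
apply: (le_trans (ler_norm_sum _ _ _)).
apply: (@le_trans _ _ (\sum_(j in [pred j : 'I_p | u 0 j != 0]) K * eta)).
  rewrite [leRHS]big_mkcond/=; apply: ler_sum => j _.
  have [h1 h2] := uv j; rewrite inE !mxE mulrA normrM.
  case: eqP => [uj|_] /=; last by rewrite ler_pM.
  by rewrite uj h2// subrr normr0 mulr0.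
by rewrite sumr_const -(mulr_natl (K * eta)) ler_wpM2r ?mulr_ge0// ler_nat -l0normE.
Qed.

Lemma dotv_l1_le (w K : R) (x u : 'rV[R]_p) : 
  (forall j, `|w * x 0 j| <= K) -> `|w * dotv x u| <= K * l1norm u.
Proof.
move=> wx; rewrite /dotv /l1norm !mulr_sumr.
apply: (le_trans (ler_norm_sum _ _ _)); apply: ler_sum => j _.
by rewrite mulrA normrM ler_wpM2r.
Qed.

End sparse_net.

Section sparse_concentration.
Context {R : realType}.

(** One move has at most [M^4] choices for [M = maxn p n], so the logarithm of the size is at most
    [4 k ln M], the quantity that the sparsity condition bounds. *)
Lemma card_net_le (p n k : nat) : (3 <= n)%N ->
  ((p * (n + n).+1).+1 ^ k)%:R <= expR (4 * (k%:R * ln (maxn p n)%:R)) :> R.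
Proof.
move=> n3; set M := maxn p n.
have M3 : (3 <= M)%N by rewrite (leq_trans n3)// leq_maxr.
have M0 : 0 < M%:R :> R by rewrite ltr0n (leq_trans _ M3).
have le : ((p * (n + n).+1).+1 <= M ^ 4)%N.
  have pM : (p <= M)%N by exact: leq_maxl.
  have nM : (n <= M)%N by exact: leq_maxr.
  apply: (@leq_trans (M * (M + M).+1).+1).
    by rewrite ltnS leq_mul// ltnS leq_add.
  have MM : (9 <= M * M)%N by rewrite (leq_mul M3 M3).
  have -> : (M ^ 4 = (M * M) * (M * M))%N by rewrite !expnS expn0 muln1 !mulnA.
  nia.
rewrite !expRM_natl lnK ?posrE// exprAC natrX lerXn2r ?nnegrE ?exprn_ge0 ?ler0n//.
by rewrite -natrX ler_nat.
Qed.

(** That is [e <= 4], from [expR (-1/2) >= 1/2] squared. It serves to drop the logarithm: a bound on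
    [k ln (maxn p n)] is also one on [k]. *)
Lemma ln_ge1 (n : nat) : (4 <= n)%N -> 1 <= ln n%:R :> R.
Proof.
move=> n3; have n0 : 0 < n%:R :> R by rewrite ltr0n (leq_trans _ n3).
rewrite -[leLHS](expRK (1 : R)) ler_ln ?posrE ?expR_gt0//.
apply: (@le_trans _ _ 4%:R); last by rewrite ler_nat.
have h := @expR_ge1Dx R (- 2^-1).
have e : expR (1 : R) * expR (- 2^-1) ^+ 2 = 1.
  by rewrite -expRM_natl -expRD -[RHS]expR0; congr expR; field.
have e0 := expR_gt0 (1 : R).
have h2 : (4^-1 : R) <= expR (- 2^-1) ^+ 2.
  by have := expR_ge0 (- 2^-1 : R); nra.
nra.
Qed.

(** A union bound over a deterministic net gives one event for all directions, into which directions
    that depend on the sample may be inserted. A net vector has exponent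
    [4 eta sqrt n - eps sqrt n / 2], the net has logarithm at most [4 eta sqrt n], and
    [eta <= eps / 32] leaves a decay [expR (- eps sqrt n / 4)]. The bound [1/16] on [eta] keeps net
    vectors in the range of Bernstein's inequality. *)
Lemma sparse_concentration (eps : R) : 0 < eps -> exists2 eta, 0 < eta & exists N : nat,
  forall n, (N <= n)%N ->
  forall d (T : measurableType d) dV (V : measurableType dV) (P : probability T R)
    (X : nat -> T -> V) (p : nat) (x : V -> 'rV[R]_p) (w : V -> R) (K : R) (k : nat),
  iid_seq P X -> measurable_fun setT w ->
  (forall j, measurable_fun setT (fun v => x v 0 j)) ->
  (forall v j, `|w v * x v 0 j| <= K) ->
  (forall j, Ex P (fun o => w (X 0%N o) * x (X 0%N o) 0 j) = 0) ->
  k%:R * ln (maxn p n)%:R <= eta * Num.sqrt n%:R ->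
  whp P eps (fun o => forall u : 'rV[R]_p, (l0norm u <= k)%N -> K * l1norm u <= eta ->
    Ex P (fun o => (w (X 0%N o) * dotv (x (X 0%N o)) u) ^+ 2) <= eta / Num.sqrt n%:R ->
    `|\sum_(i < n) w (X i o) * dotv (x (X i o)) u| <= eps * Num.sqrt n%:R).
Proof.
move=> e0; pose eta := Num.min 16^-1 (eps / 32).
have eta0 : 0 < eta by rewrite lt_min invr_gt0 ltr0n/= divr_gt0.
have eta16 : eta <= 16^-1 by rewrite ge_min lexx.
have etae : eta <= eps / 32 by rewrite ge_min lexx orbT.
exists eta => //.
have [N hN] := sqrtn_big (2 / (eps / 4 * eps)).
exists (maxn 4 N) => n; rewrite geq_max => /andP[n4 Nn].
move=> d T dV V P X p x w K k iidX mw mx wK E0 kln; have [mX _] := iidX.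
have n0 : 0 < n%:R :> R by rewrite ltr0n (leq_trans _ n4).
set r := Num.sqrt n%:R in kln *.
have r0 : 0 < r by rewrite sqrtr_gt0.
have nr : n%:R = r * r by rewrite -expr2 sqr_sqrtr// ltW.
have r1 : 1 <= r by rewrite -[leLHS]sqrtr1 ler_wsqrtr// ler1n (leq_trans _ n4).
(* For [K <= 0] all products of [w] with a coordinate of [x] vanish, and so do the sums; afterwards
   [K] can be inverted. *)
have [K0|K0] := leP K 0.
  apply: whpT; first exact: ltW.
  move=> o u _ _ _; rewrite big1 ?normr0 ?mulr_ge0 ?(ltW e0) ?(ltW r0)// => i _.
  rewrite /dotv mulr_sumr big1// => j _; rewrite mulrA.
  have := le_trans (wK (X i o) j) K0; rewrite normr_le0 => /eqP ->.
  by rewrite mul0r.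
have kr : k%:R <= eta * r.
  apply: le_trans kln; rewrite ler_peMr// (le_trans (ln_ge1 n4))//.
  rewrite ler_ln ?posrE ?ltr0n ?(leq_trans _ (leq_maxr _ _)) ?(leq_trans _ n4)//.
  by rewrite ler_nat leq_maxr.
(* With this mesh, [n] widths reach [K^-1], which bounds the coordinates of an admissible [u], while
   passing to a net vector changes each summand by at most [k / n <= eta / sqrt n]. *)
pose h := (K * n%:R)^-1.
have h0 : 0 < h by rewrite invr_gt0 mulr_gt0.
pose f u v := w v * dotv (x v) u.
have mf u : measurable_fun setT (f u).
  apply: measurable_funM => //; apply: measurable_sum => j.
  exact: measurable_funM.
have bwx j : aebd P (fun o => w (X 0%N o) * x (X 0%N o) 0 j).
  split; last by exists K; apply: aeW.
  by apply: measurable_funM; [exact: measurableT_comp|exact: (measurableT_comp (mx j))].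
have fE u o : f u (X 0%N o) = \sum_j u 0 j * (w (X 0%N o) * x (X 0%N o) 0 j).
  by rewrite /f /dotv mulr_sumr; apply: eq_bigr => j _; ring.
have bf u : aebd P (fun o => f u (X 0%N o)).
  rewrite (_ : (fun o => _) = (fun o => \sum_j u 0 j * (w (X 0%N o) * x (X 0%N o) 0 j))).
    by apply: aebd_sum => j; apply: aebdM => //; exact: aebd_cst.
  by apply/funext.
have Ef u : Ex P (fun o => f u (X 0%N o)) = 0.
  rewrite (eq_Ex _ (fE u)) Ex_sum; last by move=> j; apply: aebdM => //; exact: aebd_cst.
  by rewrite big1// => j _; rewrite ExZ ?E0 ?mulr0//; exact: aebd_ig.
(* Not every net vector is close to an admissible direction. The requirements of Bernstein's
   inequality are made premises, so the vectors that violate them satisfy [good] trivially. *)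
pose good v o := (forall y, `|f v y| <= 8^-1) ->
  Ex P (fun o => f v (X 0%N o) ^+ 2) <= 4 * eta / r -> `|psum X (f v) n o| <= eps / 2 * r.
have G v : whp P (2 * expR (n%:R * (4 * eta / r) - eps / 2 * r)) (good v).
  have [v8|nv8] := pselect (forall y, `|f v y| <= 8^-1); last first.
    by apply: whpT => [|o]; [rewrite mulr_ge0// expR_ge0|move=> ?].
  have [Ev|nEv] := pselect (Ex P (fun o => f v (X 0%N o) ^+ 2) <= 4 * eta / r); last first.
    by apply: whpT => [|o]; [rewrite mulr_ge0// expR_ge0|move=> _ ?].
  apply: whp_imp (bernstein (eps / 2 * r) n iidX (mf v) v8 (Ef v) Ev).
  by move=> o ? _.
have := whp_seq (net h n k) _ G => /(_ (mulr_ge0 (ler0n _ _) (expR_ge0 _))) W.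
have sz : (size (net (R:=R) (p:=p) h n k))%:R * (2 * expR (n%:R * (4 * eta / r) - eps / 2 * r)) <= eps.
  rewrite size_net; apply: le_trans (exp_small e0 _ (hN n Nn)); last by rewrite divr_gt0.
  rewrite mulrCA ler_wpM2l//.
  apply: (@le_trans _ _ (expR (4 * (eta * r)) * expR (n%:R * (4 * eta / r) - eps / 2 * r))).
    rewrite ler_wpM2r ?expR_ge0//; apply: le_trans (card_net_le _ _ _) _; first exact: ltnW.
    by rewrite ler_expR ler_wpM2l.
  rewrite -expRD ler_expR -/r nr.
  have -> : r * r * (4 * eta / r) = 4 * eta * r by field; rewrite gt_eqF.
  have : eta * r <= eps / 32 * r by rewrite ler_wpM2r// ltW.
  lra.
apply: whp_imp (whp_le sz W) => o H u uk u1 Eu.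
have hK : n%:R * h = K^-1 by rewrite /h invfM mulrCA divff ?mulr1// gt_eqF.
have [v vin uv] : exists2 v, v \in net h n k &
    forall j, `|u 0 j - v 0 j| <= h /\ (u 0 j = 0 -> v 0 j = 0).
  apply: net_approx => // j; rewrite hK (le_trans (l1norm_coord u j))//.
  rewrite -[leRHS]mul1r ler_pdivlMr// mulrC (le_trans u1)// (le_trans eta16)//.
  by rewrite invf_le1// ler1n.
have Kh : k%:R * (K * h) <= eta / r.
  have -> : K * h = n%:R^-1 by rewrite /h invfM mulrA divff ?mul1r// gt_eqF.
  rewrite ler_pdivrMr//.
  by rewrite nr mulrA divfK ?gt_eqF.
have uvle y : `|f u y - f v y| <= eta / r.
  apply: le_trans Kh; by apply: dotv_sparse_le => //; exact: ltW.
have etar : eta / r <= eta by rewrite ler_pdivrMr// ler_peMr// ltW.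
have fu y : `|f u y| <= eta by apply: le_trans (dotv_l1_le u (wK y)) u1.
have v8 y : `|f v y| <= 8^-1.
  have -> : f v y = f u y - (f u y - f v y) by ring.
  by rewrite (le_trans (ler_normB _ _))//; have := fu y; have := uvle y; lra.
have er0 : 0 <= eta / r by rewrite divr_ge0// ltW.
(* From [b^2 <= 2 a^2 + 2 (a - b)^2]: the net vector inherits the second moment of [u] up to
   constants. *)
have Ev : Ex P (fun o => f v (X 0%N o) ^+ 2) <= 4 * eta / r.
  have b1 : aebd P (fun o => 2 * f u (X 0%N o) ^+ 2).
    by apply: aebdM; [exact: aebd_cst|exact: aebdX].
  apply: (@le_trans _ _ (Ex P (fun o => 2 * f u (X 0%N o) ^+ 2 + 2 * (eta / r) ^+ 2))).
    apply: le_Ex.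
    - exact/aebd_ig/aebdX.
    - by apply: igD; [exact: aebd_ig|exact: ig_cst].
    - move=> o'; set y := X 0%N o'; have := uvle y.
      move: (f u y) (f v y) (eta / r) er0 => a b c c0; rewrite ler_norml => /andP[c1 c2].
      have : (a - b) ^+ 2 <= c ^+ 2 by nra.
      have := sqr_ge0 (a + (a - b)); have := sqr_ge0 (b - 2 * a); nra.
  rewrite ExD; [|exact: aebd_ig|exact: ig_cst].
  rewrite ExZ; last exact/aebd_ig/aebdX.
  rewrite Ex_cst.
  have : (eta / r) ^+ 2 <= eta / r.
    by rewrite expr2 ler_piMl// (le_trans etar)// (le_trans eta16)// invf_le1// ler1n.
  have -> : 4 * eta / r = 4 * (eta / r) by ring.
  lra.
have Gv := H v vin v8 Ev.
have -> : \sum_(i < n) w (X i o) * dotv (x (X i o)) u =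
    psum X (f v) n o + \sum_(i < n) (f u (X i o) - f v (X i o)).
  by rewrite /psum -big_split/=; apply: eq_bigr => i _; rewrite addrC subrK.
rewrite (le_trans (ler_normD _ _))//.
have : `|\sum_(i < n) (f u (X i o) - f v (X i o))| <= eta * r.
  apply: (le_trans (ler_norm_sum _ _ _)).
  apply: (@le_trans _ _ (\sum_(i < n) eta / r)); first exact: ler_sum.
  rewrite sumr_const card_ord -(mulr_natl (eta / r)) nr.
  by rewrite (_ : r * r * (eta / r) = eta * r)//; field; rewrite gt_eqF.
have : eta * r <= eps / 32 * r by rewrite ler_wpM2r// ltW.
have : 0 < eps * r by rewrite mulr_gt0.
lra.
Qed.

End sparse_concentration.

(** * Link functions and conditional means *)

Section misc.
Context {R : realType}.

(* [x * expR (- ln (x ^+ 2))] is also [0] at [x = 0], as is [0^-1]. *)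
Lemma measurable_invr : measurable_fun setT (@GRing.inv R).
Proof.
have -> : @GRing.inv R = (fun x => x * expR (- ln (x ^+ 2))).
  apply/funext => x; have [->|x0] := eqVneq x 0; first by rewrite invr0 mul0r.
  have x2 : 0 < x ^+ 2 by rewrite exprn_even_gt0.
  by rewrite expRN lnK ?posrE//; field.
apply: measurable_funM => //; apply: (measurableT_comp (@measurable_expR R)).
apply: measurable_funN; apply: (measurableT_comp (@measurable_ln R)).
exact: exprn_measurable.
Qed.

Lemma measurable_funV d (T : measurableType d) (f : T -> R) :
  measurable_fun setT f -> measurable_fun setT (fun x => (f x)^-1).
Proof. exact: measurableT_comp measurable_invr. Qed.

Lemma measurable_logistic : measurable_fun setT (@logistic R).
Proof.
apply: measurable_funM; first exact: measurable_expR.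
apply: measurable_funV; apply: measurable_funD => //; exact: measurable_expR.
Qed.

Definition odds (q : R) : R := q / (1 - q).

Lemma oddsB (q q' : R) : q != 1 -> q' != 1 ->
  odds q - odds q' = (q - q') / ((1 - q) * (1 - q')).
Proof.
move=> q1 q1'; rewrite /odds.
have n1 : 1 - q != 0 by rewrite subr_eq0 eq_sym.
have n2 : 1 - q' != 0 by rewrite subr_eq0 eq_sym.
by field; apply/andP.
Qed.

Lemma odds_logistic (u : R) : odds (logistic u) = expR u.
Proof.
rewrite /odds /logistic; have e0 := expR_gt0 u.
have n1 : 1 + expR u != 0 by rewrite gt_eqF// addr_gt0.
by field; rewrite n1 addrK oner_neq0.
Qed.

(** [a] is the derivative of the odds in the linear index: [(1 - u)^-2] for the identity and
    [expR u] for the logit link, whose odds are exponential. The range [b / 4] keeps the shifted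
    probability away from 1 in the first case and [t] within [1/8] in the second; [16 / b^3] serves
    both. *)
Lemma odds_link (Lam : R -> R) (b : R) : Lam = id \/ Lam = @logistic R ->
  0 < b < 2^-1 -> exists2 a : R -> R, measurable_fun setT a &
  forall u t, b / 2 <= Lam u <= 1 - b / 2 -> `|t| <= b / 4 ->
    `|a u| <= 16 / b ^+ 3 /\
    `|odds (Lam (u + t)) - odds (Lam u) - a u * t| <= 16 / b ^+ 3 * t ^+ 2.
Proof.
move=> hLam /andP[b0 b2].
have b3 : 0 < b ^+ 3 by rewrite exprn_gt0.
have bb : b ^+ 2 <= 1 by rewrite exprn_ile1 ?ltW//; lra.
case: hLam => ->; [exists (fun u => (1 - u)^-1 ^+ 2)|exists expR].
- by apply: measurable_funX; apply: measurable_funV; apply: measurable_funB.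
- move=> u t /andP[u1 u2]; rewrite ler_norml => /andP[t1 t2].
  have q0 : b / 2 <= 1 - u by lra.
  have q1 : b / 4 <= 1 - (u + t) by lra.
  have p0 : 0 < 1 - u by lra.
  have p1 : 0 < 1 - (u + t) by lra.
  have i0 : (1 - u)^-1 <= 2 / b by rewrite -[leRHS]invrK invf_div lef_pV2 ?posrE// divr_gt0.
  have i1 : (1 - (u + t))^-1 <= 4 / b by rewrite -[leRHS]invrK invf_div lef_pV2 ?posrE// divr_gt0.
  have s0 : (1 - u)^-1 ^+ 2 <= 4 / b ^+ 2.
    have -> : 4 / b ^+ 2 = (2 / b) ^+ 2 by field; rewrite gt_eqF.
    by rewrite lerXn2r// nnegrE ?invr_ge0 ?divr_ge0 ?ltW.
  split.
    rewrite (ger0_norm (sqr_ge0 _)).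
    apply: (le_trans s0); rewrite ler_pdivrMr ?exprn_gt0//.
    rewrite mulrAC ler_pdivlMr// exprSr.
    have -> : 4 * (b ^+ 2 * b) = (4 * b) * b ^+ 2 by ring.
    by rewrite ler_wpM2r ?sqr_ge0//; lra.
  rewrite /= /odds.
  have -> : (u + t) / (1 - (u + t)) - u / (1 - u) - (1 - u)^-1 ^+ 2 * t =
     (1 - u)^-1 ^+ 2 * (1 - (u + t))^-1 * t ^+ 2 by field; rewrite !gt_eqF.
  have j0 : 0 <= (1 - u)^-1 ^+ 2 by exact: sqr_ge0.
  have j1 : 0 <= (1 - (u + t))^-1 by rewrite invr_ge0 ltW.
  rewrite (ger0_norm (mulr_ge0 (mulr_ge0 j0 j1) (sqr_ge0 t))).
  rewrite ler_wpM2r ?sqr_ge0//.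
  have -> : 16 / b ^+ 3 = 4 / b ^+ 2 * (4 / b) by field; rewrite gt_eqF.
  by rewrite ler_pM.
- exact: (@measurable_expR R).
- move=> u t /andP[u1 u2] tb.
  have t8 : `|t| <= 8^-1 by lra.
  have e0 := expR_gt0 u.
  have eu : expR u <= 2 / b.
    rewrite -odds_logistic /odds ler_pdivrMr; last lra.
    have : 2 / b * (b / 2) = 1 by field; rewrite gt_eqF.
    have : 2 / b * (b / 2) <= 2 / b * (1 - logistic u).
      by rewrite ler_wpM2l ?divr_ge0 ?(ltW b0)//; lra.
    lra.
  have c : 2 / b <= 16 / b ^+ 3.
    rewrite ler_pdivrMr// mulrAC ler_pdivlMr// exprSr mulrA.
    by rewrite ler_wpM2r ?(ltW b0)//; lra.
  rewrite gtr0_norm//; split; first exact: le_trans c.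
  rewrite !odds_logistic expRD.
  have -> : expR u * expR t - expR u - expR u * t = expR u * (expR t - 1 - t) by ring.
  have h1 := expR_le_quad t8; have h2 := expR_ge1Dx t.
  rewrite normrM gtr0_norm// ger0_norm; last lra.
  by apply: ler_pM; [exact: ltW|lra|exact: le_trans c|lra].
Qed.

Lemma L2norm d (T : measurableType d) (P : probability T R) (f : T -> R) :
  aebd P f -> ('N[P]_2%:E[EFin \o f] = (Num.sqrt (Ex P (fun w => f w ^+ 2)))%:E)%E.
Proof.
move=> bf; rewrite unlock.
rewrite (_ : (\int[P]_x _)%E = (\int[P]_x ((f x) ^+ 2)%:E)%E); last first.
  apply: eq_integral => w _; rewrite abse_EFin poweR_EFin powR_mulrn ?normr_ge0//.
  by rewrite real_normK ?num_real.
rewrite Ex_EFin; last exact/aebd_ig/aebdX.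
by rewrite poweR_EFin powR12_sqrt// Ex_ge0// => w; exact: sqr_ge0.
Qed.

Lemma ae_prob1 d (T : measurableType d) (P : probability T R) (A : set T) :
  measurable A -> P A = 1%E -> \forall w \ae P, A w.
Proof.
move=> mA PA; exists (~` A); split => //; first exact: measurableC.
by rewrite probability_setC// PA subee.
Qed.

Lemma ae_probP d (T : measurableType d) (P : probability T R) (A : set T) :
  measurable A -> (\forall w \ae P, A w) -> P A = 1%E.
Proof.
move=> mA [N [mN PN AN]]; apply/eqP; rewrite eq_le probability_le1//=.
have : (P (~` A) <= 0)%E.
  by rewrite -PN le_measure// ?inE//; exact: measurableC.
rewrite probability_setC// => h.
by rewrite leNgt; apply/negP => h2; move: h; rewrite leNgt sube_gt0 h2.
Qed.

End misc.

Section cond_mean.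
Context {R : realType} d (T : measurableType d) dV (V : measurableType dV)
  (P : probability T R) (W : T -> R) (F : T -> V).
Hypothesis mF : measurable_fun setT F.
Hypothesis WF : cond_mean_zero P W F.

Let iW : ig P W. Proof. by have [] := WF. Qed.

Lemma cond_mean_zero_indic (B : set V) : measurable B ->
  Ex P (fun w => \1_B (F w) * W w) = 0.
Proof.
move=> mB; have [_ /(_ _ mB)] := WF; rewrite unlock /Ex /Rintegral => h.
transitivity (fine (0%E : \bar R)); last by [].
by rewrite -h; congr fine; apply: eq_integral => w _; rewrite !indicE.
Qed.

Let igM (f : V -> R) M : measurable_fun setT f -> (forall v, `|f v| <= M) ->
  ig P (fun w => f (F w) * W w).
Proof.
move=> mf fM; apply: (@ig_le _ _ _ _ _ (fun w => M * W w)).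
- by apply: measurable_funM; [exact: measurableT_comp|exact: (igm iW)].
- by move=> w; rewrite !normrM ler_wpM2r// (le_trans (fM _))// ler_norm.
- exact: igZ.
Qed.

(** Counting levels below [t] turns a truncated value into a sum of indicators. *)
Let sum_lt (M t : nat) : (\sum_(k < M) (k < t)%N = minn M t)%N.
Proof.
elim: M => [|M IH]; first by rewrite big_ord0 min0n.
by rewrite big_ord_recr/= IH; case: (ltnP M t) => h /=; lia.
Qed.

Lemma cond_mean_zero_bounded (f : V -> R) B : measurable_fun setT f ->
  (forall v, `|f v| <= B) -> Ex P (fun w => f (F w) * W w) = 0.
Proof.
move=> mf fB.
have B0 : 0 <= B by apply: le_trans (fB point); exact: normr_ge0.
(* Uniform approximation of [f] by a staircase of step [N.+1^-1]. *)
have approx (N : nat) : `|Ex P (fun w => f (F w) * W w)| <= N.+1%:R^-1 * Ex P (fun w => `|W w|).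
  pose h : R := N.+1%:R^-1.
  have h0 : 0 < h by rewrite invr_gt0.
  (* [f + B] ranges between 0 and [2 B], and [M] steps of height [h] cover this range. *)
  pose M := (Num.truncn ((B + B) / h)).+1.
  pose A (k : 'I_M) := [set v | k.+1%:R * h <= f v + B].
  have mA k : measurable (A k).
    by apply: measurable_le_set => //; exact: measurable_funD.
  pose g v : R := h * (\sum_(k < M) \1_(A k) v) - B.
  have mg : measurable_fun setT g.
    apply: measurable_funB => //; apply: measurable_funM => //.
    by apply: measurable_sum => k; exact: measurable_indic.
  have fg v : `|f v - g v| <= h.
    pose y := (f v + B) / h.
    have := fB v; rewrite ler_norml => /andP[f1 f2].
    have y0 : 0 <= y by rewrite divr_ge0 ?(ltW h0)//; lra.
    have /andP[t1 t2] := truncn_itv y0.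
    have yM : (Num.truncn y <= M)%N.
      apply: leqW; apply: le_truncn.
      by rewrite ler_pM2r ?invr_gt0//; lra.
    have -> : g v = h * (Num.truncn y)%:R - B.
      rewrite /g; congr (_ * _ - _).
      rewrite -(minn_idPr yM) -sum_lt natr_sum; apply: eq_bigr => k _.
      rewrite indicE; congr (nat_of_bool _)%:R.
      rewrite truncn_gt_nat; apply/idP/idP.
        by move/set_mem; rewrite /A/= ler_pdivlMr.
      by move=> hh; apply: mem_set; rewrite /A/= -ler_pdivlMr.
    have fy : f v = h * y - B by rewrite /y; field; rewrite gt_eqF.
    rewrite fy; have -> : h * y - B - (h * (Num.truncn y)%:R - B) = h * (y - (Num.truncn y)%:R) by ring.
    rewrite normrM gtr0_norm// ler_piMr ?(ltW h0)// ger0_norm; last lra.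
    by move: t2; rewrite -natr1; lra.
  have gb v : `|g v| <= B + h.
    have -> : g v = f v - (f v - g v) by ring.
    by rewrite (le_trans (ler_normB _ _))// lerD.
  have Eg : Ex P (fun w => g (F w) * W w) = 0.
    rewrite (@eq_Ex _ _ _ _ _ (fun w => h * (\sum_(k < M) \1_(A k) (F w) * W w) - B * (\1_setT (F w) * W w))); last first.
      by move=> w; rewrite /g indicT mul1r mulrBl -mulrA mulr_suml.
    have ii (C : set V) : measurable C -> ig P (fun w => \1_C (F w) * W w).
      move=> mC; apply: (igM (M := 1)); first exact: measurable_indic.
      by move=> v; rewrite indicE; case: (v \in C); rewrite /= ?normr1 ?normr0.
    have isum (r : seq 'I_M) : ig P (fun w => \sum_(k <- r) \1_(A k) (F w) * W w) /\
        Ex P (fun w => \sum_(k <- r) \1_(A k) (F w) * W w) = 0.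
      elim: r => [|k r [IH1 IH2]].
        by rewrite (_ : (fun w => _) = cst 0); [split; [exact: ig_cst|exact: Ex_cst]|apply/funext => w; rewrite big_nil].
      rewrite (_ : (fun w => _) = (fun w => \1_(A k) (F w) * W w + \sum_(k <- r) \1_(A k) (F w) * W w)); last first.
        by apply/funext => w; rewrite big_cons.
      by split; [apply: igD => //; exact: ii|rewrite ExD ?IH2 ?cond_mean_zero_indic ?addr0//; exact: ii].
    have [is1 is2] := isum (index_enum _).
    rewrite ExB; [|exact: igZ|by apply: igZ; exact: ii].
    rewrite ExZ// is2 ExZ; last exact: ii.
    by rewrite cond_mean_zero_indic// !mulr0 subrr.
  have -> : Ex P (fun w => f (F w) * W w) = Ex P (fun w => f (F w) * W w - g (F w) * W w).
    by rewrite ExB ?Eg ?subr0//; [exact: (igM mf fB)|exact: (igM mg gb)].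
  have i3 : ig P (fun w => f (F w) * W w - g (F w) * W w).
    by apply: igB; [exact: (igM mf fB)|exact: (igM mg gb)].
  apply: le_trans (Ex_norm i3) _.
  rewrite -ExZ; last exact: ig_norm.
  apply: le_Ex; [exact: ig_norm|exact/igZ/ig_norm|].
  by move=> w; rewrite -mulrBl normrM ler_wpM2r.
apply/eqP; rewrite -normr_eq0; apply/eqP/le_anti; rewrite normr_ge0 andbT.
set E := `|_|; set w := Ex P (fun w => `|W w|) in approx.
rewrite leNgt; apply/negP => E0.
have w0 : 0 <= w by apply: Ex_ge0.
have := approx (Num.truncn (w / E)).
have h1 := truncnS_gt (w / E).
rewrite mulrC ler_pdivlMr// => h2.
have : w < (Num.truncn (w / E)).+1%:R * E by rewrite -ltr_pdivrMr.
by rewrite mulrC ltNge h2.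
Qed.

Lemma cond_mean_zero_aebd (f : V -> R) : measurable_fun setT f ->
  aebd P (fun w => f (F w)) -> Ex P (fun w => f (F w) * W w) = 0.
Proof.
move=> mf [mfF [M fM]].
pose f' v := if `|f v| <= M then f v else 0.
have mf' : measurable_fun setT f'.
  apply: measurable_fun_ifT => //.
  by apply: measurable_fun_ler => //; exact: measurableT_comp.
have mW := igm iW.
rewrite (@Ex_ae_eq _ _ _ _ _ (fun w => f' (F w) * W w)).
- apply: (@cond_mean_zero_bounded f' `|M|) => // v.
  rewrite /f'; case: ifPn => [h|_]; last by rewrite normr0.
  exact: le_trans (ler_norm _).
- exact: measurable_funM.
- by apply: measurable_funM => //; exact: measurableT_comp.
- by apply: filterS fM => w; rewrite /f' => ->.
Qed.

End cond_mean.

Lemma whp_prob_le {R : realType} d (T : measurableType d) (P : probability T R)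
    (e : R) (Q : T -> Prop) (A B : set T) : measurable A -> measurable B ->
  whp P e Q -> (forall w, Q w -> A w -> B w) -> fine (P A) <= fine (P B) + e.
Proof.
move=> mA mB [F [mF PF FQ]] QAB.
rewrite -lee_fin EFinD !fineK ?fin_num_measure//.
have mU : measurable (B `|` ~` F) by apply: measurableU => //; exact: measurableC.
apply: (@le_trans _ _ (P (B `|` ~` F))).
  rewrite le_measure ?inE// => w Aw.
  by have [Fw|nFw] := pselect (F w); [left; apply: QAB Aw; exact: FQ|right].
apply: le_trans (measureU2 _ _ _) _ => //; first exact: measurableC.
by rewrite leeD2l.
Qed.

Lemma whp_and0 {R : realType} d (T : measurableType d) (P : probability T R) (e : R)
    (Q Q' : T -> Prop) : whp P 0 Q -> whp P e Q' -> whp P e (fun w => Q w /\ Q' w).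
Proof. by move=> h h'; have := whp_and h h'; rewrite add0r. Qed.

(** * From pointwise bounds to almost sure bounds *)

Section ae_bounded.
Context {R : realType} d (T : measurableType d) dV (V : measurableType dV).
Context (P : probability T R) (X : nat -> T -> V).
Hypothesis iidX : iid_seq P X.

Let mX i : measurable_fun setT (X i). Proof. by have [] := iidX. Qed.

Lemma whp_iid (A : set V) : measurable A -> (\forall w \ae P, A (X 0%N w)) ->
  whp P 0 (fun w => forall i, A (X i w)).
Proof.
move=> mA aeA; apply: whp_ae; apply/ae_foralln => i.
have mXA j : measurable (X j @^-1` A) by rewrite -[X in measurable X]setTI; exact: mX.
have [_ [idX _]] := iidX.
by apply: (@ae_prob1 _ _ _ P (X i @^-1` A)) => //; rewrite (idX i 0%N A mA); exact: ae_probP.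
Qed.

(** The concentration results assume pointwise bounds, the model gives almost sure ones. Multiplying
    by the indicator of a set of full probability passes from one to the other, changing no moment
    and changing sums only on a null event. *)
Definition restr (A : set V) (f : V -> R) v : R := \1_A v * f v.

Lemma restrE A f v : A v -> restr A f v = f v.
Proof. by move=> Av; rewrite /restr indicE mem_set// mul1r. Qed.

Lemma measurable_restr A f : measurable A -> measurable_fun setT f ->
  measurable_fun setT (restr A f).
Proof. by move=> mA mf; apply: measurable_funM => //; exact: measurable_indic. Qed.

Lemma restr_le A f B v : 0 <= B -> (A v -> `|f v| <= B) -> `|restr A f v| <= B.
Proof.
move=> B0 fB; have [Av|nAv] := pselect (A v); first by rewrite restrE// fB.
by rewrite /restr indicE memNset// mul0r normr0.
Qed.

Lemma psum_restr A f n w : (forall i, A (X i w)) -> psum X (restr A f) n w = psum X f n w.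
Proof. by move=> Aw; apply: eq_bigr => i _; rewrite restrE. Qed.

Lemma Ex_restr A (f : V -> R) (F : R -> R) : measurable A -> measurable_fun setT f ->
  measurable_fun setT F -> (\forall w \ae P, A (X 0%N w)) ->
  Ex P (fun w => F (restr A f (X 0%N w))) = Ex P (fun w => F (f (X 0%N w))).
Proof.
move=> mA mf mF aeA; apply: Ex_ae_eq.
- by apply: (measurableT_comp mF); apply: measurableT_comp => //; exact: measurable_restr.
- by apply: (measurableT_comp mF); exact: measurableT_comp.
- by apply: filterS aeA => w Aw; rewrite restrE.
Qed.

Lemma measurable_bound_set (f : V -> R) B : measurable_fun setT f ->
  measurable [set v | `|f v| <= B].
Proof. by move=> mf; apply: measurable_le_set => //; exact: measurableT_comp. Qed.

End ae_bounded.

Section concentration_ae.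
Context {R : realType}.

Lemma concentration_small_ae (eps : R) : 0 < eps -> exists2 eta, 0 < eta & exists N : nat,
  forall n, (N <= n)%N ->
  forall d (T : measurableType d) dV (V : measurableType dV) (P : probability T R)
    (X : nat -> T -> V) (f : V -> R), iid_seq P X -> measurable_fun setT f ->
  (\forall w \ae P, `|f (X 0%N w)| <= eta) -> Ex P (fun w => f (X 0%N w)) = 0 ->
  Ex P (fun w => f (X 0%N w) ^+ 2) <= eta / Num.sqrt n%:R ->
  whp P eps (fun w => `|psum X f n w| <= eps * Num.sqrt n%:R).
Proof.
move=> e0; have [eta eta0 [N hN]] := concentration_small e0.
exists eta => //; exists N => n Nn d T dV V P X f iidX mf fb f0 f2.
pose A := [set v | `|f v| <= eta].
have mA : measurable A by exact: measurable_bound_set.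
have h := hN n Nn d T dV V P X (restr A f) iidX (measurable_restr mA mf).
apply: whp_imp (whp_and0 (whp_iid iidX mA fb) (h _ _ _)).
- by move=> w [Aw]; rewrite psum_restr.
- by move=> v; apply: restr_le => //; exact: ltW.
- by rewrite (Ex_restr iidX mA mf (@measurable_id _ _ _) fb).
- by rewrite (Ex_restr iidX mA mf (exprn_measurable 2) fb).
Qed.

Lemma weak_lln_ae (eps B : R) : 0 < eps -> 0 < B -> exists N : nat,
  forall n, (N <= n)%N ->
  forall d (T : measurableType d) dV (V : measurableType dV) (P : probability T R)
    (X : nat -> T -> V) (f : V -> R), iid_seq P X -> measurable_fun setT f ->
  (\forall w \ae P, `|f (X 0%N w)| <= B) -> Ex P (fun w => f (X 0%N w)) = 0 ->
  whp P eps (fun w => `|psum X f n w| <= eps * n%:R).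
Proof.
move=> e0 B0; have [N hN] := weak_lln e0 B0.
exists N => n Nn d T dV V P X f iidX mf fb f0.
pose A := [set v | `|f v| <= B].
have mA : measurable A by exact: measurable_bound_set.
have h := hN n Nn d T dV V P X (restr A f) iidX (measurable_restr mA mf).
apply: whp_imp (whp_and0 (whp_iid iidX mA fb) (h _ _)).
- by move=> w [Aw]; rewrite psum_restr.
- by move=> v; apply: restr_le => //; exact: ltW.
- by rewrite (Ex_restr iidX mA mf (@measurable_id _ _ _) fb).
Qed.

Lemma sparse_concentration_ae (eps : R) : 0 < eps -> exists2 eta, 0 < eta & exists N : nat,
  forall n, (N <= n)%N ->
  forall d (T : measurableType d) dV (V : measurableType dV) (P : probability T R)
    (X : nat -> T -> V) (p : nat) (x : V -> 'rV[R]_p) (w : V -> R) (K : R) (k : nat),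
  iid_seq P X -> measurable_fun setT w ->
  (forall j, measurable_fun setT (fun v => x v 0 j)) ->
  (forall j, \forall o \ae P, `|w (X 0%N o) * x (X 0%N o) 0 j| <= K) ->
  (forall j, Ex P (fun o => w (X 0%N o) * x (X 0%N o) 0 j) = 0) ->
  k%:R * ln (maxn p n)%:R <= eta * Num.sqrt n%:R ->
  whp P eps (fun o => forall u : 'rV[R]_p, (l0norm u <= k)%N -> K * l1norm u <= eta ->
    Ex P (fun o => (w (X 0%N o) * dotv (x (X 0%N o)) u) ^+ 2) <= eta / Num.sqrt n%:R ->
    `|\sum_(i < n) w (X i o) * dotv (x (X i o)) u| <= eps * Num.sqrt n%:R).
Proof.
move=> e0; have [eta eta0 [N hN]] := sparse_concentration e0.
exists eta => //; exists N => n Nn d T dV V P X p x w K k iidX mw mx wxK wx0 kn.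
pose A := \big[setI/setT]_(j <- index_enum 'I_p) [set v | `|w v * x v 0 j| <= K].
have mwx j : measurable_fun setT (fun v => w v * x v 0 j) by exact: measurable_funM.
have mA : measurable A.
  by apply: bigsetI_measurable => j _; exact: measurable_bound_set.
have AE v : A v <-> forall j, `|w v * x v 0 j| <= K.
  rewrite /A -bigcap_seq; split => h j; last by move=> _; exact: h.
  by apply: (h j); rewrite /= mem_index_enum.
have aeA : \forall o \ae P, A (X 0%N o).
  have [s sP] : exists s : seq 'I_p, forall j, j \in s by exists (index_enum 'I_p) => j; rewrite mem_index_enum.
  have : \forall o \ae P, forall j, j \in s -> `|w (X 0%N o) * x (X 0%N o) 0 j| <= K.
    elim: (s) => [|i r IH]; first by apply: aeW.
    apply: filterS2 (wxK i) IH => o h1 h2 j.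
    by rewrite inE => /orP[/eqP->//|]; exact: h2.
  by apply: filterS => o h; apply/AE => j; exact: h.
have h := hN n Nn d T dV V P X p x (restr A w) K k iidX (measurable_restr mA mw) mx.
apply: whp_imp (whp_and0 (whp_iid iidX mA aeA) (h _ _ kn)).
- move=> o [Ao] ho u uk uK uE.
  have := ho u uk uK.
  have -> : Ex P (fun o => (restr A w (X 0%N o) * dotv (x (X 0%N o)) u) ^+ 2) =
            Ex P (fun o => (w (X 0%N o) * dotv (x (X 0%N o)) u) ^+ 2).
    have mX0 : measurable_fun setT (X 0%N) by have [] := iidX.
    have md : measurable_fun setT (fun o => dotv (x (X 0%N o)) u).
      apply: measurable_sum => j; apply: measurable_funM => //.
      exact: (measurableT_comp (mx j)).
    apply: Ex_ae_eq.
    + apply: measurable_funX; apply: measurable_funM => //.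
      apply: measurableT_comp => //; exact: measurable_restr.
    + by apply: measurable_funX; apply: measurable_funM => //; exact: measurableT_comp.
    + by apply: filterS aeA => o' Ao'; rewrite restrE.
  move=> /(_ uE); congr (`|_| <= _); apply: eq_bigr => i _.
  by rewrite restrE.
- move=> v j; rewrite /restr -mulrA; apply: (@restr_le _ _ _ A (fun v => w v * x v 0 j)).
    (* [0 <= K] is read off from the almost sure bound by integrating the two constants. *)
    rewrite -(Ex_cst P 0) -(Ex_cst P K); apply: ae_le_Ex; [exact: ig_cst|exact: ig_cst|].
    by apply: filterS (wxK j) => o; exact: le_trans.
  by move=> /AE.
- move=> j; rewrite -[RHS](wx0 j).
  have mX0 : measurable_fun setT (X 0%N) by have [] := iidX.
  rewrite -[RHS](Ex_restr iidX mA (mwx j) (@measurable_id _ _ _) aeA).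
  by apply: eq_Ex => o; rewrite /restr mulrA.
Qed.

Lemma clt_bound_ae d (T : measurableType d) dV (V : measurableType dV)
    (P : probability T R) (X : nat -> T -> V) (f : V -> R) (B : R) (n : nat) (k t : R) :
  iid_seq P X -> measurable_fun setT f -> 0 <= B ->
  (\forall w \ae P, `|f (X 0%N w)| <= B) -> Ex P (fun w => f (X 0%N w)) = 0 ->
  Ex P (fun w => f (X 0%N w) ^+ 2) = 1 -> (0 < n)%N -> 0 < k ->
  `|fine (P [set w | psum X f n w / Num.sqrt n%:R <= t]) - Phi t| <=
    4 * k + 3 * (k ^- 2) ^+ 3 * (B ^+ 3 + gauss_cube) / Num.sqrt n%:R.
Proof.
move=> iidX mf B0 fB f0 f1 n0 k0.
pose A := [set v | `|f v| <= B].
have mA : measurable A by exact: measurable_bound_set.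
have mr := measurable_restr mA mf.
have b1 v : `|restr A f v| <= B by exact: restr_le.
have E0 : Ex P (fun w => restr A f (X 0%N w)) = 0.
  by rewrite (Ex_restr iidX mA mf (@measurable_id _ _ _) fB).
have E1 : Ex P (fun w => restr A f (X 0%N w) ^+ 2) = 1.
  by rewrite (Ex_restr iidX mA mf (exprn_measurable 2) fB).
have := clt_bound iidX mr b1 E0 E1 t n0 k0.
have mX i : measurable_fun setT (X i) by have [] := iidX.
have mS h : measurable_fun setT h -> measurable [set w | psum X h n w / Num.sqrt n%:R <= t].
  move=> mh; apply: measurable_le_set => //; apply: measurable_funM => //.
  exact: measurable_psum.
have := whp_iid iidX mA fB.
move=> hA; suff -> : fine (P [set w | psum X f n w / Num.sqrt n%:R <= t]) =
  fine (P [set w | psum X (restr A f) n w / Num.sqrt n%:R <= t]) by [].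
apply/eqP; rewrite eq_le; apply/andP; split.
  by rewrite -[leRHS]addr0; apply: whp_prob_le (mS _ _) (mS _ _) hA _ => // w /= Aw; rewrite psum_restr.
by rewrite -[leRHS]addr0; apply: whp_prob_le (mS _ _) (mS _ _) hA _ => // w /= Aw; rewrite psum_restr.
Qed.

End concentration_ae.

(** * Pointwise second-order expansion of the score *)

Section expansion.
Context {R : realType}.
Variables (C L D e r0 t0 t rm h hl hh a : R).
Hypotheses (D01 : D = 0 \/ D = 1) (C0 : 0 <= C) (L0 : 0 <= L) (eC : `|e| <= 2 * C).
Hypotheses (aL : `|a| <= L) (linkL : `|hh - hl - a * t| <= L * t ^+ 2).
Hypotheses (hhl : `|h - hl| <= L * `|rm|) (t1 : `|t| <= 1).

(** In the application [D] is the treatment, [e] is [y - g 0], [r0] and [rm] are the approximation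
    errors of [g 0] and [m], [t0] and [t] the index errors of the fitted control regression and
    propensity score, and [h], [hl], [hh] the odds at the true propensity score, at its sparse
    approximation and at its estimate. *)
Lemma link_le : `|hh - h| <= 2 * L * (`|t| + `|rm|).
Proof.
have -> : hh - h = (hh - hl - a * t) + a * t - (h - hl) by ring.
apply: (le_trans (ler_normB _ _)); apply: (le_trans (lerD (ler_normD _ _) (lexx _))).
have p1 : `|a * t| <= L * `|t| by rewrite normrM ler_wpM2r.
have p2 : L * t ^+ 2 <= L * `|t|.
  by rewrite ler_wpM2l// -(real_normK (num_real t)) expr2 ler_piMr.
have p3 : 0 <= L * `|rm| by rewrite mulr_ge0.
by move: linkL hhl => q1 q2; lra.
Qed.

(** Beyond the linear terms only the link remainder and the product of the errors [r0 - t0] and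
    [hh - h] survive, both carrying the factor [1 - D]. That factor is kept on [t0^2] because the
    empirical rate controls this error over untreated units only. *)
Lemma score_expansion :
  `|(e + r0 - t0) * (D - (1 - D) * hh) - e * (D - (1 - D) * h)
    - (r0 * (D - (1 - D) * h) - (D - (1 - D) * h) * t0 - (1 - D) * e * a * t
       + (1 - D) * e * (h - hl))|
  <= (2 * C + 4) * L * (r0 ^+ 2 + (1 - D) * t0 ^+ 2 + t ^+ 2 + rm ^+ 2).
Proof.
have DD : 0 <= 1 - D <= 1 by case: D01 => ->; rewrite ?subrr ?subr0 lexx ler01.
have [D0 D1] := andP DD.
have -> : (e + r0 - t0) * (D - (1 - D) * hh) - e * (D - (1 - D) * h)
    - (r0 * (D - (1 - D) * h) - (D - (1 - D) * h) * t0 - (1 - D) * e * a * t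
       + (1 - D) * e * (h - hl)) =
   - ((1 - D) * (e * (hh - hl - a * t))) - (1 - D) * ((r0 - t0) * (hh - h)) by ring.
have n1 z : `|(1 - D) * z| = (1 - D) * `|z| by rewrite normrM ger0_norm.
apply: (le_trans (ler_normB _ _)); rewrite normrN !n1.
have p1 : (1 - D) * `|e * (hh - hl - a * t)| <= 2 * C * (L * t ^+ 2).
  apply: (@le_trans _ _ (1 * `|e * (hh - hl - a * t)|)); first by rewrite ler_wpM2r.
  by rewrite mul1r normrM ler_pM.
have p2 : (1 - D) * `|(r0 - t0) * (hh - h)| <=
   (1 - D) * ((`|r0| + `|t0|) * (2 * L * (`|t| + `|rm|))).
  by rewrite ler_wpM2l// normrM ler_pM// ?link_le// ler_normB.
have p3 : (`|r0| + `|t0|) * (`|t| + `|rm|) <= r0 ^+ 2 + t0 ^+ 2 + t ^+ 2 + rm ^+ 2.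
  rewrite -(real_normK (num_real r0)) -(real_normK (num_real t0)).
  rewrite -(real_normK (num_real t)) -(real_normK (num_real rm)).
  move: `|r0| `|t0| `|t| `|rm| => x1 x2 x3 x4.
  rewrite -subr_ge0.
  have -> : x1 ^+ 2 + x2 ^+ 2 + x3 ^+ 2 + x4 ^+ 2 - (x1 + x2) * (x3 + x4) =
     2^-1 * ((x1 - x3) ^+ 2 + (x1 - x4) ^+ 2 + (x2 - x3) ^+ 2 + (x2 - x4) ^+ 2) by field.
  by rewrite mulr_ge0// !addr_ge0// sqr_ge0.
have p4 : (1 - D) * ((`|r0| + `|t0|) * (2 * L * (`|t| + `|rm|))) <=
    2 * L * (r0 ^+ 2 + (1 - D) * t0 ^+ 2 + t ^+ 2 + rm ^+ 2).
  have -> : (1 - D) * ((`|r0| + `|t0|) * (2 * L * (`|t| + `|rm|))) =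
     2 * L * ((1 - D) * ((`|r0| + `|t0|) * (`|t| + `|rm|))) by ring.
  rewrite ler_wpM2l ?mulr_ge0//.
  have := ler_wpM2l D0 p3.
  by case: D01 => ->; rewrite ?subrr ?subr0 ?mul0r ?mul1r ?addr0// => _; rewrite !addr_ge0// sqr_ge0.
have p5 : 0 <= (1 - D) * t0 ^+ 2 by rewrite mulr_ge0// sqr_ge0.
have := sqr_ge0 r0; have := sqr_ge0 t; have := sqr_ge0 rm; move: (r0 ^+ 2) (t ^+ 2) (rm ^+ 2) ((1 - D) * t0 ^+ 2) p1 p2 p4 p5 => y1 y2 y3 y4 p1 p2 p4 p5 h1 h2 h3.
have q1 : 0 <= C * L by rewrite mulr_ge0.
have q2 : 0 <= C * L * (y1 + y4 + y3) by rewrite mulr_ge0//; lra.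
have q3 : 0 <= L * (y1 + y4 + y2 + y3) by rewrite mulr_ge0//; lra.
have -> : (2 * C + 4) * L * (y1 + y4 + y2 + y3) = 2 * C * (L * y2) + 2 * L * (y1 + y4 + y2 + y3) + 2 * (C * L * (y1 + y4 + y3)) + 2 * (L * (y1 + y4 + y2 + y3)) by ring.
lra.
Qed.

(** A first-order bound in the sup norm, which is all that the variance estimator requires. *)
Lemma score_close (dl : R) : `|r0| <= dl -> `|t0| <= dl -> `|t| <= dl -> `|rm| <= dl ->
  dl <= 1 -> `|D - (1 - D) * h| <= L ->
  `|(e + r0 - t0) * (D - (1 - D) * hh) - e * (D - (1 - D) * h)| <= (8 * C + 10) * L * dl.
Proof.
move=> r0d t0d td rmd dl1 AL.
have dl0 : 0 <= dl by apply: le_trans r0d.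
have DD : 0 <= 1 - D <= 1 by case: D01 => ->; rewrite ?subrr ?subr0 lexx ler01.
have [D0 D1] := andP DD.
have -> : (e + r0 - t0) * (D - (1 - D) * hh) - e * (D - (1 - D) * h) =
  (r0 - t0) * (D - (1 - D) * h) - (1 - D) * ((e + (r0 - t0)) * (hh - h)) by ring.
have p0 : `|r0 - t0| <= 2 * dl by apply: (le_trans (ler_normB _ _)); lra.
apply: (le_trans (ler_normB _ _)).
have p1 : `|(r0 - t0) * (D - (1 - D) * h)| <= 2 * dl * L by rewrite normrM ler_pM.
have p2 : `|hh - h| <= 4 * L * dl.
  apply: (le_trans link_le); have -> : 4 * L * dl = 2 * L * (dl + dl) by ring.
  by rewrite ler_wpM2l ?mulr_ge0// lerD.
have p3 : `|e + (r0 - t0)| <= 2 * C + 2 by apply: (le_trans (ler_normD _ _)); move: eC p0 dl1; lra.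
have p4 : `|(1 - D) * ((e + (r0 - t0)) * (hh - h))| <= (2 * C + 2) * (4 * L * dl).
  rewrite normrM (ger0_norm D0) -[leRHS]mul1r ler_pM// normrM ler_pM//.
have -> : (8 * C + 10) * L * dl = 2 * dl * L + (2 * C + 2) * (4 * L * dl) by ring.
exact: lerD.
Qed.

End expansion.

(** * Normal quantiles and Slutsky's lemma *)

Section Phi_quantile.
Context {R : realType}.
Implicit Types t a : R.
Local Notation N := (normal_prob (0 : R) 1).

Lemma Phi_Ex t : Phi t = Ex N (fun x => (x <= t)%R%:R).
Proof.
rewrite /Phi -Ex_indic//.
by apply: eq_Ex => x; rewrite indicE mem_setE in_itv.
Qed.

Let mle t : measurable_fun setT (fun x : R => (x <= t)%R%:R : R).
Proof.
rewrite (_ : (fun x : R => _) = \1_(`]-oo, t]%classic)); last first.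
  by apply/funext => x; rewrite indicE mem_setE in_itv.
by apply: measurable_indic; exact: measurable_itv.
Qed.

Let igle t : ig N (fun x : R => (x <= t)%R%:R : R).
Proof.
apply: aebd_ig; split; first exact: mle.
by exists 1; apply: aeW => x; case: (x <= t); rewrite ?normr1 ?normr0.
Qed.

(** Reflection produces the closed half-line above [t], which shares the point [t] with the one
    below. That this point has no mass comes from the Lipschitz bound: [t] is lowered by an
    arbitrary [h > 0]. *)
Lemma PhiN t : Phi (- t) = 1 - Phi t.
Proof.
have mN : measurable_fun setT (fun x : R => (- x <= - t)%R%:R : R).
  by apply: (measurableT_comp (mle (- t))); exact: measurable_funN.
have igN : ig N (fun x : R => (- x <= - t)%R%:R : R).
  apply: aebd_ig; split; first exact: mN.
  by exists 1; apply: aeW => x; case: (- x <= - t); rewrite ?normr1 ?normr0.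
have E1 : Phi (- t) = Ex N (fun x => (- x <= - t)%R%:R).
  by rewrite Phi_Ex -(Ex_normalN ltr01 (mle (- t))).
have E2 : 1 <= Phi t + Phi (- t).
  rewrite E1 Phi_Ex -ExD// -[leLHS](Ex_cst N 1).
  apply: le_Ex; [exact: ig_cst|exact: igD|] => x.
  rewrite lerN2; case: (leP x t) => h; first by rewrite lerDl.
  by rewrite (ltW h) add0r.
have E3 h : 0 < h -> Phi (t - h) + Phi (- t) <= 1.
  move=> h0; rewrite E1 Phi_Ex -ExD// -[leRHS](Ex_cst N 1).
  apply: le_Ex; [exact: igD|exact: ig_cst|] => x.
  rewrite lerN2; case: (leP t x) => q; last by rewrite addr0; case: (x <= t - h); rewrite ?lexx ?ler01.
  have -> : (x <= t - h) = false by apply/negbTE; rewrite -ltNge; lra.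
  by rewrite add0r.
apply/eqP; rewrite eq_le; apply/andP; split; last lra.
apply/ler_addgt0Pr => h h0; have := E3 h h0.
have : Phi t <= Phi (t - h) + (t - (t - h)) by apply: Phi_lip; lra.
lra.
Qed.

(** Chebyshev's inequality; any decay is enough to find quantiles by the intermediate value
    theorem. *)
Lemma Phi_tail t : 0 < t -> 1 - Phi t <= t ^- 2.
Proof.
move=> t0.
have t2 : 0 < t ^+ 2 by rewrite exprn_gt0.
have i2 := ig_normal_sqr (R := R) ltr01.
have -> : 1 - Phi t = Ex N (fun x => 1 - (x <= t)%R%:R).
  rewrite ExB; [|exact: ig_cst|exact: igle].
  by rewrite -Phi_Ex Ex_cst.
apply: (@le_trans _ _ (Ex N (fun x => t ^- 2 * x ^+ 2))).
  apply: le_Ex; [by apply: igB; [exact: ig_cst|exact: igle]|exact: igZ|] => x /=.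
  case: (leP x t) => h; first by rewrite subrr mulr_ge0 ?sqr_ge0// invr_ge0 ltW.
  by rewrite subr0 mulrC ler_pdivlMr// mul1r ler_pXn2r ?nnegrE ?(ltW h) ?(ltW t0) ?(ltW (lt_trans t0 h)).
by rewrite ExZ// Ex_normal_sqr// expr1n mulr1.
Qed.

Lemma continuous_Phi : continuous (@Phi R).
Proof.
move=> t; apply/cvgrPdist_le => e e0; near=> u.
have ue : `|t - u| <= e by near: u; apply: cvgr_dist_le => //; exact: cvg_id.
apply: le_trans ue; have [ut|tu] := leP u t.
  have h1 := Phi_le ut; have h2 := Phi_lip ut.
  by rewrite !ger0_norm ?subr_ge0//; lra.
have h1 := Phi_le (ltW tu); have h2 := Phi_lip (ltW tu).
by rewrite !ler0_norm ?subr_le0 ?(ltW tu)//; lra.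
Unshelve. all: by end_near.
Qed.

Lemma Phi_surj a : 0 < a < 1 -> exists q, Phi q = a.
Proof.
move=> /andP[a0 a1].
have tail (e : R) : 0 < e -> exists2 t, 0 < t & 1 - Phi t <= e.
  move=> e0; pose t := 1 + e^-1; have ie : 0 < e^-1 by rewrite invr_gt0.
  have t0 : 0 < t by rewrite /t; lra.
  exists t => //. apply: (le_trans (Phi_tail t0)).
  rewrite -[leRHS]invrK lef_pV2 ?posrE ?exprn_gt0//.
  rewrite /t sqrrD expr1n mul1r; have := sqr_ge0 e^-1; lra.
have [t1 t10 h1] := tail _ a0.
have a1' : 0 < 1 - a by lra.
have [t2 t20 h2] := tail _ a1'.
have le12 : - t1 <= t2 by lra.
have l1 : Phi (- t1) <= a by rewrite PhiN.
have l2 : a <= Phi t2 by lra.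
have [|q _ <-] := @IVT R Phi (- t1) t2 a le12 (continuous_subspaceT continuous_Phi).
  by rewrite ge_min l1 le_max l2 orbT.
by exists q.
Qed.

Lemma Phi_Phiinv a : 0 < a < 1 -> Phi (Phiinv a) = a.
Proof. by move=> /Phi_surj[q hq]; rewrite /Phiinv; case: xgetP => // /(_ q). Qed.

End Phi_quantile.

(** The random factor multiplies [S], as the estimating equation delivers it. On the event, the
    half-lines for [S] and [W] contain each other once the threshold is shifted by [e (|t| + 1)],
    and [Phi] is 1-Lipschitz. *)
Lemma slutsky {R : realType} d (T : measurableType d) (P : probability T R)
    (W S : T -> R) (t e e1 e2 : R) :
  measurable_fun setT W -> measurable_fun setT S -> 0 <= e < 1 ->
  (forall s, `|fine (P [set w | W w <= s]) - Phi s| <= e1) ->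
  whp P e2 (fun w => exists r E, [/\ W w + E = r * S w, `|r - 1| <= e & `|E| <= e]) ->
  `|fine (P [set w | S w <= t]) - Phi t| <= e2 + e1 + e * (`|t| + 1).
Proof.
move=> mW mS /andP[e0 elt1] hW hq.
have mWs s : measurable [set w | W w <= s] by exact: measurable_le_set.
have mSs : measurable [set w | S w <= t] by exact: measurable_le_set.
pose h := e * (`|t| + 1).
have h0 : 0 <= h by rewrite mulr_ge0// addr_ge0.
have rt (r : R) : `|r - 1| <= e -> `|r * t - t| <= e * `|t|.
  by move=> hr; rewrite -[X in _ - X]mul1r -mulrBl normrM ler_wpM2r.
have hE : h = e * `|t| + e by rewrite /h mulrDr mulr1.
have U : fine (P [set w | S w <= t]) <= fine (P [set w | W w <= t + h]) + e2.
  apply: (whp_prob_le mSs (mWs _) hq) => w [r [E [h1 h2 h3]]] /= St.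
  have r0 : 0 <= r by move: h2; rewrite ler_norml => /andP[? _]; lra.
  have := ler_wpM2l r0 St; have := rt r h2.
  by move: h3; rewrite !ler_norml => /andP[? ?] /andP[? ?]; lra.
have Lo : fine (P [set w | W w <= t - h]) <= fine (P [set w | S w <= t]) + e2.
  apply: (whp_prob_le (mWs _) mSs hq) => w [r [E [h1 h2 h3]]] /= St.
  have r0 : 0 < r by move: h2; rewrite ler_norml => /andP[? _]; lra.
  rewrite -(ler_pM2l r0) -h1; have := rt r h2.
  by move: h3; rewrite !ler_norml => /andP[? ?] /andP[? ?]; lra.
have := hW (t + h); have := hW (t - h).
have : Phi (t + h) <= Phi t + (t + h - t) by apply: Phi_lip; lra.
have : Phi t <= Phi (t - h) + (t - (t - h)) by apply: Phi_lip; lra.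
rewrite -/h !ler_norml => ? ? /andP[? ?] /andP[? ?]; apply/andP; split; lra.
Qed.

(** * Moments in the regression model *)

Ltac bd := repeat first [ eassumption | apply: aebdX | apply: aebdM | apply: aebdB | apply: aebdD
  | apply: aebdN | exact: aebd_cst ].
Ltac igt := apply: aebd_ig; bd.

Section model.
Context {R : realType} {dZ : measure_display} {Zt : measurableType dZ}.
Context {d : measure_display} {T : measurableType d} {P : probability T R}.
Variables (X : nat -> T -> R * R * Zt) (g : R -> Zt -> R) (m : Zt -> R) (p : nat).
Variables (x : Zt -> 'rV[R]_p) (Lam : R -> R).
Variables (bg0 : 'rV[R]_(p + p)) (bm0 : 'rV[R]_p) (dl rate K C c b : R).

Local Notation Y v := (v.1.1).
Local Notation Dd v := (v.1.2).
Local Notation Z v := (v.2).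
Local Notation X0 := (X 0%N).

Definition noise (w : T) : R := Y (X0 w) - g (Dd (X0 w)) (Z (X0 w)).
Definition approx_g (w : T) : R := g (Dd (X0 w)) (Z (X0 w)) - dotv (xtilde (Dd (X0 w)) (x (Z (X0 w)))) bg0.
Definition link_m (z : Zt) : R := Lam (dotv (x z) bm0).

(** The hypotheses at one sample size, with the sequences frozen to numbers; [b] is the overlap
    constant. The extra requirement [dl <= b / 4], true for large [n], keeps the sparse
    approximation of the propensity score in the range of [odds_link]. *)
Record model_hyp : Prop := ModelHyp {
  model_iid : iid_seq P X;
  model_binary : forall i w, Dd (X i w) = 0 \/ Dd (X i w) = 1;
  measurable_g0 : measurable_fun setT (g 0);
  measurable_g1 : measurable_fun setT (g 1);
  measurable_m : measurable_fun setT m;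
  measurable_x : forall j, measurable_fun setT (fun z => x z 0 j);
  noise_cond_mean : cond_mean_zero P noise (fun w => (Z (X0 w), Dd (X0 w)));
  treatment_cond_mean : cond_mean_zero P (fun w => Dd (X0 w) - m (Z (X0 w))) (fun w => Z (X0 w));
  approx_g_L2 : ('N[P]_2%:E[EFin \o approx_g] <= rate%:E)%E;
  approx_g_sup : \forall w \ae P, `|approx_g w| <= dl;
  approx_m_L2 : ('N[P]_2%:E[EFin \o (fun w => m (Z (X0 w)) - link_m (Z (X0 w)))%R] <= rate%:E)%E;
  approx_m_sup : \forall w \ae P, `|m (Z (X0 w)) - link_m (Z (X0 w))| <= dl;
  controls_bound : forall j, \forall w \ae P, `|x (Z (X0 w)) 0 j| <= K;
  g_bound : \forall w \ae P, `|g 0 (Z (X0 w))| <= C /\ `|g 1 (Z (X0 w))| <= C;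
  outcome_bound : \forall w \ae P, `|Y (X0 w)| <= C;
  overlap_bound : P [set w | b <= m (Z (X0 w)) <= 1 - b] = 1%E;
  noise_L4 : (c%:E <= 'N[P]_2%:E[EFin \o (fun w => noise w ^+ 2)%R])%E;
  link_cases : Lam = id \/ Lam = @logistic R;
  overlap_gt0 : 0 < b; overlap_lt : b < 2^-1; outcome_bound_gt0 : 0 < C; noise_gt0 : 0 < c; tolerance_gt0 : 0 < dl; tolerance_le : dl <= b / 4;
  rate_ge0 : 0 <= rate }.

Hypothesis H : model_hyp.

Definition approx_g0 (z : Zt) : R := g 0 z - dotv (x z) (rsubmx bg0).
Definition approx_m (z : Zt) : R := m z - link_m z.
Definition score_weight (v : R * R * Zt) : R := Dd v - (1 - Dd v) * odds (m (Z v)).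

Let mX i : measurable_fun setT (X i). Proof. by have [] := model_iid H. Qed.

Lemma measurable_Z i : measurable_fun setT (fun w => Z (X i w)).
Proof. exact: (measurableT_comp measurable_snd (mX i)). Qed.
Lemma measurable_D i : measurable_fun setT (fun w => Dd (X i w)).
Proof. by apply: (measurableT_comp measurable_snd); exact: (measurableT_comp measurable_fst (mX i)). Qed.
Lemma measurable_Y i : measurable_fun setT (fun w => Y (X i w)).
Proof. by apply: (measurableT_comp measurable_fst); exact: (measurableT_comp measurable_fst (mX i)). Qed.

Let mZ (f : Zt -> R) : measurable_fun setT f -> measurable_fun setT (fun w => f (Z (X0 w))).
Proof. by move=> mf; apply: (measurableT_comp mf); exact: measurable_Z. Qed.

Lemma measurable_dotx (u : 'rV[R]_p) : measurable_fun setT (fun z => dotv (x z) u).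
Proof. by apply: measurable_sum => j; apply: measurable_funM => //; exact: (measurable_x H j). Qed.

Lemma measurable_lam : measurable_fun setT link_m.
Proof.
have mL : measurable_fun setT Lam.
  by have [->|->] := link_cases H; [exact: measurable_id|exact: measurable_logistic].
exact: (measurableT_comp mL (measurable_dotx bm0)).
Qed.

Lemma measurable_odds : measurable_fun setT (@odds R).
Proof.
apply: measurable_funM => //; apply: measurable_funV; exact: measurable_funB.
Qed.

Lemma measurable_r0 : measurable_fun setT approx_g0.
Proof. by apply: measurable_funB; [exact: (measurable_g0 H)|exact: measurable_dotx]. Qed.

Lemma measurable_rm : measurable_fun setT approx_m.
Proof. by apply: measurable_funB; [exact: (measurable_m H)|exact: measurable_lam]. Qed.

Let mcT : \forall w \ae P, b <= m (Z (X0 w)) <= 1 - b.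
Proof.
apply: ae_prob1 (overlap_bound H).
have -> : [set w | b <= m (Z (X0 w)) <= 1 - b] =
    [set w | b <= m (Z (X0 w))] `&` [set w | m (Z (X0 w)) <= 1 - b].
  by apply/seteqP; split => w /=; [move/andP|move=> [-> ->]].
have mmZ := mZ (measurable_m H).
by apply: measurableI; exact: measurable_le_set.
Qed.

Lemma aebd_D : aebd P (fun w => Dd (X0 w)).
Proof.
split; first exact: measurable_D.
by exists 1; apply: aeW => w; have [->|->] := model_binary H 0 w; rewrite ?normr0 ?normr1.
Qed.
Lemma aebd_Y : aebd P (fun w => Y (X0 w)).
Proof. by split; [exact: measurable_Y|exists C; exact: (outcome_bound H)]. Qed.
Lemma aebd_g0 : aebd P (fun w => g 0 (Z (X0 w))).
Proof. by split; [exact: mZ (measurable_g0 H)|exists C; apply: filterS (g_bound H) => w []]. Qed.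
Lemma aebd_g1 : aebd P (fun w => g 1 (Z (X0 w))).
Proof. by split; [exact: mZ (measurable_g1 H)|exists C; apply: filterS (g_bound H) => w []]. Qed.
Lemma aebd_m : aebd P (fun w => m (Z (X0 w))).
Proof.
split; [exact: mZ (measurable_m H)|exists 1; apply: filterS mcT => w /andP[h1 h2]].
by have := overlap_gt0 H; have := overlap_lt H => b2 b0; rewrite ler_norml; apply/andP; split; lra.
Qed.
Lemma aebd_x j : aebd P (fun w => x (Z (X0 w)) 0 j).
Proof. by split; [exact: mZ (measurable_x H j)|exists K; exact: (controls_bound H)]. Qed.
Lemma aebd_dot (u : 'rV[R]_p) : aebd P (fun w => dotv (x (Z (X0 w))) u).
Proof.
by apply: aebd_sum => j; apply: aebdM; [exact: aebd_x|exact: aebd_cst].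
Qed.
Lemma aebd_inv1m : aebd P (fun w => (1 - m (Z (X0 w)))^-1).
Proof.
split.
  apply: measurable_funV; apply: measurable_funB => //; exact: mZ (measurable_m H).
exists b^-1; apply: filterS mcT => w /andP[h1 h2]; have b0 := overlap_gt0 H.
rewrite ger0_norm ?invr_ge0; last lra.
by rewrite lef_pV2 ?posrE//; lra.
Qed.
Lemma aebd_odds : aebd P (fun w => odds (m (Z (X0 w)))).
Proof. exact: aebdM aebd_m aebd_inv1m. Qed.

Let bA : aebd P (fun w => score_weight (X0 w)).
Proof. by have := aebd_D; have := aebd_odds => h1 h2; rewrite /score_weight; bd. Qed.

Lemma resid1 w : Dd (X0 w) * noise w = Dd (X0 w) * (Y (X0 w) - g 1 (Z (X0 w))).
Proof. by rewrite /noise; have [->|->] := model_binary H 0 w; rewrite ?mul0r ?mul1r. Qed.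

Lemma residE w : noise w = Y (X0 w) - g 0 (Z (X0 w)) - Dd (X0 w) * (g 1 (Z (X0 w)) - g 0 (Z (X0 w))).
Proof.
by rewrite /noise; have [->|->] := model_binary H 0 w; rewrite ?mul0r ?mul1r ?subr0//; ring.
Qed.

Lemma aebd_noise : aebd P noise.
Proof.
have := aebd_D; have := aebd_Y; have := aebd_g0; have := aebd_g1 => h1 h2 h3 h4.
have -> : noise = (fun w => Y (X0 w) - g 0 (Z (X0 w)) - Dd (X0 w) * (g 1 (Z (X0 w)) - g 0 (Z (X0 w)))).
  by apply/funext => w; exact: residE.
by bd.
Qed.

(** [score_weight] equals [(D - m) / (1 - m)], which is centred given [Z]. This is orthogonality of
    the score with respect to the outcome regression. *)
Lemma Ex_score_zero (f : Zt -> R) : measurable_fun setT f ->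
  aebd P (fun w => f (Z (X0 w))) -> Ex P (fun w => score_weight (X0 w) * f (Z (X0 w))) = 0.
Proof.
move=> mf bf; have i1m := aebd_inv1m; have hD := aebd_D; have hm := aebd_m.
rewrite -(@cond_mean_zero_aebd _ _ _ _ _ P _ _ (measurable_Z 0) (treatment_cond_mean H) (fun z => f z / (1 - m z))).
- apply: Ex_ae_eq.
  + by have [] : aebd P (fun w => score_weight (X0 w) * f (Z (X0 w))) by apply: aebdM.
  + by have [] : aebd P (fun w => f (Z (X0 w)) / (1 - m (Z (X0 w))) * (Dd (X0 w) - m (Z (X0 w)))) by bd.
  + apply: filterS mcT => w /andP[h1 h2]; have b0 := overlap_gt0 H.
    rewrite /score_weight /odds; field.
    by rewrite subr_eq0 gt_eqF//; lra.
- apply: measurable_funM => //; apply: measurable_funV; apply: measurable_funB => //.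
  exact: (measurable_m H).
- by bd.
Qed.

Lemma measurable_ZD : measurable_fun setT (fun w => (Z (X0 w), Dd (X0 w))).
Proof.
by apply/measurable_fun_pairP; split; [exact: (measurable_Z 0)|exact: (measurable_D 0)].
Qed.

Lemma Ex_resid_zero (f : Zt * R -> R) : measurable_fun setT f ->
  aebd P (fun w => f (Z (X0 w), Dd (X0 w))) ->
  Ex P (fun w => f (Z (X0 w), Dd (X0 w)) * noise w) = 0.
Proof.
by move=> mf bf; have := cond_mean_zero_aebd measurable_ZD (noise_cond_mean H) mf bf.
Qed.

Lemma resid0 w : (1 - Dd (X0 w)) * noise w = (1 - Dd (X0 w)) * (Y (X0 w) - g 0 (Z (X0 w))).
Proof. by rewrite /noise; have [->|->] := model_binary H 0 w; rewrite ?subrr ?mul0r. Qed.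

(** Orthogonality with respect to the propensity score: on untreated units [Y - g 0] is the noise,
    centred given covariates and treatment. *)
Lemma Ex_control_zero (f : Zt -> R) : measurable_fun setT f ->
  aebd P (fun w => f (Z (X0 w))) ->
  Ex P (fun w => (1 - Dd (X0 w)) * (Y (X0 w) - g 0 (Z (X0 w))) * f (Z (X0 w))) = 0.
Proof.
move=> mf bf; rewrite -[RHS](@Ex_resid_zero (fun zd => (1 - zd.2) * f zd.1)).
- by apply: eq_Ex => w; rewrite /= -resid0; ring.
- apply: measurable_funM; first by apply: measurable_funB.
  exact: (measurableT_comp mf measurable_fst).
- by have hD := aebd_D; bd.
Qed.

(** Given [Z], a unit is untreated with probability [1 - m >= b]. *)
Lemma overlap (f : Zt -> R) : measurable_fun setT f ->
  aebd P (fun w => f (Z (X0 w))) -> (forall z, 0 <= f z) ->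
  b * Ex P (fun w => f (Z (X0 w))) <= Ex P (fun w => (1 - Dd (X0 w)) * f (Z (X0 w))).
Proof.
move=> mf bf f0; have hD := aebd_D; have hm := aebd_m.
have E0 : Ex P (fun w => f (Z (X0 w)) * (Dd (X0 w) - m (Z (X0 w)))) = 0.
  exact: (@cond_mean_zero_aebd _ _ _ _ _ P _ _ (measurable_Z 0) (treatment_cond_mean H) f).
have -> : Ex P (fun w => (1 - Dd (X0 w)) * f (Z (X0 w))) =
    Ex P (fun w => (1 - m (Z (X0 w))) * f (Z (X0 w)) - f (Z (X0 w)) * (Dd (X0 w) - m (Z (X0 w)))).
  by apply: eq_Ex => w; ring.
rewrite ExB; [|igt|igt].
rewrite E0 subr0 -ExZ; last igt.
apply: ae_le_Ex; [igt|igt|].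
apply: filterS mcT => w /andP[h1 h2]; rewrite ler_wpM2r//; lra.
Qed.

Lemma dotv_xtilde k (t : R) (u : 'rV[R]_k) (v : 'rV[R]_(k + k)) :
  dotv (xtilde t u) v = t * dotv u (lsubmx v) + (1 - t) * dotv u (rsubmx v).
Proof.
rewrite /dotv /xtilde big_split_ord/= !mulr_sumr; congr (_ + _); apply: eq_bigr => j _.
  by rewrite row_mxEl !mxE mulrA.
by rewrite row_mxEr !mxE mulrA.
Qed.

Lemma rgT_control w : (1 - Dd (X0 w)) * approx_g w = (1 - Dd (X0 w)) * approx_g0 (Z (X0 w)).
Proof.
rewrite /approx_g dotv_xtilde /approx_g0.
by have [->|->] := model_binary H 0 w; rewrite ?subrr ?subr0 ?mul0r ?mul1r ?add0r.
Qed.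

(** The hypothesis bounds the error of [g] at the observed treatment, hence that of [g 0] only on
    untreated units. [overlap], applied to the indicator of the violating set, shows that this set
    is null. *)
Lemma r0_ae : \forall w \ae P, `|approx_g0 (Z (X0 w))| <= dl.
Proof.
pose B := [set z | dl < `|approx_g0 z|].
have mB : measurable B.
  by apply: measurable_lt_set => //; apply: measurableT_comp => //; exact: measurable_r0.
have bB : aebd P (fun w => \1_B (Z (X0 w)) : R).
  split; first by apply: mZ; exact: measurable_indic.
  by exists 1; apply: aeW => w; rewrite indicE; case: (_ \in _); rewrite /= ?normr1 ?normr0.
have hD := aebd_D.
have le : b * Ex P (fun w => \1_B (Z (X0 w))) <= Ex P (fun w => (1 - Dd (X0 w)) * \1_B (Z (X0 w))).
  by apply: overlap => //; exact: measurable_indic.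
have E0 : Ex P (fun w => (1 - Dd (X0 w)) * \1_B (Z (X0 w))) = 0.
  rewrite -[RHS](Ex_cst P 0); apply: Ex_ae_eq => //.
    by have [] : aebd P (fun w => (1 - Dd (X0 w)) * \1_B (Z (X0 w))) by bd.
  apply: filterS (approx_g_sup H) => w; have := rgT_control w.
  have [->|->] := model_binary H 0 w; rewrite ?subrr ?subr0 ?mul0r ?mul1r// => ->.
  rewrite indicE => h; case: (boolP (_ \in _)) => //.
  by move/set_mem; rewrite /B/= ltNge h.
have PB : P ((fun w => Z (X0 w)) @^-1` (~` B)) = 1%E.
  have mZB : measurable ((fun w => Z (X0 w)) @^-1` B).
    by rewrite -[X in measurable X]setTI; exact: measurable_Z.
  rewrite preimage_setC probability_setC//.
  have EB : Ex P (fun w => \1_B (Z (X0 w))) = fine (P ((fun w => Z (X0 w)) @^-1` B)).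
    by rewrite /Ex /Rintegral -[in RHS](setIT ((fun w => Z (X0 w)) @^-1` B)) -integral_indic.
  have : fine (P ((fun w => Z (X0 w)) @^-1` B)) <= 0.
    have b0 := overlap_gt0 H; rewrite -EB; move: le; rewrite E0 pmulr_rle0//.
  rewrite -lee_fin fineK ?fin_num_measure// => PB0.
  have -> : P ((fun w => Z (X0 w)) @^-1` B) = 0%E by apply/eqP; rewrite eq_le PB0 measure_ge0.
  by rewrite sube0.
have mZB : measurable ((fun w => Z (X0 w)) @^-1` (~` B)).
  by rewrite -[X in measurable X]setTI; apply: measurable_Z => //; exact: measurableC.
apply: filterS (ae_prob1 mZB PB) => w /=.
by rewrite /B/= => /negP; rewrite -leNgt.
Qed.

Lemma aebd_r0 : aebd P (fun w => approx_g0 (Z (X0 w))).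
Proof. by split; [exact: mZ measurable_r0|exists dl; exact: r0_ae]. Qed.
Lemma aebd_rm : aebd P (fun w => approx_m (Z (X0 w))).
Proof. by split; [exact: mZ measurable_rm|exists dl; exact: (approx_m_sup H)]. Qed.
Lemma aebd_approx_g : aebd P approx_g.
Proof.
split; last by exists dl; exact: (approx_g_sup H).
have := aebd_D; have := aebd_g0; have := aebd_g1; have := aebd_dot (lsubmx bg0); have := aebd_dot (rsubmx bg0) => h1 h2 h3 h4 h5.
have -> : approx_g = (fun w => Dd (X0 w) * (g 1 (Z (X0 w)) - dotv (x (Z (X0 w))) (lsubmx bg0)) +
   (1 - Dd (X0 w)) * (g 0 (Z (X0 w)) - dotv (x (Z (X0 w))) (rsubmx bg0))).
  apply/funext => w; rewrite /approx_g dotv_xtilde.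
  by have [->|->] := model_binary H 0 w; rewrite ?subrr ?subr0 ?mul0r ?mul1r ?add0r ?addr0.
suff [] : aebd P (fun w => Dd (X0 w) * (g 1 (Z (X0 w)) - dotv (x (Z (X0 w))) (lsubmx bg0)) +
   (1 - Dd (X0 w)) * (g 0 (Z (X0 w)) - dotv (x (Z (X0 w))) (rsubmx bg0))) by [].
by bd.
Qed.

Lemma Ex_rm2 : Ex P (fun w => approx_m (Z (X0 w)) ^+ 2) <= rate ^+ 2.
Proof.
have := approx_m_L2 H; rewrite L2norm; last exact: aebd_rm.
rewrite lee_fin => h.
have E0 : 0 <= Ex P (fun w => approx_m (Z (X0 w)) ^+ 2) by apply: Ex_ge0 => w; exact: sqr_ge0.
by rewrite -[leLHS]sqr_sqrtr// lerXn2r ?nnegrE ?sqrtr_ge0// (rate_ge0 H).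
Qed.

Lemma Ex_r02 : Ex P (fun w => approx_g0 (Z (X0 w)) ^+ 2) <= rate ^+ 2 / b.
Proof.
have b0 := overlap_gt0 H; rewrite ler_pdivlMr// mulrC.
have hr := aebd_r0; have hD := aebd_D; have hg := aebd_approx_g.
apply: le_trans (@overlap (fun z => approx_g0 z ^+ 2) _ _ _) _.
- by apply: measurable_funX; exact: measurable_r0.
- by bd.
- by move=> z; exact: sqr_ge0.
apply: (@le_trans _ _ (Ex P (fun w => approx_g w ^+ 2))).
  apply: le_Ex; [igt|igt|] => w.
  have := rgT_control w.
  have [->|->] := model_binary H 0 w; rewrite ?subrr ?subr0 ?mul0r ?mul1r ?sqr_ge0// => -> //.
have := approx_g_L2 H; rewrite L2norm//.
rewrite lee_fin => h.
have E0 : 0 <= Ex P (fun w => approx_g w ^+ 2) by apply: Ex_ge0 => w; exact: sqr_ge0.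
by rewrite -[leLHS]sqr_sqrtr// lerXn2r ?nnegrE ?sqrtr_ge0// (rate_ge0 H).
Qed.

Lemma Ex_dot2_overlap (u : 'rV[R]_p) :
  Ex P (fun w => dotv (x (Z (X0 w))) u ^+ 2) <=
  Ex P (fun w => (1 - Dd (X0 w)) * dotv (x (Z (X0 w))) u ^+ 2) / b.
Proof.
have b0 := overlap_gt0 H; rewrite ler_pdivlMr// mulrC; apply: (@overlap (fun z => dotv (x z) u ^+ 2)).
- by apply: measurable_funX; exact: measurable_dotx.
- by have h := aebd_dot u; bd.
- by move=> z; exact: sqr_ge0.
Qed.

End model.

(** * Expansion of the score *)

Section model_score.
Context {R : realType} {dZ : measure_display} {Zt : measurableType dZ}.
Context {d : measure_display} {T : measurableType d} {P : probability T R}.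
Variables (X : nat -> T -> R * R * Zt) (g : R -> Zt -> R) (m : Zt -> R) (p : nat).
Variables (x : Zt -> 'rV[R]_p) (Lam : R -> R).
Variables (bg0 : 'rV[R]_(p + p)) (bm0 : 'rV[R]_p) (dl rate K C c b : R).

Local Notation Y v := (v.1.1).
Local Notation Dd v := (v.1.2).
Local Notation Z v := (v.2).
Local Notation X0 := (X 0%N).
Local Notation r0 := (approx_g0 g x bg0).
Local Notation rm := (approx_m m x Lam bm0).
Local Notation lam := (link_m x Lam bm0).
Local Notation scoreA := (score_weight m).

Hypothesis H : @model_hyp R dZ Zt d T P X g m p x Lam bg0 bm0 dl rate K C c b.
Variable a : R -> R.
Hypothesis ma : measurable_fun setT a.
Let L : R := 16 / b ^+ 3.
Hypothesis ha : forall u t, b / 2 <= Lam u <= 1 - b / 2 -> `|t| <= b / 4 ->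
  `|a u| <= L /\ `|odds (Lam (u + t)) - odds (Lam u) - a u * t| <= L * t ^+ 2.

Let mX i : measurable_fun setT (X i). Proof. by have [] := model_iid H. Qed.
Let bp : 0 < b. Proof. exact: (overlap_gt0 H). Qed.
Let bh : b < 2^-1. Proof. exact: (overlap_lt H). Qed.
Let Cp : 0 < C. Proof. exact: (outcome_bound_gt0 H). Qed.
Let dlb : dl <= b / 4. Proof. exact: (tolerance_le H). Qed.

(** Requirements on one observation under which the inequalities of the expansion become
    deterministic. They define a measurable set of full probability, so almost surely the whole
    sample meets them. *)
Definition good (v : R * R * Zt) : Prop :=
  [/\ `|Y v| <= C, `|g 0 (Z v)| <= C, b <= m (Z v) <= 1 - b, `|r0 (Z v)| <= dl & `|rm (Z v)| <= dl]
  /\ forall j, `|x (Z v) 0 j| <= K.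

Let mZ : measurable_fun setT (fun v : R * R * Zt => Z v). Proof. exact: measurable_snd. Qed.
Let mD : measurable_fun setT (fun v : R * R * Zt => Dd v).
Proof. by apply: (measurableT_comp measurable_snd); exact: measurable_fst. Qed.
Let mY : measurable_fun setT (fun v : R * R * Zt => Y v).
Proof. by apply: (measurableT_comp measurable_fst); exact: measurable_fst. Qed.
Let mfZ (f : Zt -> R) : measurable_fun setT f -> measurable_fun setT (fun v : R * R * Zt => f (Z v)).
Proof. by move=> mf; exact: (measurableT_comp mf). Qed.
Let mr0 := measurable_r0 H.
Let mrm := measurable_rm H.
Let mlam := measurable_lam H.
Let mm' := measurable_m H.

Lemma measurable_good : measurable good.
Proof.
have bs (f : Zt -> R) B : measurable_fun setT f -> measurable [set v : R * R * Zt | `|f (Z v)| <= B].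
  by move=> mf; apply: measurable_bound_set; exact: mfZ.
have -> : good = [set v | `|Y v| <= C] `&` [set v | `|g 0 (Z v)| <= C] `&`
   [set v | b <= m (Z v)] `&` [set v | m (Z v) <= 1 - b] `&`
   [set v | `|r0 (Z v)| <= dl] `&` [set v | `|rm (Z v)| <= dl] `&`
   \bigcap_(j in [set: 'I_p]) [set v | `|x (Z v) 0 j| <= K].
  apply/seteqP; split => v.
    by move=> [[h1 h2 /andP[h3 h3'] h4 h5] h6]; do ![split] => // j _; exact: h6.
  move=> [[[[[[h1 h2] h3] h3'] h4] h5] h6]; split; last by move=> j; exact: h6.
  by split => //; apply/andP.
have mmZ := mfZ mm'.
apply: measurableI; last first.
  by apply: fin_bigcap_measurable => // j _; exact: (bs (fun z => x z 0 j) K (measurable_x H j)).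
do 5 (apply: measurableI; last by [exact: (bs _ _ mrm)|exact: (bs _ _ mr0)|exact: measurable_le_set|exact: (bs _ _ (measurable_g0 H))]).
exact: measurable_bound_set.
Qed.

Lemma good_ae : \forall w \ae P, good (X0 w).
Proof.
have h1 := outcome_bound H; have h2 := g_bound H; have h4 := r0_ae H; have h5 := approx_m_sup H.
have h3 : \forall w \ae P, b <= m (Z (X0 w)) <= 1 - b.
  apply: ae_prob1 (overlap_bound H).
  have -> : [set w | b <= m (Z (X0 w)) <= 1 - b] =
      [set w | b <= m (Z (X0 w))] `&` [set w | m (Z (X0 w)) <= 1 - b].
    by apply/seteqP; split => w /=; [move/andP|move=> [-> ->]].
  have mmZ : measurable_fun setT (fun w => m (Z (X0 w))) by exact: (measurableT_comp (mfZ mm') (mX 0)).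
  by apply: measurableI; exact: measurable_le_set.
have h6 : \forall w \ae P, forall j, `|x (Z (X0 w)) 0 j| <= K by apply: filter_forall; exact: (controls_bound H).
apply: filterS (filterI h1 (filterI h2 (filterI h3 (filterI h4 (filterI h5 h6)))));
  by move=> w [q1 [[q2 _] [q3 [q4 [q5 q6]]]]].
Qed.

Lemma whp_good : whp P 0 (fun w => forall i, good (X i w)).
Proof. by have := whp_iid (model_iid H) measurable_good good_ae. Qed.

Definition bin (v : R * R * Zt) : Prop := Dd v = 0 \/ Dd v = 1.

Lemma good_facts v : bin v -> good v ->
  [/\ `|Y v - g 0 (Z v)| <= 2 * C, b / 2 <= lam (Z v) <= 1 - b / 2,
     `|odds (m (Z v)) - odds (lam (Z v))| <= L * `|rm (Z v)| & `|scoreA v| <= L].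
Proof.
move=> bv [[h1 h2 /andP[h3 h3'] h4 h5] h6].
have lb : b / 2 <= lam (Z v) <= 1 - b / 2.
  move: h5; rewrite /approx_m ler_norml => /andP[q1 q2]; apply/andP; split; move: dlb; lra.
have [lb1 lb2] := andP lb.
have Lb : b^-1 <= L.
  rewrite /L ler_pdivlMr ?exprn_gt0// exprS mulrA mulVf ?gt_eqF// mul1r.
  by rewrite expr2; have : b * b <= 1 * 1 by [apply: ler_pM; move: bh bp; lra]; lra.
split => //.
- by apply: (le_trans (ler_normB _ _)); lra.
- rewrite oddsB ?lt_eqF//; try (move: bp; lra).
  rewrite normrM mulrC; apply: ler_wpM2r => //.
  have e1 : 0 < 1 - m (Z v) by move: bp; lra.
  have e2 : 0 < 1 - lam (Z v) by move: bp; lra.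
  rewrite gtr0_norm ?invr_gt0 ?mulr_gt0//.
  apply: (@le_trans _ _ (2 / b ^+ 2)).
    rewrite ler_pdivlMr ?exprn_gt0// mulrC ler_pdivrMr ?mulr_gt0//.
    have -> : b ^+ 2 = 2 * (b * (b / 2)) by field.
    by rewrite ler_wpM2l//; apply: ler_pM; move: bp; lra.
  have -> : 2 / b ^+ 2 = 2 * b / b ^+ 3 by field; rewrite gt_eqF.
  by rewrite /L ler_pM2r ?invr_gt0 ?exprn_gt0//; move: bh; lra.
- rewrite /score_weight; case: bv => ->.
    rewrite sub0r subr0 mul1r normrN /odds normrM.
    apply: le_trans Lb; rewrite ger0_norm; last by move: bp; lra.
    rewrite ger0_norm ?invr_ge0; last by move: bp; lra.
    rewrite -[leRHS]mul1r; apply: ler_pM; rewrite ?invr_ge0; try (move: bp; lra).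
    by rewrite lef_pV2 ?posrE//; move: bp; lra.
  rewrite subrr mul0r subr0 normr1; apply: le_trans Lb.
  by rewrite -[leLHS]invr1 lef_pV2 ?posrE//; move: bh; lra.
Qed.

Lemma ae_bound (f : R * R * Zt -> R) B : (forall v, bin v -> good v -> `|f v| <= B) ->
  \forall w \ae P, `|f (X0 w)| <= B.
Proof. by move=> h; apply: filterS good_ae => w; apply: h; exact: (model_binary H). Qed.

Lemma aebd_good (f : R * R * Zt -> R) B : measurable_fun setT f ->
  (forall v, bin v -> good v -> `|f v| <= B) -> aebd P (fun w => f (X0 w)).
Proof.
move=> mf h; split; first exact: (measurableT_comp mf (mX 0)).
by exists B; exact: ae_bound.
Qed.

Lemma Ex_sqr_le (f h : R * R * Zt -> R) B : aebd P (fun w => f (X0 w)) ->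
  aebd P (fun w => h (X0 w)) -> (forall v, bin v -> good v -> `|f v| <= B * `|h v|) ->
  Ex P (fun w => f (X0 w) ^+ 2) <= B ^+ 2 * Ex P (fun w => h (X0 w) ^+ 2).
Proof.
move=> bf hb fh; rewrite -ExZ; last igt.
apply: ae_le_Ex; [igt|igt|].
apply: filterS good_ae => w gw; have := fh _ (model_binary H 0 w) gw.
move=> q; rewrite -exprMn -(real_normK (num_real (f _))) -[leRHS](real_normK (num_real _)).
rewrite ler_pXn2r ?nnegrE//; apply: (le_trans q).
by rewrite normrM ler_wpM2r// ler_norm.
Qed.

Definition outcome_err (v : R * R * Zt) : R := Y v - g 0 (Z v).
Definition rh (z : Zt) : R := odds (m z) - odds (lam z).
(** The coefficient, up to sign, of the propensity index error in the linearized score. Together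
    with [score_weight], [r0A] and [errh] it accounts for all first-order terms. *)
Definition linkw (v : R * R * Zt) : R := (1 - Dd v) * outcome_err v * a (dotv (x (Z v)) bm0).
Definition r0A (v : R * R * Zt) : R := scoreA v * r0 (Z v).
Definition errh (v : R * R * Zt) : R := (1 - Dd v) * outcome_err v * rh (Z v).

Lemma measurable_scoreA : measurable_fun setT scoreA.
Proof.
apply: measurable_funB => //; apply: measurable_funM; first exact: measurable_funB.
exact: (mfZ (measurableT_comp measurable_odds mm')).
Qed.

Lemma measurable_err : measurable_fun setT outcome_err.
Proof. by apply: measurable_funB => //; exact: (mfZ (measurable_g0 H)). Qed.

Lemma measurable_rh : measurable_fun setT rh.
Proof.
by apply: measurable_funB; [exact: measurableT_comp measurable_odds mm'|exact: measurableT_comp measurable_odds mlam].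
Qed.

Let m1D : measurable_fun setT (fun v : R * R * Zt => 1 - Dd v).
Proof. exact: measurable_funB. Qed.

Lemma measurable_linkw : measurable_fun setT linkw.
Proof.
apply: measurable_funM; first by apply: measurable_funM => //; exact: measurable_err.
by apply: (mfZ (f := fun z => a (dotv (x z) bm0))); apply: (measurableT_comp ma); exact: (measurable_dotx H).
Qed.

Lemma measurable_r0A : measurable_fun setT r0A.
Proof. by apply: measurable_funM; [exact: measurable_scoreA|exact: mfZ]. Qed.

Lemma measurable_errh : measurable_fun setT errh.
Proof.
apply: measurable_funM; first by apply: measurable_funM => //; exact: measurable_err.
exact: (mfZ measurable_rh).
Qed.

Let L0 : 0 < L. Proof. by rewrite divr_gt0// exprn_gt0. Qed.

Let CL : 0 <= 2 * C * L.
Proof. by apply: mulr_ge0; [rewrite mulr_ge0// ltW|exact: ltW]. Qed.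

Lemma bin_err v : bin v -> good v -> `|(1 - Dd v) * outcome_err v| <= 2 * C.
Proof.
move=> bv gv; have [h _ _ _] := good_facts bv gv.
by case: bv => ->; rewrite ?subrr ?subr0 ?mul0r ?mul1r ?normr0// mulr_ge0// ltW.
Qed.

Lemma a_le v : bin v -> good v -> `|a (dotv (x (Z v)) bm0)| <= L.
Proof.
move=> bv gv; have [_ h _ _] := good_facts bv gv.
have [] // := ha h (t := 0); by rewrite normr0 divr_ge0// ltW.
Qed.

Lemma linkw_le v : bin v -> good v -> `|linkw v| <= 2 * C * L.
Proof. by move=> bv gv; rewrite normrM ler_pM// ?bin_err// a_le. Qed.

Lemma errh_le v : bin v -> good v -> `|errh v| <= 2 * C * L * `|rm (Z v)|.
Proof.
move=> bv gv; have [_ _ h _] := good_facts bv gv.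
by rewrite normrM -mulrA ler_pM// bin_err.
Qed.

Lemma r0A_le v : bin v -> good v -> `|r0A v| <= L * `|r0 (Z v)|.
Proof.
move=> bv gv; have [_ _ _ h] := good_facts bv gv.
by rewrite normrM ler_wpM2r.
Qed.

Let bscore : aebd P (fun w => scoreA (X0 w)).
Proof.
apply: (aebd_good (B := L) measurable_scoreA) => v bv gv.
by have [] := good_facts bv gv.
Qed.
Let blinkw : aebd P (fun w => linkw (X0 w)).
Proof. exact: (aebd_good measurable_linkw linkw_le). Qed.
Let brh : aebd P (fun w => rh (Z (X0 w))).
Proof.
apply: (aebd_good (f := fun v => rh (Z v)) (B := L * dl) (mfZ measurable_rh)) => v bv gv.
have [_ _ h _] := good_facts bv gv; apply: le_trans h _.
by rewrite ler_wpM2l ?(ltW L0)//; case: gv => [[]].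
Qed.
Let br0A : aebd P (fun w => r0A (X0 w)).
Proof. exact: aebdM bscore (aebd_r0 H). Qed.
Let berrh : aebd P (fun w => errh (X0 w)).
Proof.
apply: (aebd_good (B := 2 * C * L * dl) measurable_errh) => v bv gv.
apply: le_trans (errh_le bv gv) _; rewrite ler_wpM2l ?CL//.
by case: gv => [[]].
Qed.

Lemma Ex_scoreA_x j : Ex P (fun w => scoreA (X0 w) * x (Z (X0 w)) 0 j) = 0.
Proof. exact: (Ex_score_zero H (measurable_x H j) (aebd_x H j)). Qed.

Lemma Ex_r0A : Ex P (fun w => r0A (X0 w)) = 0.
Proof. exact: (Ex_score_zero H mr0 (aebd_r0 H)). Qed.

Lemma Ex_linkw_x j : Ex P (fun w => linkw (X0 w) * x (Z (X0 w)) 0 j) = 0.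
Proof.
have ma' : measurable_fun setT (fun z => a (dotv (x z) bm0)).
  by apply: (measurableT_comp ma); exact: (measurable_dotx H).
rewrite -[RHS](@Ex_control_zero _ _ _ _ _ P _ _ _ _ _ _ _ _ _ _ _ _ _ _ H (fun z => a (dotv (x z) bm0) * x z 0 j)).
- by apply: eq_Ex => w; rewrite /linkw /outcome_err; ring.
- by apply: measurable_funM => //; exact: (measurable_x H j).
- apply: aebdM; last exact: (aebd_x H j).
  exact: (aebd_good (f := fun v => a (dotv (x (Z v)) bm0)) (mfZ ma') a_le).
Qed.

Lemma Ex_errh : Ex P (fun w => errh (X0 w)) = 0.
Proof. exact: (Ex_control_zero H measurable_rh brh). Qed.

Lemma Ex_scoreA_dot2 u : Ex P (fun w => (scoreA (X0 w) * dotv (x (Z (X0 w))) u) ^+ 2) <=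
  L ^+ 2 * Ex P (fun w => dotv (x (Z (X0 w))) u ^+ 2).
Proof.
apply: (@Ex_sqr_le (fun v => scoreA v * dotv (x (Z v)) u) (fun v => dotv (x (Z v)) u)).
- by apply: aebdM => //; exact: (aebd_dot H u).
- exact: (aebd_dot H u).
- move=> v bv gv; have [_ _ _ h] := good_facts bv gv.
  by rewrite normrM ler_wpM2r.
Qed.

Lemma Ex_linkw_dot2 u : Ex P (fun w => (linkw (X0 w) * dotv (x (Z (X0 w))) u) ^+ 2) <=
  (2 * C * L) ^+ 2 * Ex P (fun w => dotv (x (Z (X0 w))) u ^+ 2).
Proof.
apply: (@Ex_sqr_le (fun v => linkw v * dotv (x (Z v)) u) (fun v => dotv (x (Z v)) u)).
- by apply: aebdM => //; exact: (aebd_dot H u).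
- exact: (aebd_dot H u).
- by move=> v bv gv; rewrite normrM ler_wpM2r// linkw_le.
Qed.

Lemma Ex_r0A2 : Ex P (fun w => r0A (X0 w) ^+ 2) <= L ^+ 2 * (rate ^+ 2 / b).
Proof.
apply: le_trans (@Ex_sqr_le r0A (fun v => r0 (Z v)) L br0A (aebd_r0 H) r0A_le) _.
by rewrite ler_wpM2l ?sqr_ge0//; exact: (Ex_r02 H).
Qed.

Lemma Ex_errh2 : Ex P (fun w => errh (X0 w) ^+ 2) <= (2 * C * L) ^+ 2 * rate ^+ 2.
Proof.
apply: le_trans (@Ex_sqr_le errh (fun v => rm (Z v)) (2 * C * L) berrh (aebd_rm H) errh_le) _.
by rewrite ler_wpM2l ?sqr_ge0//; exact: (Ex_rm2 H).
Qed.

(** The variance of [f^2] is at most [B^2] times its mean, so sums of squared approximation errors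
    concentrate at the scale [sqrt n]. *)
Lemma Ex_centered2 (f : R * R * Zt -> R) (B r : R) : aebd P (fun w => f (X0 w)) ->
  (forall v, bin v -> good v -> `|f v| <= B) -> Ex P (fun w => f (X0 w) ^+ 2) <= r ->
  Ex P (fun w => (f (X0 w) ^+ 2 - Ex P (fun w => f (X0 w) ^+ 2)) ^+ 2) <= B ^+ 2 * r.
Proof.
move=> bf fB fr; set E := Ex P (fun w => f (X0 w) ^+ 2) in fr *.
have -> : Ex P (fun w => (f (X0 w) ^+ 2 - E) ^+ 2) = Ex P (fun w => f (X0 w) ^+ 4) - E ^+ 2.
  have -> : Ex P (fun w => (f (X0 w) ^+ 2 - E) ^+ 2) = Ex P (fun w => f (X0 w) ^+ 4 - (2 * E * (f (X0 w) ^+ 2) - E ^+ 2)).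
    by apply: eq_Ex => w; ring.
  rewrite ExB; [|igt|apply: aebd_ig; bd]. 
  rewrite ExB; [|igt|igt].
  by rewrite ExZ ?Ex_cst -/E; [ring|igt].
apply: (@le_trans _ _ (B ^+ 2 * E)).
  rewrite lerBlDr ler_wpDr ?sqr_ge0//.
  rewrite /E -ExZ; last igt.
  apply: ae_le_Ex; [igt|igt|].
  apply: filterS (ae_bound fB) => w h.
  rewrite (_ : f (X0 w) ^+ 4 = f (X0 w) ^+ 2 * f (X0 w) ^+ 2); last by ring.
  rewrite ler_wpM2r ?sqr_ge0// -(real_normK (num_real (f _))).
  by rewrite ler_pXn2r ?nnegrE//; apply: le_trans h.
by rewrite ler_wpM2l ?sqr_ge0.
Qed.

(** The plug-in score as a function of the estimation errors, so that bounds can be stated for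
    deterministic arguments. Only the control block of the outcome coefficients occurs. *)
Definition psih (u0 um : 'rV[R]_p) (v : R * R * Zt) : R :=
  (Y v - dotv (x (Z v)) (rsubmx bg0 + u0)) *
  (Dd v - (1 - Dd v) * odds (Lam (dotv (x (Z v)) (bm0 + um)))).
Definition psi0 (v : R * R * Zt) : R := outcome_err v * scoreA v.

Lemma dotvDr (y u v : 'rV[R]_p) : dotv y (u + v) = dotv y u + dotv y v.
Proof. by rewrite /dotv -big_split; apply: eq_bigr => j _; rewrite !mxE mulrDr. Qed.

Lemma good_dot v u : good v -> K * l1norm u <= dl -> `|dotv (x (Z v)) u| <= dl.
Proof.
move=> [_ xK]; apply: le_trans; rewrite -[dotv _ _]mul1r.
by apply: dotv_l1_le => j; rewrite mul1r.
Qed.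

Lemma psihE u0 um v : psih u0 um v = (outcome_err v + r0 (Z v) - dotv (x (Z v)) u0) *
  (Dd v - (1 - Dd v) * odds (Lam (dotv (x (Z v)) bm0 + dotv (x (Z v)) um))).
Proof. by rewrite /psih !dotvDr /outcome_err /approx_g0; congr (_ * _); ring. Qed.

Lemma psih_expansion u0 um v : bin v -> good v ->
  K * l1norm u0 <= dl -> K * l1norm um <= dl ->
  `|psih u0 um v - psi0 v - (r0A v - scoreA v * dotv (x (Z v)) u0
     - linkw v * dotv (x (Z v)) um + errh v)|
  <= (2 * C + 4) * L * (r0 (Z v) ^+ 2 + (1 - Dd v) * dotv (x (Z v)) u0 ^+ 2
                        + dotv (x (Z v)) um ^+ 2 + rm (Z v) ^+ 2).
Proof.
move=> bv gv h0 hm; have [e1 e2 e3 e4] := good_facts bv gv.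
have t1 := good_dot gv hm; have [a1 a2] := ha e2 (le_trans t1 dlb).
rewrite psihE.
have t2 : `|dotv (x (Z v)) um| <= 1 by apply: le_trans t1 _; move: dlb bh; lra.
have := score_expansion (r0 (Z v)) (dotv (x (Z v)) u0) bv (ltW Cp) (ltW L0) e1 a1 a2 e3 t2.
by rewrite /psi0 /r0A /linkw /errh /rh /score_weight (mulrC _ (r0 _)) -/(outcome_err v).
Qed.

Lemma psih_close u0 um v : bin v -> good v ->
  K * l1norm u0 <= dl -> K * l1norm um <= dl ->
  `|psih u0 um v - psi0 v| <= (8 * C + 10) * L * dl.
Proof.
move=> bv gv h0 hm; have [e1 e2 e3 e4] := good_facts bv gv.
have t1 := good_dot gv hm; have [a1 a2] := ha e2 (le_trans t1 dlb).
have d1 : dl <= 1 by move: dlb bh; lra.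
have [[_ _ _ g1 g2] _] := gv.
rewrite psihE.
have := score_close bv (ltW L0) e1 a1 a2 e3 (le_trans t1 d1) g1 (good_dot gv h0) t1 g2 d1 e4.
by rewrite /psi0 /score_weight -/(outcome_err v).
Qed.

Lemma psih_sum n w u0 um : (forall i, good (X i w)) ->
  K * l1norm u0 <= dl -> K * l1norm um <= dl ->
  `|psum X (fun v => psih u0 um v - psi0 v) n w| <=
  `|psum X r0A n w| + `|\sum_(i < n) scoreA (X i w) * dotv (x (Z (X i w))) u0|
  + `|\sum_(i < n) linkw (X i w) * dotv (x (Z (X i w))) um| + `|psum X errh n w|
  + (2 * C + 4) * L * (psum X (fun v => r0 (Z v) ^+ 2) n w
     + (\sum_(i < n) (1 - Dd (X i w)) * dotv (x (Z (X i w))) u0 ^+ 2)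
     + (\sum_(i < n) dotv (x (Z (X i w))) um ^+ 2)
     + psum X (fun v => rm (Z v) ^+ 2) n w).
Proof.
move=> gw h0 hm; rewrite /psum -!big_split/= mulr_sumr.
set S := \sum_(i < n) (psih _ _ _ - _).
pose U i := r0A (X i w) - scoreA (X i w) * dotv (x (Z (X i w))) u0
     - linkw (X i w) * dotv (x (Z (X i w))) um + errh (X i w).
have -> : S = \sum_(i < n) (psih u0 um (X i w) - psi0 (X i w) - U i) + \sum_(i < n) U i.
  by rewrite -big_split/=; apply: eq_bigr => i _; rewrite subrK.
apply: (le_trans (ler_normD _ _)); rewrite addrC; apply: lerD.
  rewrite /U !big_split/= !sumrN.
  apply: (le_trans (ler_normD _ _)); apply: lerD => //.
  apply: (le_trans (ler_normB _ _)); apply: lerD => //.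
  exact: ler_normB.
apply: (le_trans (ler_norm_sum _ _ _)); apply: ler_sum => i _.
by apply: psih_expansion => //; exact: (model_binary H i w).
Qed.

End model_score.

Section score_remainder.
Local Notation Y v := (v.1.1).
Local Notation Dd v := (v.1.2).
Local Notation Z v := (v.2).

(** The linear terms fall under the two concentration results, the quadratic ones under
    [n rate^2 <= dl sqrt n], which is where the exponent [-1/4] of the rate matters. *)
Lemma score_remainder (R : realType) (C b eps : R) (Lam : R -> R) :
  0 < C -> 0 < b -> b < 2^-1 -> Lam = id \/ Lam = @logistic R -> 0 < eps ->
  exists2 eta, 0 < eta & exists N : nat, forall n, (N <= n)%N ->
  forall dZ (Zt : measurableType dZ) d (T : measurableType d) (P : probability T R)
    (X : nat -> T -> R * R * Zt) (g : R -> Zt -> R) (m : Zt -> R) (p : nat)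
    (x : Zt -> 'rV[R]_p) (bg0 : 'rV[R]_(p + p)) (bm0 : 'rV[R]_p) (dl rate K c : R) (k : nat),
  @model_hyp R dZ Zt d T P X g m p x Lam bg0 bm0 dl rate K C c b ->
  dl <= eta -> rate ^+ 2 <= dl ^+ 2 / Num.sqrt n%:R ->
  k%:R * ln (maxn p n)%:R <= eta * Num.sqrt n%:R ->
  whp P eps (fun w => forall u0 um : 'rV[R]_p, (l0norm u0 <= k)%N -> (l0norm um <= k)%N ->
    K * l1norm u0 <= dl -> K * l1norm um <= dl ->
    Ex P (fun w => dotv (x (Z (X 0%N w))) u0 ^+ 2) <= 4 / b * rate ^+ 2 ->
    Ex P (fun w => dotv (x (Z (X 0%N w))) um ^+ 2) <= 4 / b * rate ^+ 2 ->
    \sum_(i < n) (1 - Dd (X i w)) * dotv (x (Z (X i w))) u0 ^+ 2 <= n%:R * rate ^+ 2 ->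
    \sum_(i < n) dotv (x (Z (X i w))) um ^+ 2 <= n%:R * rate ^+ 2 ->
    `|psum X (fun v => psih x Lam bg0 bm0 u0 um v - psi0 g m v) n w| <= eps * Num.sqrt n%:R).
Proof.
move=> Cp bp bh hL ep.
have bb : 0 < b < 2^-1 by rewrite bp.
have [a ma ha] := odds_link hL bb.
pose L : R := 16 / b ^+ 3.
have L0 : 0 < L by rewrite divr_gt0// exprn_gt0.
pose A1 := (2 * C + 4) * L.
have A10 : 0 < A1 by rewrite mulr_gt0//; lra.
(* Six events fail with total probability [6 e1 <= eps], and [(4 + 2 A1) e1 <= eps / 2] covers four
   linear sums and, with weight [A1], two centred sums of squares. The other half of [eps] goes to
   the terms in [n rate^2]. *)
pose e1 := eps / (12 + 4 * A1).
have e10 : 0 < e1 by rewrite divr_gt0//; lra.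
have [es es0 [Ns hNs]] := sparse_concentration_ae e10.
have [ec ec0 [Nc hNc]] := concentration_small_ae e10.
have ib : 0 < b^-1 by rewrite invr_gt0.
have CL0 : 0 < 2 * C * L by rewrite mulr_gt0// mulr_gt0.
pose q1 := L ^+ 2 * (4 / b).
pose q2 := (2 * C * L) ^+ 2 * (4 / b).
have q10 : 0 < q1 by rewrite mulr_gt0 ?exprn_gt0// divr_gt0.
have q20 : 0 < q2 by rewrite mulr_gt0 ?exprn_gt0// divr_gt0.
pose q3 := A1 * (b^-1 + 3).
have q30 : 0 < q3 by rewrite mulr_gt0//; lra.
(* A common upper bound for the coefficients that multiply [dl] or [rate^2]; dividing the tolerance
   by it settles all smallness conditions at once. *)
pose BIG := 1 + b^-1 + L + 2 * C * L + q1 + q2 + 2 * q3 + (2 * C * L) ^+ 2.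
have q40 : 0 < (2 * C * L) ^+ 2 by rewrite exprn_gt0.
have BIG1 : 1 <= BIG by rewrite /BIG; lra.
have BIG0 : 0 < BIG by lra.
have B1 : 1 + b^-1 <= BIG by rewrite /BIG; lra.
have BL : L <= BIG by rewrite /BIG; lra.
have BCL : 2 * C * L <= BIG by rewrite /BIG; lra.
have Bq1 : q1 <= BIG by rewrite /BIG; lra.
have Bq2 : q2 <= BIG by rewrite /BIG; lra.
have Bq3 : 2 * q3 <= BIG by rewrite /BIG; lra.
have BC2 : (2 * C * L) ^+ 2 <= BIG by rewrite /BIG; lra.
have BLb : L ^+ 2 / b <= BIG.
  apply: le_trans Bq1; rewrite /q1 ler_wpM2l ?sqr_ge0//; lra.
have Bb : b^-1 <= BIG by lra.
have ib1 : 0 <= 1 + b^-1 by lra.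
clearbody BIG.
exists (Num.min es (Num.min ec eps) / BIG); first by rewrite divr_gt0// !lt_min es0 ec0 ep.
exists (maxn 1 (maxn Ns Nc)) => n; rewrite !geq_max => /andP[n1 /andP[nNs nNc]].
move=> dZ Zt d T P X g m p x bg0 bm0 dl rate K c k H dle rdl kn.
set eta := _ / BIG in dle kn.
have etaB : eta * BIG = Num.min es (Num.min ec eps) by rewrite divfK// gt_eqF.
have dB : dl * BIG <= Num.min es (Num.min ec eps) by rewrite -etaB ler_wpM2r// ltW.
move: (dB); rewrite !le_min => /andP[dBs /andP[dBc dBe]].
have dl0 := tolerance_gt0 H; have d1 : dl <= 1 by have := tolerance_le H; lra.
have sn1 : 1 <= Num.sqrt n%:R :> R by rewrite -[leLHS]sqrtr1 ler_wsqrtr// ler1n.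
have sn0 : 0 < Num.sqrt n%:R :> R by lra.
have d2 : dl ^+ 2 <= dl by rewrite expr2 ler_piMl// ltW.
have kap (q : R) : 0 <= q -> q <= BIG -> q * dl <= dl * BIG by move=> *; rewrite mulrC ler_wpM2l// ltW.
have rd : rate ^+ 2 <= dl / Num.sqrt n%:R by apply: le_trans rdl _; rewrite ler_wpM2r// invr_ge0 ltW.
have kapr (q : R) : 0 <= q -> q <= BIG -> q * rate ^+ 2 <= dl * BIG / Num.sqrt n%:R.
  move=> h h'; apply: (@le_trans _ _ (q * (dl / Num.sqrt n%:R))); first exact: ler_wpM2l.
  by rewrite mulrA ler_wpM2r ?invr_ge0 ?kap// ltW.
have sdiv (q q' : R) : q <= q' -> q / Num.sqrt n%:R <= q' / Num.sqrt n%:R.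
  by move=> *; rewrite ler_wpM2r// invr_ge0 ltW.
have r2 : 0 <= rate ^+ 2 by exact: sqr_ge0.
have rd' : rate ^+ 2 <= dl.
  by apply: le_trans rd _; rewrite ler_pdivrMr// ler_peMr// ltW.
have kes : k%:R * ln (maxn p n)%:R <= es * Num.sqrt n%:R.
  apply: le_trans kn _; rewrite ler_wpM2r ?(ltW sn0)// /eta ler_pdivrMr//.
  rewrite ge_min; apply/orP; left; by rewrite ler_peMr// ltW.
have iid := model_iid H.
have mZ : measurable_fun setT (fun v : R * R * Zt => Z v) by exact: measurable_snd.
have mxj j : measurable_fun setT (fun v : R * R * Zt => x (Z v) 0 j).
  exact: (measurableT_comp (measurable_x H j) mZ).
have W1 : whp P e1 (fun o => forall u : 'rV[R]_p, (l0norm u <= k)%N -> L * K * l1norm u <= es ->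
    Ex P (fun o => (score_weight m (X 0%N o) * dotv (x (Z (X 0%N o))) u) ^+ 2) <= es / Num.sqrt n%:R ->
    `|\sum_(i < n) score_weight m (X i o) * dotv (x (Z (X i o))) u| <= e1 * Num.sqrt n%:R).
  apply: (hNs n nNs d T _ _ P X p (fun v => x (Z v)) (score_weight m) (L * K) k iid (measurable_scoreA H) mxj) => //.
  - move=> j; apply: (ae_bound H (f := fun v => score_weight m v * x (Z v) 0 j)) => v bv gv.
    have [_ _ _ h] := good_facts H bv gv; have [_ h'] := gv.
    by rewrite normrM ler_pM.
  - by move=> j; exact: (Ex_scoreA_x H).
have W2 : whp P e1 (fun o => forall u : 'rV[R]_p, (l0norm u <= k)%N -> 2 * C * L * K * l1norm u <= es ->
    Ex P (fun o => (linkw g x bm0 a (X 0%N o) * dotv (x (Z (X 0%N o))) u) ^+ 2) <= es / Num.sqrt n%:R ->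
    `|\sum_(i < n) linkw g x bm0 a (X i o) * dotv (x (Z (X i o))) u| <= e1 * Num.sqrt n%:R).
  apply: (hNs n nNs d T _ _ P X p (fun v => x (Z v)) (linkw g x bm0 a) (2 * C * L * K) k iid (measurable_linkw H ma) mxj) => //.
  - move=> j; apply: (ae_bound H (f := fun v => linkw g x bm0 a v * x (Z v) 0 j)) => v bv gv.
    have h := linkw_le H ha bv gv; have [_ h'] := gv.
    by rewrite normrM ler_pM.
  - by move=> j; exact: (Ex_linkw_x H ma ha).
have W3 : whp P e1 (fun o => `|psum X (r0A g m x bg0) n o| <= e1 * Num.sqrt n%:R).
  apply: (hNc n nNc d T _ _ P X _ iid (measurable_r0A H)).
  - apply: (ae_bound H) => v bv gv; apply: le_trans (r0A_le H bv gv) _.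
    have [[_ _ _ h _] _] := gv; apply: le_trans dBc; apply: (@le_trans _ _ (L * dl)); first by rewrite ler_wpM2l// ltW.
    by apply: kap; [exact: ltW|by []].
  - exact: (Ex_r0A H).
  - apply: (le_trans (Ex_r0A2 H)). refine (le_trans _ (sdiv _ _ dBc)).
    rewrite mulrCA mulrC.
    apply: kapr.
    + by rewrite divr_ge0// ?sqr_ge0// ltW.
    + exact: BLb.
have W4 : whp P e1 (fun o => `|psum X (errh g m x Lam bm0) n o| <= e1 * Num.sqrt n%:R).
  apply: (hNc n nNc d T _ _ P X _ iid (measurable_errh H)).
  - apply: (ae_bound H) => v bv gv; apply: le_trans (errh_le H bv gv) _.
    have [[_ _ _ _ h] _] := gv; apply: le_trans dBc; apply: (@le_trans _ _ ((2 * C * L) * dl)); first by rewrite ler_wpM2l// ltW.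
    by apply: kap; [exact: ltW|by []].
  - exact: (Ex_errh H).
  - apply: (le_trans (Ex_errh2 H)); refine (le_trans _ (sdiv _ _ dBc)).
    by apply: (kapr ((2 * C * L) ^+ 2)); [exact: ltW|by []].
(* Squared approximation errors are split into a mean of order [rate^2] and a fluctuation that falls
   under [concentration_small_ae]. *)
pose E5 := Ex P (fun w => approx_g0 g x bg0 (Z (X 0%N w)) ^+ 2).
pose E6 := Ex P (fun w => approx_m m x Lam bm0 (Z (X 0%N w)) ^+ 2).
have E5r : E5 <= rate ^+ 2 / b := Ex_r02 H.
have E6r : E6 <= rate ^+ 2 := Ex_rm2 H.
have E50 : 0 <= E5 by apply: Ex_ge0 => w; exact: sqr_ge0.
have E60 : 0 <= E6 by apply: Ex_ge0 => w; exact: sqr_ge0.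
have cst_le (r E : R) : 0 <= E -> E <= (1 + b^-1) * dl -> `|r| <= dl -> `|r ^+ 2 - E| <= ec.
  move=> h1 h2 h3; have h4 : r ^+ 2 <= dl.
    by apply: le_trans d2; rewrite -(real_normK (num_real r)) ler_pXn2r ?nnegrE// ltW.
  have h5 := kap (1 + b^-1) _ _.
  have h6 : (1 + b^-1) * dl <= ec.
    by apply: le_trans dBc; apply: h5.
  have h7 : dl <= (1 + b^-1) * dl by rewrite ler_peMl ?(ltW dl0)// lerDl ltW.
  rewrite ler_norml; have := sqr_ge0 r; move: h1 h2 h4 h6 h7; clear=> *; apply/andP; split; lra.
have W5 : whp P e1 (fun o => `|psum X (fun v => approx_g0 g x bg0 (Z v) ^+ 2 - E5) n o| <= e1 * Num.sqrt n%:R).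
  apply: (hNc n nNc d T _ _ P X _ iid).
  - apply: measurable_funB => //; apply: measurable_funX.
    exact: (measurableT_comp (measurable_r0 H) mZ).
  - apply: (ae_bound H (f := fun v => approx_g0 g x bg0 (Z v) ^+ 2 - E5)) => v bv [[_ _ _ h _] _].
    apply: cst_le => //; apply: (le_trans E5r); rewrite mulrDl mul1r mulrC.
    by rewrite ler_wpDl ?(ltW dl0)// ler_wpM2l// ltW.
  - have br := aebd_r0 H; rewrite ExB; [|igt|igt].
    by rewrite Ex_cst subrr.
  - apply: (le_trans (Ex_centered2 H (f := fun v => approx_g0 g x bg0 (Z v)) (aebd_r0 H) _ E5r)).
      by move=> v bv [[_ _ _ h _] _]; exact: h.
    refine (le_trans _ (sdiv _ _ dBc)).
    apply: (@le_trans _ _ (1 * (rate ^+ 2 / b))).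
      by rewrite ler_wpM2r ?divr_ge0 ?(ltW bp)//; apply: (le_trans d2).
    rewrite mul1r mulrC; apply: kapr => //; exact: ltW.
have W6 : whp P e1 (fun o => `|psum X (fun v => approx_m m x Lam bm0 (Z v) ^+ 2 - E6) n o| <= e1 * Num.sqrt n%:R).
  apply: (hNc n nNc d T _ _ P X _ iid).
  - apply: measurable_funB => //; apply: measurable_funX.
    exact: (measurableT_comp (measurable_rm H) mZ).
  - apply: (ae_bound H (f := fun v => approx_m m x Lam bm0 (Z v) ^+ 2 - E6)) => v bv [[_ _ _ _ h] _].
    apply: cst_le => //; apply: (le_trans E6r); apply: (le_trans rd').
    by rewrite ler_peMl ?(ltW dl0)// lerDl ltW.
  - have br := aebd_rm H; rewrite ExB; [|igt|igt].
    by rewrite Ex_cst subrr.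
  - apply: (le_trans (Ex_centered2 H (f := fun v => approx_m m x Lam bm0 (Z v)) (aebd_rm H) _ E6r)).
      by move=> v bv [[_ _ _ _ h] _]; exact: h.
    refine (le_trans _ (sdiv _ _ dBc)).
    apply: (@le_trans _ _ (1 * rate ^+ 2)).
      by rewrite ler_wpM2r//; apply: (le_trans d2).
    by apply: kapr => //; apply: le_trans B1; rewrite lerDl ltW.
have e6 : e1 + (e1 + (e1 + (e1 + (e1 + e1)))) <= eps.
  have -> : e1 + (e1 + (e1 + (e1 + (e1 + e1)))) = 6 * e1 by ring.
  rewrite /e1 mulrA ler_pdivrMr; [rewrite mulrC ler_wpM2l ?(ltW ep)//|]; move: A10; clear=> *; lra.
apply: (whp_le e6).
have := whp_and0 (whp_good H) (whp_and W1 (whp_and W2 (whp_and W3 (whp_and W4 (whp_and W5 W6))))).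
apply: whp_imp => w [gw [w1 [w2 [w3 [w4 [w5 w6]]]]]] u0 um u0k umk u0K umK V0 Vm S0 Sm.
apply: (le_trans (psih_sum H ha n gw u0K umK)).
set S1 := \sum_(i < n) score_weight _ _ * _.
set S2 := \sum_(i < n) linkw _ _ _ _ _ * _.
have b1 : `|S1| <= e1 * Num.sqrt n%:R.
  apply: w1 => //.
    apply: le_trans dBs; rewrite -mulrA; apply: (@le_trans _ _ (L * dl)).
      by rewrite ler_wpM2l// ltW.
    by apply: kap; [exact: ltW|by []].
  apply: (le_trans (Ex_scoreA_dot2 H u0)).
  refine (le_trans _ (sdiv _ _ dBs)).
  apply: (@le_trans _ _ (q1 * rate ^+ 2)).
    by rewrite /q1 -mulrA ler_wpM2l ?sqr_ge0.
  by apply: kapr; [exact: ltW|by []].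
have b2 : `|S2| <= e1 * Num.sqrt n%:R.
  apply: w2 => //.
    apply: le_trans dBs; rewrite -mulrA; apply: (@le_trans _ _ (2 * C * L * dl)).
      by rewrite ler_wpM2l// ltW.
    by apply: kap; [exact: ltW|by []].
  apply: (le_trans (Ex_linkw_dot2 H ma ha um)).
  refine (le_trans _ (sdiv _ _ dBs)).
  apply: (@le_trans _ _ (q2 * rate ^+ 2)).
    by rewrite /q2 -[leRHS]mulrA ler_wpM2l ?sqr_ge0.
  by apply: kapr; [exact: ltW|by []].
have psumB (f : R * R * Zt -> R) E : psum X f n w = psum X (fun v => f v - E) n w + n%:R * E.
  by rewrite /psum big_split/= sumrN sumr_const card_ord -mulr_natl; ring.
have nr : n%:R * rate ^+ 2 <= dl * Num.sqrt n%:R.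
  apply: (@le_trans _ _ (n%:R * (dl / Num.sqrt n%:R))); first by rewrite ler_wpM2l.
  rewrite -[X in X * (dl / _)](sqr_sqrtr (ler0n R n)) expr2 le_eqVlt; apply/orP; left; apply/eqP; field.
  by rewrite gt_eqF.
have b5 : psum X (fun v => approx_g0 g x bg0 (Z v) ^+ 2) n w <= e1 * Num.sqrt n%:R + b^-1 * (n%:R * rate ^+ 2).
  rewrite (psumB _ E5) lerD//; first exact: le_trans (ler_norm _) w5.
  by rewrite mulrCA ler_wpM2l// mulrC.
have b6 : psum X (fun v => approx_m m x Lam bm0 (Z v) ^+ 2) n w <= e1 * Num.sqrt n%:R + n%:R * rate ^+ 2.
  rewrite (psumB _ E6) lerD//; first exact: le_trans (ler_norm _) w6.
  by rewrite ler_wpM2l.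
set P5 := psum X (fun v => approx_g0 g x bg0 (Z v) ^+ 2) n w in b5 *.
set P6 := psum X (fun v => approx_m m x Lam bm0 (Z v) ^+ 2) n w in b6 *.
set Q0 := \sum_(i < n) (1 - _) * _ in S0 *.
set Qm := \sum_(i < n) dotv _ _ ^+ 2 in Sm *.
set P3 := psum _ _ _ _ in w3 *; set P4 := psum _ _ _ _ in w4 *.
rewrite -/L -/A1.
have c1 : A1 * (P5 + Q0 + Qm + P6) <= A1 * (2 * e1 * Num.sqrt n%:R + (b^-1 + 3) * (n%:R * rate ^+ 2)).
  by rewrite ler_wpM2l ?(ltW A10)//; move: b5 b6 S0 Sm; clear=> *; lra.
have c2 : A1 * (2 * e1 * Num.sqrt n%:R + (b^-1 + 3) * (n%:R * rate ^+ 2)) <= 2 * A1 * e1 * Num.sqrt n%:R + q3 * dl * Num.sqrt n%:R.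
  rewrite mulrDr; apply: lerD.
    by rewrite le_eqVlt; apply/orP; left; apply/eqP; clear; ring.
  by rewrite mulrA -/q3 -[leRHS]mulrA ler_wpM2l ?(ltW q30).
have c3 : q3 * dl <= eps / 2.
  have : (2 * q3) * dl <= dl * BIG by apply: kap => //; rewrite mulr_ge0 ?(ltW q30).
  by move: dBe; clear=> *; lra.
have c4 : (4 + 2 * A1) * e1 <= eps / 2.
  rewrite /e1 mulrA ler_pdivrMr; [|by move: A10; clear=> *; lra].
  by rewrite mulrC -mulrA ler_wpM2l ?(ltW ep)//; move: A10; clear=> *; lra.
have c5 : (4 + 2 * A1) * e1 * Num.sqrt n%:R + q3 * dl * Num.sqrt n%:R <= eps * Num.sqrt n%:R.
  by rewrite -mulrDl ler_wpM2r ?(ltW sn0)//; move: c3 c4; clear=> *; lra.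
have c6 : (4 + 2 * A1) * e1 * Num.sqrt n%:R = 4 * (e1 * Num.sqrt n%:R) + 2 * A1 * e1 * Num.sqrt n%:R by ring.
move: w3 w4 b1 b2 c1 c2 c5 c6; clear=> *; lra.
Qed.

End score_remainder.

Lemma phitildeE {R : realType} (gam y d g0 g1 m mu : R) :
  phitilde gam y d g0 g1 m mu = ((y - g0) * (d - (1 - d) * odds m) - gam * d) / mu.
Proof. by rewrite /phitilde /odds invfM; ring. Qed.

(** * Mean and variance of the limiting score *)

Section model_variance.
Context {R : realType} {dZ : measure_display} {Zt : measurableType dZ}.
Context {d : measure_display} {T : measurableType d} {P : probability T R}.
Variables (X : nat -> T -> R * R * Zt) (g : R -> Zt -> R) (m : Zt -> R) (p : nat).
Variables (x : Zt -> 'rV[R]_p) (Lam : R -> R).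
Variables (bg0 : 'rV[R]_(p + p)) (bm0 : 'rV[R]_p) (dl rate K C c b : R).

Local Notation Y v := (v.1.1).
Local Notation Dd v := (v.1.2).
Local Notation Z v := (v.2).
Local Notation X0 := (X 0%N).
Local Notation scoreA := (score_weight m).
Local Notation resid := (noise X g).
Local Notation err := (outcome_err g).

Hypothesis H : @model_hyp R dZ Zt d T P X g m p x Lam bg0 bm0 dl rate K C c b.
Let L : R := 16 / b ^+ 3.
Let bp : 0 < b. Proof. exact: (overlap_gt0 H). Qed.
Let bh : b < 2^-1. Proof. exact: (overlap_lt H). Qed.
Let Cp : 0 < C. Proof. exact: (outcome_bound_gt0 H). Qed.
Let cp : 0 < c. Proof. exact: (noise_gt0 H). Qed.
Let L0 : 0 < L. Proof. by rewrite divr_gt0// exprn_gt0. Qed.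

Let hD := aebd_D H. Let hY := aebd_Y H. Let hg0 := aebd_g0 H. Let hg1 := aebd_g1 H.
Let hm := aebd_m H. Let hodds := aebd_odds H. Let hres := aebd_noise H.
Let mX i : measurable_fun setT (X i). Proof. by have [] := model_iid H. Qed.

Definition treat_prob : R := Ex P (fun w => Dd (X0 w)).
Definition att : R := Ex P (fun w => Dd (X0 w) * (g 1 (Z (X0 w)) - g 0 (Z (X0 w)))) / treat_prob.
Definition phi_score (v : R * R * Zt) : R := psi0 g m v - att * Dd v.

Lemma m_ae : \forall w \ae P, b <= m (Z (X0 w)) <= 1 - b.
Proof. by apply: filterS (good_ae H) => w [[]]. Qed.

Lemma mu_itv : b <= treat_prob <= 1 - b.
Proof.
have E0 : Ex P (fun w => 1 * (Dd (X0 w) - m (Z (X0 w)))) = 0.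
  apply: (@cond_mean_zero_aebd _ _ _ _ _ P _ _ (measurable_Z H 0) (treatment_cond_mean H) (fun=> 1)) => //.
  exact: aebd_cst.
have -> : treat_prob = Ex P (fun w => m (Z (X0 w))).
  apply/eqP; rewrite -subr_eq0 -ExB; [|igt|igt].
  by rewrite -[X in _ == X]E0; apply/eqP; apply: eq_Ex => w; rewrite mul1r.
rewrite -{1}(Ex_cst P b) -(Ex_cst P (1 - b)); apply/andP; split.
  by apply: ae_le_Ex; [exact: ig_cst|igt|]; apply: filterS m_ae => w /andP[].
by apply: ae_le_Ex; [igt|exact: ig_cst|]; apply: filterS m_ae => w /andP[].
Qed.

Let mu0 : 0 < treat_prob. Proof. by have /andP[h _] := mu_itv; exact: lt_le_trans h. Qed.

Lemma gam_le : `|att| <= 2 * C.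
Proof.
rewrite /att normrM (gtr0_norm (x := treat_prob^-1)) ?invr_gt0// ler_pdivrMr//.
apply: (le_trans (Ex_norm _)); first by igt.
rewrite /treat_prob -ExZ; last igt.
apply: ae_le_Ex; [apply: ig_norm; igt|igt|].
apply: filterS (g_bound H) => w [h1 h2].
have : `|g 1 (Z (X0 w)) - g 0 (Z (X0 w))| <= 2 * C by apply: (le_trans (ler_normB _ _)); lra.
by have [->|->] := model_binary H 0 w; rewrite ?mul0r ?mulr0 ?normr0 ?mul1r ?mulr1.
Qed.

Lemma aebd_psi0 : aebd P (fun w => psi0 g m (X0 w)).
Proof. by rewrite /psi0 /outcome_err /score_weight; bd. Qed.

Lemma aebd_phi0 : aebd P (fun w => phi_score (X0 w)).
Proof. by have h := aebd_psi0; rewrite /phi_score; bd. Qed.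

Lemma psi0_resid w : psi0 g m (X0 w) = Dd (X0 w) * resid w
  + Dd (X0 w) * (g 1 (Z (X0 w)) - g 0 (Z (X0 w)))
  - (1 - Dd (X0 w)) * (Y (X0 w) - g 0 (Z (X0 w))) * odds (m (Z (X0 w))).
Proof. by rewrite (resid1 H) /psi0 /outcome_err /score_weight; ring. Qed.

Lemma Ex_phi0 : Ex P (fun w => phi_score (X0 w)) = 0.
Proof.
have h := aebd_psi0.
rewrite /phi_score ExB; [|igt|igt].
rewrite ExZ; last igt.
rewrite -/treat_prob /att divfK ?gt_eqF//.
have -> : Ex P (fun w => psi0 g m (X0 w)) = Ex P (fun w => Dd (X0 w) * resid w
  + Dd (X0 w) * (g 1 (Z (X0 w)) - g 0 (Z (X0 w)))
  - (1 - Dd (X0 w)) * (Y (X0 w) - g 0 (Z (X0 w))) * odds (m (Z (X0 w)))).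
  by apply: eq_Ex => w; exact: psi0_resid.
rewrite ExB; [|igt|igt]; rewrite ExD; [|igt|igt].
have -> : Ex P (fun w => Dd (X0 w) * resid w) = 0.
  exact: (Ex_resid_zero H (f := fun zd => zd.2) measurable_snd).
rewrite (Ex_control_zero H (f := fun z => odds (m z))) ?subr0 ?add0r ?subrr//.
exact: measurableT_comp (@measurable_odds R) (measurable_m H).
Qed.

(** The hypothesis bounds the fourth moment of the noise below by [c^2]; as the noise is at most
    [2 C] in modulus, its fourth moment is at most [4 C^2] times its second. *)
Lemma Ex_resid2 : c ^+ 2 / (4 * C ^+ 2) <= Ex P (fun w => resid w ^+ 2).
Proof.
have := noise_L4 H; rewrite L2norm; last by bd.
rewrite lee_fin => h.
have C20 : 0 < 4 * C ^+ 2 by rewrite mulr_gt0// exprn_gt0.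
rewrite ler_pdivrMr//.
have h4 : c ^+ 2 <= Ex P (fun w => (resid w ^+ 2) ^+ 2).
  rewrite -[leRHS]sqr_sqrtr; last by apply: Ex_ge0 => w; exact: sqr_ge0.
  by rewrite ler_pXn2r ?nnegrE ?sqrtr_ge0// ltW.
apply: (le_trans h4); rewrite mulrC -ExZ; last igt.
apply: ae_le_Ex; [igt|igt|].
apply: filterS2 (outcome_bound H) (g_bound H) => w h1 [h2 h3].
rewrite [leLHS]expr2 ler_wpM2r ?sqr_ge0//.
have : `|resid w| <= 2 * C.
  rewrite /noise; apply: (le_trans (ler_normB _ _)).
  by have [->|->] := model_binary H 0 w; lra.
rewrite -(real_normK (num_real (resid w))) => h5.
have -> : 4 * C ^+ 2 = (2 * C) ^+ 2 by ring.
by rewrite ler_pXn2r ?nnegrE// mulr_ge0// ltW.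
Qed.

(** The cross term between noise and treatment effect on treated units is centred and may be
    subtracted. What remains dominates [b^2 resid^2] pointwise: on untreated units it is
    [odds^2 resid^2] with [odds >= b], on treated units [resid^2 + h^2]. *)
Lemma Ex_phi02_ge : b ^+ 2 * (c ^+ 2 / (4 * C ^+ 2)) <= Ex P (fun w => phi_score (X0 w) ^+ 2).
Proof.
pose h z := g 1 z - g 0 z - att.
have mh : measurable_fun setT h.
  by apply: measurable_funB => //; apply: measurable_funB; [exact: (measurable_g1 H)|exact: (measurable_g0 H)].
have bh' : aebd P (fun w => h (Z (X0 w))) by rewrite /h; bd.
apply: (@le_trans _ _ (b ^+ 2 * Ex P (fun w => resid w ^+ 2))).
  by rewrite ler_wpM2l ?sqr_ge0// Ex_resid2.
have E0 : Ex P (fun w => 2 * Dd (X0 w) * h (Z (X0 w)) * resid w) = 0.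
  apply: (Ex_resid_zero H (f := fun zd => 2 * zd.2 * h zd.1)); last by bd.
  apply: measurable_funM; first by apply: measurable_funM.
  exact: (measurableT_comp mh measurable_fst).
have hp := aebd_phi0.
rewrite -[leRHS]subr0 -E0 -ExB; [|igt|igt].
rewrite -ExZ; last igt.
apply: ae_le_Ex; [igt|igt|].
apply: filterS m_ae => w /andP[h1 h2].
have b21 : b ^+ 2 <= 1 by rewrite expr_le1// ?(ltW bp)//; move: bh; lra.
have := residE H w; rewrite /phi_score /psi0 /outcome_err /score_weight /h.
have [->|->] := model_binary H 0 w; rewrite ?mul0r ?mul1r ?mulr0 ?mulr1 ?subr0 ?sub0r ?subrr ?mul0r ?subr0 ?mulr1 => re.
  rewrite -re ?subr0 mulrN sqrrN exprMn mulrC ler_wpM2l ?sqr_ge0//.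
  have o1 : b <= odds (m (Z (X0 w))).
    rewrite /odds ler_pdivlMr; last by move: bp; lra.
    have : b * (1 - m (Z (X0 w))) <= b * 1 by rewrite ler_wpM2l ?(ltW bp)//; move: bp; lra.
    lra.
  by rewrite mul1r ler_pXn2r ?nnegrE// ?(ltW bp)//; exact: le_trans (ltW bp) o1.
have -> : Y (X0 w) - g 0 (Z (X0 w)) - att = resid w + h (Z (X0 w)) by rewrite re /h; ring.
rewrite -/(h (Z (X0 w))).
have -> : (resid w + h (Z (X0 w))) ^+ 2 - 2 * h (Z (X0 w)) * resid w = resid w ^+ 2 + h (Z (X0 w)) ^+ 2 by ring.
apply: ler_wpDr; first exact: sqr_ge0.
by rewrite -[leRHS]mul1r ler_wpM2r ?sqr_ge0.
Qed.

Lemma phi0_le v : bin v -> good g m x Lam bg0 bm0 dl K C b v -> `|phi_score v| <= 2 * C * L + 2 * C.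
Proof.
move=> bv gv; have [e1 _ _ e4] := good_facts H bv gv.
apply: (le_trans (ler_normB _ _)); apply: lerD; first by rewrite normrM ler_pM.
rewrite normrM -[leRHS]mulr1; apply: ler_pM => //; first exact: gam_le.
by case: bv => ->; rewrite ?normr0 ?normr1.
Qed.

Lemma measurable_phi0 : measurable_fun setT phi_score.
Proof.
apply: measurable_funB; first by apply: measurable_funM; [exact: (measurable_err H)|exact: (measurable_scoreA H)].
apply: measurable_funM => //.
by apply: (measurableT_comp measurable_snd); exact: measurable_fst.
Qed.

End model_variance.

(** * Plug-in conditions *)

Section sparse_vectors.
Context {R : realType}.

Lemma l0norm_sum p (u : 'rV[R]_p) : l0norm u = (\sum_(j < p) (u 0 j != 0)%R)%N.
Proof. by rewrite l0normE -sum1_card big_mkcond; apply: eq_bigr => j _; rewrite inE; case: (_ != _). Qed.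

Lemma l0normB p (u v : 'rV[R]_p) : (l0norm (u - v) <= l0norm u + l0norm v)%N.
Proof.
rewrite !l0norm_sum -big_split/=; apply: leq_sum => j _; rewrite !mxE.
case: (eqVneq (u 0 j) 0) => [->|_]; last by apply: leq_trans (leq_b1 _) _.
case: (eqVneq (v 0 j) 0) => [->|_]; last by apply: leq_trans (leq_b1 _) _.
by rewrite oppr0 addr0 eqxx.
Qed.

Lemma l0norm_rsubmx p q (u : 'rV[R]_(p + q)) : (l0norm (rsubmx u) <= l0norm u)%N.
Proof.
rewrite !l0norm_sum big_split_ord/=; apply: leq_trans (leq_addl _ _).
by apply: leq_sum => j _; rewrite mxE.
Qed.

Lemma l1norm_rsubmx p q (u : 'rV[R]_(p + q)) : l1norm (rsubmx u) <= l1norm u.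
Proof.
rewrite /l1norm big_split_ord/= ler_wpDl ?sumr_ge0//.
by apply: ler_sum => j _; rewrite mxE.
Qed.

Lemma l0norm_row_mx0 p q (u : 'rV[R]_q) : l0norm (row_mx (0 : 'rV_p) u) = l0norm u.
Proof.
rewrite !l0norm_sum big_split_ord/= big1 ?add0n; last first.
  by move=> j _; rewrite row_mxEl mxE eqxx.
by apply: eq_bigr => j _; rewrite row_mxEr.
Qed.

Lemma dotv0r p (x : 'rV[R]_p) : dotv x 0 = 0.
Proof. by rewrite /dotv big1// => j _; rewrite mxE mulr0. Qed.

Lemma empL2_sum n (f : 'I_n -> R) (r : R) : (0 < n)%N -> 0 <= r ->
  (empL2 f <= r) = (\sum_(i < n) f i ^+ 2 <= n%:R * r ^+ 2).
Proof.
move=> n0 r0; have s0 : 0 <= \sum_(i < n) f i ^+ 2 by apply: sumr_ge0 => i _; exact: sqr_ge0.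
have n0' : 0 < n%:R :> R by rewrite ltr0n.
have e0 : 0 <= (\sum_(i < n) f i ^+ 2) / n%:R by rewrite divr_ge0// ltW.
rewrite /empL2 /Emp -(ler_pXn2r (n := 2))// ?nnegrE ?sqrtr_ge0// sqr_sqrtr//.
by rewrite ler_pdivrMr// mulrC.
Qed.

End sparse_vectors.

Section model_sample.
Context {R : realType} {dZ : measure_display} {Zt : measurableType dZ}.
Context {d : measure_display} {T : measurableType d} {P : probability T R}.
Variables (X : nat -> T -> R * R * Zt) (g : R -> Zt -> R) (m : Zt -> R) (p : nat).
Variables (x : Zt -> 'rV[R]_p) (Lam : R -> R).
Variables (bg0 : 'rV[R]_(p + p)) (bm0 : 'rV[R]_p) (dl rate K C c b : R).

Local Notation Y v := (v.1.1).
Local Notation Dd v := (v.1.2).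
Local Notation Z v := (v.2).
Local Notation X0 := (X 0%N).
Hypothesis H : @model_hyp R dZ Zt d T P X g m p x Lam bg0 bm0 dl rate K C c b.
Let bp : 0 < b. Proof. exact: (overlap_gt0 H). Qed.

Let xt w : 'rV[R]_(p + p) := xtilde (Dd (X0 w)) (x (Z (X0 w))).

Lemma bdotxt (v : 'rV[R]_(p + p)) : aebd P (fun w => dotv (xt w) v).
Proof.
have h1 := aebd_D H; have h2 := aebd_dot H (lsubmx v); have h3 := aebd_dot H (rsubmx v).
have -> : (fun w => dotv (xt w) v) = (fun w => Dd (X0 w) * dotv (x (Z (X0 w))) (lsubmx v)
    + (1 - Dd (X0 w)) * dotv (x (Z (X0 w))) (rsubmx v)).
  by apply/funext => w; rewrite /xt dotv_xtilde.
by bd.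
Qed.

(** Padding [v] with a zero treated block makes [xtilde] see untreated units only. Norm equivalence
    with [dl <= 1/2] bounds their population norm by [2 rate], and overlap extends this to all units
    at the price of [1 / b]. *)
Lemma population_le n w (v : 'rV[R]_p) (B : R) : (0 < n)%N -> dl <= 2^-1 ->
  (forall v' : 'rV[R]_(p + p), v' != 0 -> (l0norm v')%:R <= B ->
    `|empL2 (fun i : 'I_n => dotv (xtilde (Dd (X i w)) (x (Z (X i w)))) v') /
      fine ('N[P]_2%:E[EFin \o (fun w' => dotv (xt w') v')]) - 1| <= dl) ->
  (l0norm v)%:R <= B ->
  \sum_(i < n) (1 - Dd (X i w)) * dotv (x (Z (X i w))) v ^+ 2 <= n%:R * rate ^+ 2 ->
  Ex P (fun w => dotv (x (Z (X0 w))) v ^+ 2) <= 4 / b * rate ^+ 2.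
Proof.
move=> n0 dl2 ratio vB hS.
have rt0 := rate_ge0 H.
have [->|v0] := eqVneq v 0.
  rewrite (_ : (fun w => _) = (fun=> 0)); last by apply/funext => w'; rewrite dotv0r expr0n.
  by rewrite Ex_cst !mulr_ge0 ?sqr_ge0// invr_ge0 ltW.
pose v' := row_mx (0 : 'rV[R]_p) v.
have v'0 : v' != 0.
  by apply: contra_neq v0 => h; have := congr1 rsubmx h; rewrite row_mxKr => ->; rewrite linear0.
have := ratio v' v'0; rewrite l0norm_row_mx0 => /(_ vB).
rewrite L2norm; last exact: bdotxt.
rewrite /=; set E := Ex P _; set e := empL2 _.
have dv' i w' : dotv (xtilde (Dd (X i w')) (x (Z (X i w')))) v' =
    (1 - Dd (X i w')) * dotv (x (Z (X i w'))) v.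
  by rewrite dotv_xtilde row_mxKl row_mxKr dotv0r mulr0 add0r.
have sq i w' : dotv (xtilde (Dd (X i w')) (x (Z (X i w')))) v' ^+ 2 =
    (1 - Dd (X i w')) * dotv (x (Z (X i w'))) v ^+ 2.
  by rewrite dv'; have [->|->] := model_binary H i w'; rewrite ?subrr ?subr0 ?mul0r ?mul1r ?expr0n.
have er : e <= rate.
  by rewrite empL2_sum//; move: hS; congr (_ <= _); apply: eq_bigr => i _; rewrite sq.
have e0 : 0 <= e by exact: sqrtr_ge0.
have E0 : 0 <= E by apply: Ex_ge0 => w'; exact: sqr_ge0.
have s0 : 0 <= Num.sqrt E by exact: sqrtr_ge0.
move=> hr.
(* Division by zero yields 0, so a vanishing population norm would put the ratio at distance 1 from
   1, against [dl <= 1/2]. *)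
have sn0 : Num.sqrt E != 0.
  apply/eqP => h; move: hr; rewrite h invr0 mulr0 sub0r normrN1.
  by move: dl2; lra.
have sp : 0 < Num.sqrt E by rewrite lt_neqAle eq_sym sn0.
have h2 : Num.sqrt E <= 2 * rate.
  have : 2^-1 <= e / Num.sqrt E by move: hr dl2; rewrite ler_norml => /andP[+ _]; lra.
  by rewrite ler_pdivlMr//; move: er; lra.
have h3 : E <= 4 * rate ^+ 2.
  rewrite -(sqr_sqrtr E0) (_ : 4 * rate ^+ 2 = (2 * rate) ^+ 2); last by ring.
  by rewrite ler_pXn2r ?nnegrE// mulr_ge0.
apply: (le_trans (Ex_dot2_overlap H v)).
have -> : Ex P (fun w => (1 - Dd (X0 w)) * dotv (x (Z (X0 w))) v ^+ 2) = E.
  by apply: eq_Ex => w'; rewrite -sq.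
by rewrite mulrAC ler_wpM2r// invr_ge0 ltW.
Qed.

Lemma K_l1norm_rsubmx (u : 'rV[R]_(p + p)) : K * l1norm u <= dl -> K * l1norm (rsubmx u) <= dl.
Proof.
(* [0 <= K] follows from the bound on any one control; without controls the norm is an empty sum. *)
case: (posnP p) => p0.
  move=> _; have -> : l1norm (rsubmx u) = 0; last by rewrite mulr0 ltW// (tolerance_gt0 H).
  by rewrite /l1norm big1// => -[j jp]; exfalso; move: jp; rewrite p0.
apply: le_trans; rewrite ler_wpM2l ?l1norm_rsubmx//.
rewrite -(Ex_cst P 0) -(Ex_cst P K); apply: ae_le_Ex; [exact: ig_cst|exact: ig_cst|].
by apply: filterS (controls_bound H (Ordinal p0)) => o; exact: le_trans.
Qed.

Lemma control_sum_le n w (u : 'rV[R]_(p + p)) : (0 < n)%N ->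
  empL2 (fun i : 'I_n => dotv (xtilde (Dd (X i w)) (x (Z (X i w)))) u) <= rate ->
  \sum_(i < n) (1 - Dd (X i w)) * dotv (x (Z (X i w))) (rsubmx u) ^+ 2 <= n%:R * rate ^+ 2.
Proof.
move=> n0; rewrite empL2_sum ?(rate_ge0 H)//; apply: le_trans; apply: ler_sum => i _.
rewrite dotv_xtilde; have [->|->] := model_binary H i w; rewrite ?subrr ?subr0 ?mul0r ?mul1r ?add0r//.
exact: sqr_ge0.
Qed.

Lemma control_sum_le_all n w (u : 'rV[R]_p) : (0 < n)%N ->
  empL2 (fun i : 'I_n => dotv (x (Z (X i w))) u) <= rate ->
  \sum_(i < n) dotv (x (Z (X i w))) u ^+ 2 <= n%:R * rate ^+ 2 /\
  \sum_(i < n) (1 - Dd (X i w)) * dotv (x (Z (X i w))) u ^+ 2 <= n%:R * rate ^+ 2.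
Proof.
move=> n0; rewrite empL2_sum ?(rate_ge0 H)// => h; split => //.
apply: (le_trans _ h); apply: ler_sum => i _.
have [->|->] := model_binary H i w; rewrite ?subrr ?subr0 ?mul0r ?mul1r//.
exact: sqr_ge0.
Qed.

End model_sample.

(** * Studentization and uniform convergence *)

Section studentize.
Context {R : realType}.
Variables (b mu sg n sn Sd S r gc gam V e1 e2 eps : R).
Hypotheses (b0 : 0 < b) (bmu : b <= mu) (sg0 : 0 < sg) (n0 : 0 < n) (sn0 : 0 < sn).
Hypotheses (snE : sn ^+ 2 = n) (eps0 : 0 < eps) (eps1 : eps <= 1).
Hypotheses (hSd : `|Sd - n * mu| <= e1 * n) (hS : S + r = Sd * (gc - gam)).
Hypotheses (hr : `|r| <= e1 * sn) (hV : `|V - sg ^+ 2| <= e2).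
Hypotheses (e1b : e1 <= eps / 4 * b) (e1s : e1 <= eps / 4 * sg) (e2s : e2 <= eps / 4 * sg ^+ 2).

Let mu0 : 0 < mu. Proof. exact: lt_le_trans bmu. Qed.

Let r1_le : `|Sd / (n * mu) - 1| <= eps / 4.
Proof.
have nm : 0 < n * mu by exact: mulr_gt0.
have -> : Sd / (n * mu) - 1 = (Sd - n * mu) / (n * mu) by field; rewrite !gt_eqF.
rewrite normrM (gtr0_norm (x := _^-1)) ?invr_gt0// ler_pdivrMr//.
apply: (le_trans hSd); have -> : eps / 4 * (n * mu) = eps / 4 * mu * n by ring.
rewrite ler_wpM2r ?(ltW n0)//.
by apply: (le_trans e1b); rewrite ler_wpM2l// divr_ge0// ltW.
Qed.

Let E_le : `|r / (sg * sn)| <= eps / 4.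
Proof.
have nm : 0 < sg * sn by exact: mulr_gt0.
rewrite normrM (gtr0_norm (x := _^-1)) ?invr_gt0// ler_pdivrMr//.
by apply: (le_trans hr); rewrite mulrA ler_wpM2r// ltW.
Qed.

Let q_le : `|V / sg ^+ 2 - 1| <= eps / 4.
Proof.
have s2 : 0 < sg ^+ 2 by exact: exprn_gt0.
have -> : V / sg ^+ 2 - 1 = (V - sg ^+ 2) / sg ^+ 2 by field; rewrite !gt_eqF.
by rewrite normrM (gtr0_norm (x := _^-1)) ?invr_gt0// ler_pdivrMr// (le_trans hV).
Qed.

Lemma V_gt0 : 0 < V.
Proof.
have s2 : 0 < sg ^+ 2 by exact: exprn_gt0.
have : 0 < V / sg ^+ 2 by move: q_le eps1; set q := V / _; rewrite ler_norml => /andP[+ _]; lra.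
by rewrite pmulr_lgt0// invr_gt0.
Qed.

(** [S] is the sum of the limiting scores, [r] the sum of the plug-in remainders, [Sd] the number of
    treated units and [n mu] its mean. Dividing [S + r = Sd (gc - gam)] by [sg sn] leaves
    [Sd / (n mu)] as the random factor. *)
Lemma studentized : exists r' E, [/\ S / (sg * sn) + E = r' * ((sg / mu)^-1 * sn * (gc - gam)),
  `|r' - 1| <= eps & `|E| <= eps].
Proof.
exists (Sd / (n * mu)), (r / (sg * sn)); split.
- rewrite -mulrDl hS -snE; field.
  by rewrite !gt_eqF.
- by apply: (le_trans r1_le); move: eps0; lra.
- by apply: (le_trans E_le); move: eps0; lra.
Qed.

(** The additional factor [y = sqrt V / sg] is close to 1 since [|y - 1| <= |y^2 - 1|] for [y >= 0].
    Tolerances of [eps / 4] leave room for the product of the two factors. *)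
Lemma studentized_hat : exists r' E,
  [/\ S / (sg * sn) + E = r' * ((Num.sqrt V / mu)^-1 * sn * (gc - gam)),
  `|r' - 1| <= eps & `|E| <= eps].
Proof.
have V0 := V_gt0; have sV0 : 0 < Num.sqrt V by rewrite sqrtr_gt0.
exists (Sd / (n * mu) * (Num.sqrt V / sg)), (r / (sg * sn)); split.
- rewrite -mulrDl hS -snE; field.
  by rewrite !gt_eqF.
- have r1' := r1_le; set x := Sd / _ in r1' *; set y := Num.sqrt V / sg.
  have y0 : 0 <= y by rewrite divr_ge0 ?ltW.
  have yE : y ^+ 2 = V / sg ^+ 2 by rewrite expr_div_n sqr_sqrtr// ltW.
  have hy : `|y - 1| <= eps / 4.
    have : `|y - 1| * 1 <= `|y - 1| * `|y + 1| by rewrite ler_wpM2l// ger0_norm; lra.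
    rewrite -normrM -subr_sqr yE expr1n mulr1 => h.
    exact: (le_trans h).
  have -> : x * y - 1 = (x - 1) * (y - 1) + (x - 1) + (y - 1) by ring.
  apply: (le_trans (ler_normD _ _)); apply: (le_trans (lerD (ler_normD _ _) (lexx _))).
  have : `|(x - 1) * (y - 1)| <= eps / 4 * 1.
    by rewrite normrM ler_pM//; move: hy eps1; lra.
  by move: r1' hy; move: eps0; lra.
- by apply: (le_trans E_le); move: eps0; lra.
Qed.

End studentize.

Section dgp.
Context {R : realType} {dZ : measure_display} {Zt : measurableType dZ}.
Variables (D : DGP R Zt) (p : nat) (x : Zt -> 'rV[R]_p) (Lam : R -> R).
Variables (bg0 : 'rV[R]_(p + p)) (bm0 : 'rV[R]_p) (dl rate K C c b : R).
Local Notation P := (dgp_P D).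
Local Notation X := (obs D).
Local Notation g := (dgp_g D).
Local Notation m := (dgp_m D).
Hypothesis H : @model_hyp R dZ Zt _ _ P X g m p x Lam bg0 bm0 dl rate K C c b.
Local Notation mu := (@treat_prob R dZ Zt _ _ P X).
Local Notation gam := (@att R dZ Zt _ _ P X g).
Local Notation phi0 := (@phi_score R dZ Zt _ _ P X g m).

Lemma indic_treated w : \1_[set w' | dgp_d D 0 w' = 1] w = dgp_d D 0 w :> R.
Proof.
rewrite indicE; have := model_binary H 0 w; rewrite /= => -[h|h].
  rewrite memNset ?h// => /=; rewrite h => /eqP; by rewrite eq_sym oner_eq0.
by rewrite mem_set.
Qed.

Lemma mu0_Ex : mu0 D = mu.
Proof.
rewrite /mu0 -Ex_indic; first by apply: eq_Ex => w; exact: indic_treated.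
rewrite -[X in measurable X]setTI; exact: (measurable_D H 0 measurableT (measurable_set1 1)).
Qed.

Lemma gamma0_Ex : gamma0 D = gam.
Proof.
rewrite /gamma0 -/(mu0 D) mu0_Ex unlock; congr (_ / _).
by apply: eq_Ex => w; rewrite indic_treated.
Qed.

Lemma sqrt_sigma2 : Num.sqrt (sigma2 D) = Num.sqrt (Ex P (fun w => phi0 (X 0%N w) ^+ 2)) / mu.
Proof.
have hp := aebd_phi0 H; have /andP[bmu _] := mu_itv H.
have mup : 0 < mu by exact: lt_le_trans (overlap_gt0 H) bmu.
have -> : sigma2 D = mu ^- 2 * Ex P (fun w => phi0 (X 0%N w) ^+ 2).
  rewrite -ExZ; last igt.
  rewrite /sigma2 unlock; apply: eq_Ex => w.
  rewrite phitildeE mu0_Ex gamma0_Ex expr_div_n mulrC.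
  by rewrite /phi_score /psi0 /outcome_err /score_weight.
by rewrite sqrtrM ?invr_ge0 ?sqr_ge0// sqrtrV ?sqr_ge0// sqrtr_sqr gtr0_norm// mulrC.
Qed.

Section sample.
Variables (n : nat) (bgh : 'rV[R]_(p + p)) (bmh : 'rV[R]_p) (w : dgp_Om D).
Local Notation ps := (psih x Lam bg0 bm0 (rsubmx (bgh - bg0)) (bmh - bm0)).

Lemma phitilde_hat (gm mm : R) v :
  phitilde gm v.1.1 v.1.2 (ghat x bgh 0 v.2) (ghat x bgh 1 v.2) (mhat Lam x bmh v.2) mm =
  (ps v - gm * v.1.2) / mm.
Proof.
rewrite phitildeE /psih /ghat /mhat mul0r add0r subr0 mul1r.
by rewrite linearB/= !(addrC _ (_ - _)) !subrK.
Qed.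

(** The estimated treatment frequency stands in the denominator, and [x / 0 = 0]: without treated
    units the estimating equation would say nothing, so their number is assumed positive. *)
Lemma est_eq_sum (gc : R) : (0 < n)%N -> 0 < \sum_(i < n) (X i w).1.2 ->
  est_eq Lam x bgh bmh (sample D n w) gc = 0 ->
  psum X ps n w = gc * \sum_(i < n) (X i w).1.2.
Proof.
move=> n0 S0; rewrite /est_eq /Emp.
under eq_bigr do rewrite phitilde_hat.
rewrite -mulr_suml sumrB -mulr_sumr => /eqP.
have nN0 : n%:R != 0 :> R by rewrite pnatr_eq0 -lt0n.
rewrite !mulf_eq0 !invr_eq0 (negbTE nN0) !orbF => /orP[/eqP h|/eqP h].
  by apply/eqP; rewrite -subr_eq0; apply/eqP.
move/eqP: h; rewrite mulf_eq0 invr_eq0 (negbTE nN0) orbF => /eqP h.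
have h' : \sum_(i < n) (X i w).1.2 = 0 := h.
by move: S0; rewrite h' ltxx.
Qed.

End sample.
End dgp.

Lemma rate_sqr (R : realType) (n : nat) (dl : R) : (0 < n)%N ->
  (dl * n%:R `^ (- 4^-1)) ^+ 2 = dl ^+ 2 / Num.sqrt n%:R.
Proof.
move=> n0; have n0' : 0 <= n%:R :> R by [].
rewrite exprMn; congr (_ * _).
have -> : (n%:R `^ (- 4^-1)) ^+ 2 = n%:R `^ (- 4^-1 * 2%:R) :> R.
  by rewrite powRrM powR_mulrn ?powR_ge0.
have -> : - 4^-1 * 2%:R = - 2^-1 :> R by field.
by rewrite powRN powR12_sqrt.
Qed.

Lemma cvg0_le (R : realType) (u : nat -> R) (e : R) : u @ \oo --> 0 -> 0 < e ->
  exists N : nat, forall n, (N <= n)%N -> u n <= e.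
Proof.
move=> /cvgrPdist_le h e0; have [N _ hN] := h e e0; exists N => n Nn.
by have := hN n Nn; rewrite /= sub0r normrN; apply: le_trans; exact: ler_norm.
Qed.

Section empirical_variance.
Context {R : realType} (n : nat).
Variables (f h : 'I_n -> R) (B e k s2 : R).

(** By [h^2 - f^2 = (h - f) (2 f + (h - f))], uniform closeness to a bounded score passes to second
    moments. *)
Lemma empirical_variance_le : (0 < n)%N -> 0 <= k ->
  (forall i, `|f i| <= B) -> (forall i, `|h i - f i| <= k) ->
  `|\sum_(i < n) (f i ^+ 2 - s2)| <= e * n%:R ->
  `|(\sum_(i < n) h i ^+ 2) / n%:R - s2| <= e + k * (2 * B + k).
Proof.
move=> n0 k0 fB hf hs; have n0' : 0 < n%:R :> R by rewrite ltr0n.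
have -> : (\sum_(i < n) h i ^+ 2) / n%:R - s2 =
    (\sum_(i < n) (f i ^+ 2 - s2) + \sum_(i < n) (h i - f i) * (2 * f i + (h i - f i))) / n%:R.
  rewrite -big_split/= [in RHS](eq_bigr (fun i => h i ^+ 2 - s2)); last by move=> i _; ring.
  by rewrite sumrB sumr_const card_ord -[s2 *+ n]mulr_natr mulrBl mulfK ?gt_eqF//.
rewrite normrM (gtr0_norm (x := n%:R^-1)) ?invr_gt0// ler_pdivrMr//.
apply: (le_trans (ler_normD _ _)); rewrite mulrDl; apply: lerD => //.
apply: (le_trans (ler_norm_sum _ _ _)).
apply: (@le_trans _ _ (\sum_(i < n) k * (2 * B + k))).
  apply: ler_sum => i _; rewrite normrM ler_pM//.
  apply: (le_trans (ler_normD _ _)); rewrite normrM (ger0_norm (x := 2))//.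
  by rewrite lerD// ler_wpM2l.
by rewrite sumr_const card_ord -[leLHS]mulr_natr.
Qed.

End empirical_variance.

Section arithmetic.
Context {R : realType}.
Implicit Types x y z e h k : R.

Lemma bin_centered x y z : x = 0 \/ x = 1 -> 0 < z -> z <= y -> y <= 1 - z -> `|x - y| <= 1.
Proof. by move=> [->|->] *; rewrite ler_norml; apply/andP; split; lra. Qed.

Lemma ler_dist_itv x y z : 0 <= x -> x <= z -> 0 <= y -> y <= z -> `|x - y| <= z.
Proof. by move=> *; rewrite ler_norml; apply/andP; split; lra. Qed.

Lemma quarter_sum x y e : x <= y -> y <= e / 4 * 1 -> x + (y + (y + y)) <= e.
Proof. lra. Qed.

Lemma quarter_lt1 e : e <= 1 -> e / 4 < 1.
Proof. lra. Qed.

Lemma dist_gt0 x y z : `|x - y| <= z -> z < y -> 0 < x.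
Proof. by rewrite ler_norml => /andP[+ _]; lra. Qed.

Lemma quadratic_chain x h k y z e : x <= k -> k <= e * h -> e * (1 + h) <= y -> y <= z ->
  e + x <= z.
Proof. by rewrite mulrDr mulr1; lra. Qed.

End arithmetic.

(** * Uniformity over the class of data-generating processes *)

Section process.
Context {R : realType} {dZ : measure_display} {Zt : measurableType dZ}.
Variables (delta Delta K s : nat -> R) (p : nat -> nat) (C c c' : R).
Variables (Pd : forall n, Zt -> 'rV[R]_(p n)) (Lam : R -> R).
Unset Implicit Arguments.
Variables (bg : forall n, ('I_n -> R * R * Zt) -> 'rV[R]_(p n + p n))
          (bm : forall n, ('I_n -> R * R * Zt) -> 'rV[R]_(p n))
          (gc : forall n, ('I_n -> R * R * Zt) -> R).
Set Implicit Arguments.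
Hypothesis delta0 : forall n, 0 < delta n.
Hypothesis cvg_delta : delta @ \oo --> 0.
Hypothesis cvg_Delta : Delta @ \oo --> 0.
Hypothesis s1 : forall n, 1 <= s n.
Hypothesis C0 : 0 < C.
Hypothesis c0 : 0 < c.
Hypothesis c'b : 0 < c' < 2^-1.
Hypothesis hLam : Lam = id \/ Lam = @logistic R.
Hypothesis mPd : forall n (j : 'I_(p n)), measurable_fun setT (fun zz => Pd n zz 0 j).
Hypothesis est : forall n (w : 'I_n -> R * R * Zt),
  est_eq Lam (Pd n) (bg n w) (bm n w) w (gc n w) = 0.

Local Notation inP := (inPn delta Delta K s C c c' Pd Lam bg bm gc).

Definition Tsig (D : DGP R Zt) n (w : dgp_Om D) : R :=
  (Num.sqrt (sigma2 D))^-1 * Num.sqrt n%:R * (gc n (sample D n w) - gamma0 D).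
Definition That (D : DGP R Zt) n (w : dgp_Om D) : R :=
  (Num.sqrt (sigmahat2 Lam Pd bg bm D n w))^-1 * Num.sqrt n%:R *
  (gc n (sample D n w) - gamma0 D).

Section measurability.
Variables (n : nat) (D : DGP R Zt).
Hypothesis hD : inP n D.

Lemma measurable_gc : measurable_fun setT (fun w => gc n (sample D n w)).
Proof. by case: hD => _ [_ [_ [_ [_ [_ [_ [_ [_ []]]]]]]]]. Qed.

Lemma measurable_Tsig : measurable_fun setT (Tsig (D := D) n).
Proof. by apply: measurable_funM => //; apply: measurable_funB => //; exact: measurable_gc. Qed.

Lemma measurable_sigmahat2 : measurable_fun setT (fun w => sigmahat2 Lam Pd bg bm D n w).
Proof.
case: hD => [[mX _]] [_ [_ [_ [_ [_ [_ [mbg [mbm _]]]]]]]].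
have mZ i : measurable_fun setT (fun w => (obs D i w).2) by exact: (measurableT_comp measurable_snd (mX i)).
have mD i : measurable_fun setT (fun w => (obs D i w).1.2).
  by apply: (measurableT_comp measurable_snd); exact: (measurableT_comp measurable_fst (mX i)).
have mY i : measurable_fun setT (fun w => (obs D i w).1.1).
  by apply: (measurableT_comp measurable_fst); exact: (measurableT_comp measurable_fst (mX i)).
have mx i j : measurable_fun setT (fun w => Pd n (obs D i w).2 0 j) by exact: (measurableT_comp (mPd j) (mZ i)).
have mg0 i : measurable_fun setT (fun w => dotv (Pd n (obs D i w).2) (rsubmx (bg n (sample D n w)))).
  apply: measurable_sum => j; apply: measurable_funM => //.
  by under eq_fun do rewrite mxE; exact: mbg.
have mm i : measurable_fun setT (fun w => dotv (Pd n (obs D i w).2) (bm n (sample D n w))).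
  by apply: measurable_sum => j; apply: measurable_funM => //; exact: mbm.
have mL : measurable_fun setT Lam.
  by have [->|->] := hLam; [exact: measurable_id|exact: measurable_logistic].
apply: measurable_funM => //; apply: measurable_sum => i; apply: measurable_funX.
under eq_fun do rewrite phitildeE.
apply: measurable_funM => //; apply: measurable_funB; last by apply: measurable_funM => //; exact: mD.
apply: measurable_funM.
  apply: measurable_funB; first exact: mY.
  rewrite /ghat; under eq_fun do rewrite mul0r add0r subr0 mul1r.
  exact: mg0.
apply: measurable_funB; first exact: mD.
apply: measurable_funM; first by apply: measurable_funB => //; exact: mD.
by apply: (measurableT_comp (@measurable_odds R)); apply: (measurableT_comp mL); exact: mm.
Qed.

Lemma measurable_That : measurable_fun setT (That (D := D) n).
Proof.
apply: measurable_funM; last by apply: measurable_funB => //; exact: measurable_gc.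
apply: measurable_funM => //; apply: measurable_funV.
exact: (measurableT_comp (continuous_measurable_fun (@sqrt_continuous R)) measurable_sigmahat2).
Qed.

End measurability.

Lemma inPn_model n D : inP n D -> delta n <= c' / 4 -> exists (bg0 : 'rV[R]_(p n + p n)) (bm0 : 'rV[R]_(p n)),
  let rate := delta n * n%:R `^ (- 4^-1) in
  [/\ @model_hyp R dZ Zt _ _ (dgp_P D) (obs D) (dgp_g D) (dgp_m D) (p n) (Pd n) Lam bg0 bm0
        (delta n) rate (K n) C c c',
      (l0norm bg0)%:R <= C * s n /\ (l0norm bm0)%:R <= C * s n,
      (s n * ln (maxn (p n) n)%:R) ^+ 2 / n%:R <= delta n &
      whp (dgp_P D) (Delta n) (fun w =>
        let bgh := bg n (sample D n w) in let bmh := bm n (sample D n w) in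
        [/\ empL2 (fun i : 'I_n => dotv (xtilde (obs D i w).1.2 (Pd n (obs D i w).2)) (bgh - bg0)) <= rate /\
          empL2 (fun i : 'I_n => dotv (Pd n (obs D i w).2) (bmh - bm0)) <= rate,
          K n * l1norm (bgh - bg0) <= delta n /\ K n * l1norm (bmh - bm0) <= delta n,
          (l0norm bgh)%:R <= C * s n, (l0norm bmh)%:R <= C * s n &
          forall v : 'rV[R]_(p n + p n), v != 0 -> (l0norm v)%:R <= 2 * C * s n ->
          `| empL2 (fun i : 'I_n => dotv (xtilde (obs D i w).1.2 (Pd n (obs D i w).2)) v)
             / fine ('N[dgp_P D]_2%:E[EFin \o (fun w' =>
                 dotv (xtilde (obs D 0%N w').1.2 (Pd n (obs D 0%N w').2)) v)]) - 1 | <= delta n])].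
Proof.
case=> [iid [bin [mg0 [mg1 [mm [cz [cv [_ [_ [_ [bg0 [bm0]]]]]]]]]]]].
case=> [rg2 [rgb [rm2 [rmb [b01 [b02 [hE [xK [gC [yC [mc [z4 sln]]]]]]]]]]]] dc.
have /andP[c'0 c'2] := c'b.
exists bg0, bm0 => rate; split => //.
  split => //; rewrite /rate mulr_ge0 ?powR_ge0// ltW//.
have [E [mE [PE EQ]]] := hE.
apply: whp_imp (whp_event mE PE) => w /EQ[h1 [h2 [h3 [h4 [h5 [h6 h7]]]]]].
by split.
Qed.

(** The function [f] is the limiting score divided by its standard deviation. Its bound is
    [Bp / sk], where [sk] bounds the standard deviation from below over the whole class, so [B] and
    [N] precede the process. *)
Lemma uniform_expansion eps : 0 < eps -> eps <= 1 -> exists2 B : R, 0 <= B & exists N : nat,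
  forall n, (N <= n)%N -> forall D, inP n D -> exists f : R * R * Zt -> R,
  [/\ measurable_fun setT f, \forall w \ae dgp_P D, `|f (obs D 0%N w)| <= B,
      Ex (dgp_P D) (fun w => f (obs D 0%N w)) = 0,
      Ex (dgp_P D) (fun w => f (obs D 0%N w) ^+ 2) = 1 &
      whp (dgp_P D) eps (fun w => [/\ 0 < sigmahat2 Lam Pd bg bm D n w,
        exists r E, [/\ psum (obs D) f n w / Num.sqrt n%:R + E = r * Tsig n w,
                        `|r - 1| <= eps & `|E| <= eps] &
        exists r E, [/\ psum (obs D) f n w / Num.sqrt n%:R + E = r * That n w,
                        `|r - 1| <= eps & `|E| <= eps]])].
Proof.
move=> e0 e1; have /andP[cp ch] := c'b.
have [a ma ha] := odds_link hLam c'b.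
pose L := 16 / c' ^+ 3.
have L0 : 0 < L by rewrite divr_gt0// exprn_gt0.
pose Bp := 2 * C * L + 2 * C.
have Bp0 : 0 < Bp by apply: addr_gt0; [apply: mulr_gt0 => //|]; rewrite mulr_gt0.
pose kap := c' ^+ 2 * (c ^+ 2 / (4 * C ^+ 2)).
have kap0 : 0 < kap by rewrite mulr_gt0 ?exprn_gt0// divr_gt0 ?exprn_gt0// mulr_gt0// exprn_gt0.
pose sk := Num.sqrt kap; have sk0 : 0 < sk by rewrite sqrtr_gt0.
pose L3 := (8 * C + 10) * L.
have L30 : 0 < L3 by rewrite mulr_gt0//; move: C0; lra.
pose h3 := L3 * (2 * Bp + L3).
have h30 : 0 < h3 by rewrite mulr_gt0//; apply: addr_gt0 => //; rewrite mulr_gt0.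
have h31 : 0 < 1 + h3 by rewrite addr_gt0.
(* [e2 = eps / 4 * q] is small relative to each denominator: [c'] for the treatment frequency, [sk]
   for the standard deviation, [kap / (1 + h3)] for the variance, where [h3] multiplies [delta n] in
   the plug-in error. *)
pose q := Num.min (Num.min c' sk) (Num.min (kap / (1 + h3)) 1).
have q0 : 0 < q by rewrite !lt_min cp sk0 divr_gt0//=.
have /and4P[q1 q2 q3 q4] : [&& q <= c', q <= sk, q <= kap / (1 + h3) & q <= 1].
  by rewrite /q !ge_min !lexx !orbT.
pose e2 := eps / 4 * q.
have ep4 : 0 < eps / 4 by rewrite divr_gt0.
have e20 : 0 < e2 by rewrite mulr_gt0.
have e2k r : q <= r -> e2 <= eps / 4 * r by move=> h; rewrite /e2 ler_wpM2l// ltW.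
have [eta eta0 [N1 hN1]] := score_remainder C0 cp ch hLam e20.
have [N2 hN2] := weak_lln_ae e20 (@ltr01 R).
have Bp20 : 0 < Bp ^+ 2 by rewrite exprn_gt0.
have [N3 hN3] := weak_lln_ae e20 Bp20.
have eC0 : 0 < eta / (2 * C) by rewrite divr_gt0// mulr_gt0.
(* The last entry turns the sparsity condition into [s ln (maxn p n) <= eta / (2 C) * sqrt n]. *)
pose dm := Num.min (Num.min eta (c' / 4)) (Num.min (Num.min e2 2^-1) ((eta / (2 * C)) ^+ 2)).
have dm0 : 0 < dm by rewrite !lt_min eta0 e20 exprn_gt0// divr_gt0//= invr_gt0 ltr0n.
have [N4 hN4] := cvg0_le cvg_delta dm0.
have [N5 hN5] := cvg0_le cvg_Delta e20.
exists (Bp / sk); first by rewrite divr_ge0 ?ltW.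
exists (maxn 1 (maxn (maxn N1 N2) (maxn N3 (maxn N4 N5)))) => n.
rewrite !geq_max => /andP[n1 /andP[/andP[nN1 nN2] /andP[nN3 /andP[nN4 nN5]]]] D hD.
have := hN4 n nN4; rewrite !le_min => /andP[/andP[d1 d2] /andP[/andP[d3 d4] d5]].
have Dn := hN5 n nN5.
have [bg0 [bm0 [H [k1 k2] sln hE]]] := inPn_model hD d2.
set rate := _ * _ in H hE.
set P := dgp_P D in H hE *; set X := obs D in H hE *.
set g := dgp_g D in H *; set m := dgp_m D in H *.
pose mu := @treat_prob R dZ Zt _ _ P X; pose gam := @att R dZ Zt _ _ P X g.
pose phi0 := @phi_score R dZ Zt _ _ P X g m.
have /andP[bmu mub] := mu_itv H.
have n0 : 0 < n%:R :> R by rewrite ltr0n.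
have sn0 : 0 < Num.sqrt n%:R :> R by rewrite sqrtr_gt0.
have snE : Num.sqrt n%:R ^+ 2 = n%:R :> R by rewrite sqr_sqrtr// ltW.
pose E2 := Ex P (fun w => phi0 (X 0%N w) ^+ 2).
have kE : kap <= E2 := Ex_phi02_ge H.
have E20 : 0 < E2 by exact: lt_le_trans kE.
pose sg := Num.sqrt E2.
have sg0 : 0 < sg by rewrite sqrtr_gt0.
have sksg : sk <= sg by rewrite ler_wsqrtr.
have sg2 : sg ^+ 2 = E2 by rewrite sqr_sqrtr// ltW.
have bphi := aebd_phi0 H; have mphi := measurable_phi0 H.
have phiB v : bin v -> good g m (Pd n) Lam bg0 bm0 (delta n) (K n) C c' v -> `|phi0 v| <= Bp.
  exact: (phi0_le H).
have E2B : E2 <= Bp ^+ 2.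
  rewrite -(Ex_cst P (Bp ^+ 2)); apply: ae_le_Ex; [igt|exact: ig_cst|].
  apply: filterS (ae_bound H phiB) => w h.
  by rewrite -(real_normK (num_real (phi0 _))) ler_pXn2r ?nnegrE ?(ltW Bp0).
have iid := model_iid H.
have mD : measurable_fun setT (fun v : R * R * Zt => v.1.2).
  by apply: (measurableT_comp measurable_snd); exact: measurable_fst.
(* The difference of two vectors with at most [C s] nonzero entries has at most [2 C s], hence at
   most the integer part. *)
pose k := Num.truncn (2 * C * s n).
have sp : 0 <= s n by apply: le_trans (s1 n).
have Cs0 : 0 <= 2 * C * s n by rewrite !mulr_ge0 ?(ltW C0).
have kcond : k%:R * ln (maxn (p n) n)%:R <= eta * Num.sqrt n%:R.
  set l := ln _ in sln *.
  have l0 : 0 <= l by rewrite ln_ge0// ler1n leq_max n1 orbT.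
  apply: (@le_trans _ _ (2 * C * (s n * l))).
    by rewrite mulrA ler_wpM2r// -truncn_ge_nat.
  have : s n * l <= eta / (2 * C) * Num.sqrt n%:R.
    rewrite -(ler_pXn2r (n := 2))// ?nnegrE ?(mulr_ge0 sp l0) ?(mulr_ge0 (ltW eC0) (ltW sn0))//.
    by rewrite exprMn [leRHS]exprMn -exprMn snE -ler_pdivrMr//; exact: le_trans d5.
  rewrite mulrAC ler_pdivlMr ?mulr_gt0//; rewrite mulrC => h; exact: h.
have SR := hN1 n nN1 _ _ _ _ _ X g m (p n) (Pd n) bg0 bm0 (delta n) rate (K n) c k H d1 _ kcond.
have {}SR := SR (eq_ind _ (fun z => z <= _) (lexx _) _ (esym (rate_sqr (delta n) n1))).
have LD : whp P e2 (fun w => `|psum X (fun v => v.1.2 - mu) n w| <= e2 * n%:R).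
  apply: (hN2 n nN2 _ _ _ _ _ X _ iid).
  - exact: measurable_funB.
  - by apply: aeW => w; exact: (bin_centered (model_binary H 0 w) cp bmu mub).
  - have bD' := aebd_D H; rewrite ExB; [|igt|igt].
    by rewrite Ex_cst subrr.
have LP : whp P e2 (fun w => `|psum X (fun v => phi0 v ^+ 2 - sg ^+ 2) n w| <= e2 * n%:R).
  apply: (hN3 n nN3 _ _ _ _ _ X _ iid).
  - by apply: measurable_funB => //; exact: measurable_funX.
  - apply: (ae_bound H (f := fun v => phi0 v ^+ 2 - sg ^+ 2)) => v bv gv.
    have h : phi0 v ^+ 2 <= Bp ^+ 2.
      by rewrite -(real_normK (num_real (phi0 _))) ler_pXn2r ?nnegrE ?(ltW Bp0)// phiB.
    by rewrite sg2; apply: ler_dist_itv; rewrite ?sqr_ge0// ltW.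
  - by rewrite /= ExB; [|igt|igt]; rewrite Ex_cst sg2 subrr.
exists (fun v => phi0 v / sg); split.
- exact: measurable_funM.
- apply: (ae_bound H (f := fun v => phi0 v / sg)) => v bv gv.
  rewrite normrM (gtr0_norm (x := sg^-1)) ?invr_gt0// ler_pM ?phiB ?invr_ge0 ?(ltW sg0)//.
  by rewrite lef_pV2 ?posrE.
- rewrite (_ : (fun w => _) = (fun w => sg^-1 * phi0 (X 0%N w))); last by apply/funext => w; rewrite mulrC.
  by rewrite ExZ ?(Ex_phi0 H) ?mulr0//; igt.
- rewrite (_ : (fun w => _) = (fun w => sg ^- 2 * phi0 (X 0%N w) ^+ 2)); last first.
    by apply/funext => w; rewrite exprMn exprVn mulrC.
  by rewrite ExZ -/E2 ?sg2 ?mulVf ?gt_eqF//; igt.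
have e4 : Delta n + (e2 + (e2 + e2)) <= eps.
  by apply: quarter_sum Dn _; exact: e2k.
apply: (whp_le e4).
apply: whp_imp (whp_and0 (whp_good H) (whp_and hE (whp_and SR (whp_and LD LP)))).
move=> w [gw [[[M1 M2] [K1 K2] l1 l2 ratio] [sr [ld lp]]]].
pose bgh := bg n (sample D n w); pose bmh := bm n (sample D n w).
pose u0 := rsubmx (bgh - bg0); pose um := bmh - bm0.
pose ps := psih (Pd n) Lam bg0 bm0 u0 um.
have l0le (q' : nat) (u v u' : 'rV[R]_q') : (l0norm u)%:R <= C * s n -> (l0norm v)%:R <= C * s n ->
    (l0norm (u - v))%:R <= 2 * C * s n.
  move=> h1 h2; apply: (@le_trans _ _ (l0norm u + l0norm v)%:R); first by rewrite ler_nat l0normB.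
  have -> : 2 * C * s n = C * s n + C * s n by rewrite -mulrA mulr_natl mulr2n.
  by rewrite natrD lerD.
have lu0 : (l0norm u0)%:R <= 2 * C * s n.
  apply: le_trans (l0le _ _ _ 0 l1 k1); rewrite ler_nat; exact: l0norm_rsubmx.
have lum : (l0norm um)%:R <= 2 * C * s n by exact: (l0le _ _ _ 0 l2 k2).
have d21 : delta n <= 2^-1 by [].
have Ku0 := K_l1norm_rsubmx H K1.
have S0 := control_sum_le H n1 M1.
have [Sm Sm'] := control_sum_le_all H n1 M2.
have R_le : `|psum X (fun v => ps v - psi0 g m v) n w| <= e2 * Num.sqrt n%:R.
  apply: sr => //.
  - by rewrite truncn_ge_nat.
  - by rewrite truncn_ge_nat.
  - exact: (population_le H n1 d21 ratio lu0 S0).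
  - exact: (population_le H n1 d21 ratio lum Sm').
pose Sd := \sum_(i < n) (X i w).1.2.
have Sd_le : `|Sd - n%:R * mu| <= e2 * n%:R.
  move: ld; rewrite /psum sumrB sumr_const card_ord -[mu *+ n]mulr_natl.
  by [].
have mup : 0 < mu by exact: lt_le_trans bmu.
(* [e2 < c' <= mu], so on this event the sample contains treated units and the estimating equation
   determines [gc]. *)
have Sd0 : 0 < Sd.
  have : e2 * n%:R < mu * n%:R.
    rewrite ltr_pM2r//; apply: lt_le_trans bmu.
    by apply: le_lt_trans (e2k _ q1) _; rewrite gtr_pMl//; exact: quarter_lt1.
  by rewrite (mulrC mu); exact: (dist_gt0 Sd_le).
have estw : psum X ps n w = gc n (sample D n w) * Sd := est_eq_sum bg0 bm0 n1 Sd0 (est (sample D n w)).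
have SRE : psum X phi0 n w + psum X (fun v => ps v - psi0 g m v) n w =
    Sd * (gc n (sample D n w) - gam).
  rewrite mulrBr [Sd * gc _ _]mulrC -estw /Sd mulr_suml /psum -big_split -sumrB/=.
  apply: eq_bigr => i _; rewrite /phi0 /phi_score -/gam; change (dgp_d D i w) with (X i w).1.2.
  by ring.
pose V := (\sum_(i < n) (ps (X i w) - gam * (X i w).1.2) ^+ 2) / n%:R.
pose kk := L3 * delta n.
have kk0 : 0 <= kk by rewrite mulr_ge0// ltW.
have V_le : `|V - sg ^+ 2| <= e2 + kk * (2 * Bp + kk).
  apply: (@empirical_variance_le _ _ (fun i => phi0 (X i w))) => //.
  - by move=> i; apply: phiB => //; exact: (model_binary H).
  - move=> i; rewrite (_ : _ - phi0 _ = ps (X i w) - psi0 g m (X i w)); last first.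
      by rewrite /phi0 /phi_score -/gam; ring.
    exact: (psih_close H ha (model_binary H i w) (gw i) Ku0 K2).
have V_le2 : e2 + kk * (2 * Bp + kk) <= eps / 4 * sg ^+ 2.
  have h1 : kk <= L3 by rewrite /kk ler_piMr ?(ltW L30)//; apply: (le_trans d4); rewrite invf_le1// ler1n.
  have h2 : kk * (2 * Bp + kk) <= kk * (2 * Bp + L3) by rewrite ler_wpM2l// lerD2l.
  have h4 : kk * (2 * Bp + L3) = delta n * h3 by rewrite /kk /h3; ring.
  have h5 : delta n * h3 <= e2 * h3 by rewrite ler_wpM2r// ltW.
  have h6 : e2 * (1 + h3) <= eps / 4 * kap.
    by rewrite -ler_pdivlMr// -[leRHS]mulrA; exact: (e2k _ q3).
  have h7 : eps / 4 * kap <= eps / 4 * sg ^+ 2 by rewrite sg2 ler_wpM2l// ltW.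
  by apply: (quadratic_chain h2 _ h6 h7); rewrite h4.
have e2b : e2 <= eps / 4 * c' by exact: e2k.
have e2s : e2 <= eps / 4 * sg by apply: e2k; exact: le_trans sksg.
have V0 : 0 < V := V_gt0 sg0 e1 V_le V_le2.
have shE : sigmahat2 Lam Pd bg bm D n w = V / mu ^+ 2.
  rewrite /sigmahat2 /Emp /V mulrAC; congr (_ / _).
  rewrite mulr_suml; apply: eq_bigr => i _.
  rewrite (phitilde_hat (Pd n) Lam bg0 bm0) expr_div_n.
  by rewrite (gamma0_Ex H) (mu0_Ex H).
have psE : psum X (fun v => phi0 v / sg) n w / Num.sqrt n%:R =
    psum X phi0 n w / (sg * Num.sqrt n%:R).
  by rewrite /psum -mulr_suml invfM mulrA.
rewrite psE; split.
- by rewrite shE divr_gt0// exprn_gt0.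
- rewrite /Tsig (sqrt_sigma2 H) (gamma0_Ex H).
  exact: (studentized cp bmu sg0 n0 sn0 snE e0 Sd_le SRE R_le e2b e2s).
- rewrite /That shE sqrtrM ?(ltW V0)// sqrtrV ?sqr_ge0// sqrtr_sqr (gtr0_norm mup) (gamma0_Ex H).
  exact: (studentized_hat cp bmu sg0 n0 sn0 snE e0 e1 Sd_le SRE R_le V_le e2b e2s V_le2).
Qed.

Lemma uniform_clt t eps : 0 < eps -> exists N : nat, forall n, (N <= n)%N -> forall D, inP n D ->
  [/\ `|fine (dgp_P D [set w | Tsig n w <= t]) - Phi t| <= eps,
      `|fine (dgp_P D [set w | That n w <= t]) - Phi t| <= eps &
      whp (dgp_P D) eps (fun w => 0 < sigmahat2 Lam Pd bg bm D n w)].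
Proof.
move=> ep0.
have t2 : 0 < 2 * (`|t| + 2) by rewrite mulr_gt0// ltr_wpDl.
(* Slutsky's lemma costs [e + e (|t| + 1) <= eps / 2]; the other half is [4 k = eps / 4] plus the
   term of order [n^(-1/2)]. *)
pose e := Num.min 2^-1 (eps / (2 * (`|t| + 2))).
have e0 : 0 < e by rewrite lt_min invr_gt0 ltr0n divr_gt0.
have e2 : e <= 2^-1 by rewrite ge_min lexx.
have et : e * (`|t| + 2) <= eps / 2.
  have : e <= eps / (2 * (`|t| + 2)) by rewrite ge_min lexx orbT.
  by rewrite ler_pdivlMr//; lra.
have e1 : e <= 1 by lra.
have [B B0 [N1 hN1]] := uniform_expansion e0 e1.
pose k := eps / 16; have k0 : 0 < k by rewrite divr_gt0.
pose M := 3 * (k ^- 2) ^+ 3 * (B ^+ 3 + @gauss_cube R).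
have [N2 hN2] := sqrtn_big (M / (eps / 4)).
exists (maxn 1 (maxn N1 N2)) => n; rewrite !geq_max => /andP[n1 /andP[nN1 nN2]] D hD.
have [f [mf fB f0 f1 hW]] := hN1 n nN1 D hD.
have iid : iid_seq (dgp_P D) (obs D) by case: hD.
have sn0 : 0 < Num.sqrt n%:R :> R by rewrite sqrtr_gt0 ltr0n.
have hM : M / Num.sqrt n%:R <= eps / 4.
  rewrite ler_pdivrMr// mulrC -ler_pdivrMr ?divr_gt0//; exact: hN2.
pose W w := psum (obs D) f n w / Num.sqrt n%:R.
have mW : measurable_fun setT W.
  by apply: measurable_funM => //; apply: measurable_psum => //; case: iid.
have clt s' : `|fine (dgp_P D [set w | W w <= s']) - Phi s'| <= eps / 2.
  apply: (le_trans (clt_bound_ae s' iid mf B0 fB f0 f1 n1 k0)); rewrite -/M.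
  by rewrite /k; move: hM; lra.
have e01 : 0 <= e < 1 by apply/andP; split; lra.
have fin : e + eps / 2 + e * (`|t| + 1) <= eps by move: et; lra.
split.
- apply: le_trans fin; apply: (slutsky t mW (measurable_Tsig hD) e01 clt).
  by apply: whp_imp hW => w [].
- apply: le_trans fin; apply: (slutsky t mW (measurable_That hD) e01 clt).
  by apply: whp_imp hW => w [].
- apply: (whp_le (e := e)); last by apply: whp_imp hW => w [].
  apply: (@le_trans _ _ (e * (`|t| + 2))); last lra.
  by rewrite ler_peMr ?(ltW e0)//; have := normr_ge0 t; lra.
Qed.

Definition ci (q : R) n (D : DGP R Zt) : set (dgp_Om D) :=
  [set w | gc n (sample D n w) - q * Num.sqrt (sigmahat2 Lam Pd bg bm D n w) / Num.sqrt n%:R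
     <= gamma0 D <=
     gc n (sample D n w) + q * Num.sqrt (sigmahat2 Lam Pd bg bm D n w) / Num.sqrt n%:R].
Arguments ci : clear implicits.

Lemma measurable_ci q n D : inP n D -> measurable (ci q n D).
Proof.
move=> hD; have mg := measurable_gc hD.
have ms : measurable_fun setT (fun w => q * Num.sqrt (sigmahat2 Lam Pd bg bm D n w) / Num.sqrt n%:R).
  apply: measurable_funM => //; apply: measurable_funM => //.
  exact: (measurableT_comp (continuous_measurable_fun (@sqrt_continuous R)) (measurable_sigmahat2 hD)).
have -> : ci q n D = [set w | gc n (sample D n w) - q * Num.sqrt (sigmahat2 Lam Pd bg bm D n w) / Num.sqrt n%:R <= gamma0 D]
   `&` [set w | gamma0 D <= gc n (sample D n w) + q * Num.sqrt (sigmahat2 Lam Pd bg bm D n w) / Num.sqrt n%:R].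
  by apply/seteqP; split => w /=; [move/andP|move=> [h1 h2]; apply/andP].
apply: measurableI; apply: measurable_le_set => //.
  exact: measurable_funB.
exact: measurable_funD.
Qed.

(** Positivity matters: at [sigmahat2 = 0] the inverse is 0, so [That] is 0 while the interval
    shrinks to a point. *)
Lemma ciE q n D w : (0 < n)%N -> 0 < sigmahat2 Lam Pd bg bm D n w ->
  ci q n D w <-> - q <= That n w <= q.
Proof.
move=> n0 s0; rewrite /ci /That /=; set sh := Num.sqrt (sigmahat2 _ _ _ _ _ _ _).
have sh0 : 0 < sh by rewrite sqrtr_gt0.
set r := Num.sqrt n%:R; have r0 : 0 < r by rewrite sqrtr_gt0 ltr0n.
set G := gc n _; set g0 := gamma0 D.
have shr : 0 < sh / r by rewrite divr_gt0.
have E : sh^-1 * r * (G - g0) = (G - g0) / (sh / r) by rewrite invf_div mulrC (mulrC r).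
have E1 : (- q <= sh^-1 * r * (G - g0)) = (- q * (sh / r) <= G - g0) by rewrite E ler_pdivlMr.
have E2 : (sh^-1 * r * (G - g0) <= q) = (G - g0 <= q * (sh / r)) by rewrite E ler_pdivrMr.
rewrite E1 E2 mulNr mulrA.
by set z := _ / r; split => /andP[h1 h2]; apply/andP; split; lra.
Qed.

Lemma coverage xi eps : 0 < xi < 1 -> 0 < eps -> exists N : nat, forall n, (N <= n)%N ->
  forall D, inP n D -> `|fine (dgp_P D (ci (Phiinv (1 - xi / 2)) n D)) - (1 - xi)| <= eps.
Proof.
move=> /andP[xi0 xi1] ep0; set q := Phiinv _.
have Pq : Phi q = 1 - xi / 2 by apply: Phi_Phiinv; apply/andP; split; lra.
(* [Phi 0 = 1/2] by symmetry, below [1 - xi / 2]. *)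
have q0 : 0 < q.
  rewrite ltNge; apply/negP => /Phi_le; rewrite Pq.
  by have := PhiN (0 : R); rewrite oppr0; lra.
have PNq : Phi (- q) = xi / 2 by rewrite PhiN Pq; lra.
pose e := eps / 5; have e0 : 0 < e by rewrite divr_gt0.
have [N1 hN1] := uniform_clt q e0.
have [N2 hN2] := uniform_clt (- q) e0.
(* The interval is closed, so it contains the case [That = - q], which the distribution function at
   [- q] already counts. The upper bound uses the threshold [- q - e] instead, at the price of [e]
   by the Lipschitz bound. *)
have [N3 hN3] := uniform_clt (- q - e) e0.
exists (maxn 1 (maxn N1 (maxn N2 N3))) => n.
rewrite !geq_max => /andP[n0 /andP[nN1 /andP[nN2 nN3]]] D hD.
have [_ a1 hs] := hN1 n nN1 D hD; have [_ a2 _] := hN2 n nN2 D hD; have [_ a3 _] := hN3 n nN3 D hD.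
have mT s' : measurable [set w | That (D := D) n w <= s'].
  by apply: measurable_le_set => //; exact: measurable_That.
have mci := measurable_ci q hD.
have PD s' : s' <= q -> fine (dgp_P D ([set w | That n w <= q] `\` [set w | That n w <= s'])) =
    fine (dgp_P D [set w | That n w <= q]) - fine (dgp_P D [set w | That n w <= s']).
  move=> sq; rewrite measureD//; last by rewrite ltey_eq fin_num_measure.
  rewrite fineB ?fin_num_measure//; last exact: measurableI.
  congr (_ - fine (dgp_P D _)); apply/seteqP; split => w /=; first by case.
  by move=> h; split => //; exact: le_trans sq.
have U : fine (dgp_P D (ci q n D)) <=
    fine (dgp_P D ([set w | That n w <= q] `\` [set w | That n w <= - q - e])) + e.
  apply: (whp_prob_le mci (measurableD (mT _) (mT _)) hs) => w s0 /(ciE q n0 s0)/andP[h1 h2].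
  by split => //=; apply/negP; rewrite -ltNge; lra.
have Lo : fine (dgp_P D ([set w | That n w <= q] `\` [set w | That n w <= - q])) <=
    fine (dgp_P D (ci q n D)) + e.
  apply: (whp_prob_le (measurableD (mT _) (mT _)) mci hs) => w s0 [/= h1 /negP].
  by rewrite -ltNge => h2; apply/(ciE q n0 s0)/andP; split => //; exact: ltW.
have q1 : - q - e <= q by lra.
have q2 : - q <= q by lra.
rewrite (PD _ q1) in U; rewrite (PD _ q2) in Lo.
have : Phi (- q) <= Phi (- q - e) + (- q - (- q - e)) by apply: Phi_lip; lra.
move: a1 a2 a3; rewrite !ler_norml PNq Pq => /andP[? ?] /andP[? ?] /andP[? ?] ?.
have eE : eps = 5 * e by rewrite /e; lra.
by apply/andP; split; lra.
Qed.

End process.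

Lemma cvg_eventually_le (R : realType) (u : nat -> R) (l : R) :
  (forall e, 0 < e -> exists N : nat, forall n, (N <= n)%N -> `|u n - l| <= e) ->
  u @ \oo --> l.
Proof.
move=> h; apply/cvgrPdist_le => e e0; have [N hN] := h e e0.
by exists N => // n Nn; rewrite distrC; exact: hN.
Qed.

Unset Implicit Arguments. Set Strict Implicit. Set Printing Implicit Defensive.

Theorem theorem2 (R : realType) (dZ : measure_display) (Zt : measurableType dZ)
  (delta Delta K s : nat -> R) (p : nat -> nat) (C c c' : R)
  (Pd : forall n, Zt -> 'rV[R]_(p n)) (Lam : R -> R)
  (bg : forall n, ('I_n -> R * R * Zt) -> 'rV[R]_(p n + p n))
  (bm : forall n, ('I_n -> R * R * Zt) -> 'rV[R]_(p n))
  (gc : forall n, ('I_n -> R * R * Zt) -> R) :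
  (forall n, 0 < delta n) -> nonincreasing_seq delta -> delta @ \oo --> 0 ->
  (forall n, 0 < Delta n) -> nonincreasing_seq Delta -> Delta @ \oo --> 0 ->
  (forall n, 1 <= s n) -> 0 < C -> 0 < c -> 0 < c' < 2^-1 ->
  (Lam = id \/ Lam = @logistic R) ->
  (forall n (j : 'I_(p n)), measurable_fun setT (fun zz => Pd n zz 0 j)) ->
  (* check-gamma solves the estimating equation *)
  (forall n (w : 'I_n -> R * R * Zt),
      est_eq Lam (Pd n) (bg n w) (bm n w) w (gc n w) = 0) ->
  let inP := inPn delta Delta K s C c c' Pd Lam bg bm gc in
  (* (1) *)
  (forall D : nat -> DGP R Zt, (forall n, inP n (D n)) ->
     cvg_dist_N01 D (fun n w => (Num.sqrt (sigma2 (D n)))^-1 * Num.sqrt n%:R *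
                                 (gc n (sample (D n) n w) - gamma0 (D n)))) /\
  (* (2) *)
  (forall D : nat -> DGP R Zt, (forall n, inP n (D n)) ->
     cvg_dist_N01 D (fun n w => (Num.sqrt (sigmahat2 Lam Pd bg bm (D n) n w))^-1 *
                                 Num.sqrt n%:R *
                                 (gc n (sample (D n) n w) - gamma0 (D n)))) /\
  (* (3) *)
  (forall xi : R, 0 < xi < 1 -> forall eps : R, 0 < eps ->
     exists N : nat, forall n : nat, (N <= n)%N -> forall D : DGP R Zt, inP n D ->
       `| fine (dgp_P D
            [set w | let q := Phiinv (1 - xi / 2) in
                     let sh := Num.sqrt (sigmahat2 Lam Pd bg bm D n w) in
                     let gch := gc n (sample D n w) in
                     gch - q * sh / Num.sqrt n%:R <= gamma0 D <=
                     gch + q * sh / Num.sqrt n%:R])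
          - (1 - xi) | <= eps).
Proof.
move=> d0 _ cd _ _ cD s1 C0 c0 cb hL mPd est inP; split; last split.
- move=> D hD t; apply: cvg_eventually_le => e e0.
  have [N hN] := uniform_clt K d0 cd cD s1 C0 c0 cb hL mPd est t e0.
  by exists N => n Nn; have [] := hN n Nn (D n) (hD n).
- move=> D hD t; apply: cvg_eventually_le => e e0.
  have [N hN] := uniform_clt K d0 cd cD s1 C0 c0 cb hL mPd est t e0.
  by exists N => n Nn; have [] := hN n Nn (D n) (hD n).
- move=> xi hxi e e0.
  have [N hN] := coverage K d0 cd cD s1 C0 c0 cb hL mPd est hxi e0.
  by exists N => n Nn D hD; exact: (hN n Nn D hD).
Qed.
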